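(* Let $d\geq 2$ and $0<\lambda^*<\infty$. There exists a constant $\beta_0=\beta_0(\lambda^*,d)<\infty$ such that for every $\beta\geq\beta_0$ and every symmetric distribution $\mathsf{P}$ of the boundary fields with zero mean, strictly positive variance, and satisfying $\mathsf{P}(|\lambda_0|>\lambda^* )=0$, the following hold: (1) If $d>3$, then $\mathsf{P}$-almost surely the set of (weak) limit points of the sequence $\{\mu_n^\lambda\}_{n\in\mathbb{N}}$ is exactly $\{\mu^+,\mu^-\}$. (2) If $d\in\{2,3\}$ and $\omega>0$, then $\mathsf{P}$-almost surely the set of (weak) limit points of the sequence $\{\mu_{[n^{4-d+\omega}]}^\lambda\}_{n\in\mathbb{N}}$ is exactly $\{\mu^+,\mu^-\}$ (here $[\cdot]$ denotes the integer part).
   Context: Fix $d\geq 2$. For $n\in\mathbb{N}$ let $\Lambda_n=\{x\in\mathbb{Z}^d: -\tfrac n2<x_i\leq \tfrac n2,\ i=1,\dots,d\}$, let $\partial\Lambda_n$ be the set of $x\in\Lambda_n$ having at least one nearest neighbour in $\mathbb{Z}^d\setminus\Lambda_n$, and $\Omega_n=\{-1,1\}^{\Lambda_n}$. Let $\lambda=(\lambda_x)_{x\in\mathbb{Z}^d}$ be independent identically distributed real random variables with (product) law $\mathsf{P}$. For $\beta>0$ and $\sigma_n\in\Omega_n$ set $H_n^\lambda(\sigma_n)=-\beta\sum_{\langle x,y\rangle,\,x,y\in\Lambda_n}(\sigma_x\sigma_y-1)-\sum_{x\in\partial\Lambda_n}\lambda_x\sigma_x$, where $\langle x,y\rangle$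 runs over unordered nearest-neighbour pairs, and let $\mu_n^\lambda(\sigma_n)=e^{-H_n^\lambda(\sigma_n)}/Z_n^\lambda$ with $Z_n^\lambda=\sum_{\sigma_n\in\Omega_n}e^{-H_n^\lambda(\sigma_n)}$ (a random probability measure on $\Omega_n$). Similarly let $H_n^\pm(\sigma_n)=-\beta\sum_{\langle x,y\rangle,\,x,y\in\Lambda_n}(\sigma_x\sigma_y-1)\mp\beta\sum_{x\in\partial\Lambda_n}\sigma_x$ and $\mu_n^\pm$ the corresponding Gibbs measures on $\Omega_n$; $\mu^\pm$ denote their weak limits as $n\to\infty$, i.e. the plus and minus Gibbs states of the nearest-neighbour Ising model at inverse temperature $\beta$ on $\mathbb{Z}^d$. Weak convergence of measures on $\Omega_n$ to a measure on $\{-1,1\}^{\mathbb{Z}^d}$ means convergence of the expectations of every function depending on finitely many spins (these sites being contained in $\Lambda_n$ for all large $n$). *)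

(* Defs.v *)
From HB Require Import structures.
From mathcomp Require Import all_boot all_order all_algebra.
From mathcomp Require Import all_classical all_reals all_analysis.
Set Implicit Arguments. Unset Strict Implicit. Unset Printing Implicit Defensive.
Import Order.TTheory GRing.Theory Num.Theory.
Import numFieldNormedType.Exports.
Local Open Scope classical_set_scope.
Local Open Scope ring_scope.

Definition site (d : nat) := {ffun 'I_d -> int}.
Definition origin (d : nat) : site d := [ffun=> 0].
Definition config (d : nat) := site d -> bool.
Definition spin (R : pzRingType) (b : bool) : R := if b then 1 else -1.

Definition adj d (x y : site d) : bool :=
  (\sum_(i < d) `|x i - y i|)%N == 1%N.

Definition in_box d (n : nat) (x : site d) : bool :=
  [forall i, (- (n%:Z) < 2 * x i) && (2 * x i <= n%:Z)].

(* A finite type in bijection with Lambda_n: coordinate k : 'I_n encodes the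
   integer k + floor(n/2) + 1 - n, so that 'I_n is mapped onto
   { -n/2 < z <= n/2 }. *)
Definition boxpt (d n : nat) := {ffun 'I_d -> 'I_n}.
Definition site_of d n (x : boxpt d n) : site d :=
  [ffun i => ((x i : nat)%:Z + (n %/ 2)%:Z + 1 - n%:Z)%R].

Definition on_boundary d n (x : boxpt d n) : bool :=
  `[< exists y : site d, adj (site_of x) y /\ ~~ in_box n y >].

(* H_n(sigma) = -beta sum_{<x,y>} (s_x s_y - 1) - sum_{x in bd} h_x s_x;
   the sum over unordered pairs is half the sum over ordered pairs. *)
Definition hamiltonian (R : realType) d n (beta : R) (h : boxpt d n -> R)
    (s : {ffun boxpt d n -> bool}) : R :=
  - beta * ((\sum_(x : boxpt d n) \sum_(y : boxpt d n | adj (site_of x) (site_of y))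
                (spin R (s x) * spin R (s y) - 1)) / 2)
  - \sum_(x : boxpt d n | on_boundary x) h x * spin R (s x).

(* extension of a box configuration to Z^d (arbitrary value +1 outside) *)
Definition extend d n (s : {ffun boxpt d n -> bool}) : config d :=
  fun z => if [pick x : boxpt d n | site_of x == z] is Some x then s x else true.

Definition gibbs_exp (R : realType) d n (beta : R) (h : boxpt d n -> R)
    (f : config d -> R) : R :=
  (\sum_(s : {ffun boxpt d n -> bool}) f (extend s) * expR (- hamiltonian beta h s))
  / (\sum_(s : {ffun boxpt d n -> bool}) expR (- hamiltonian beta h s)).

Definition plus_exp (R : realType) d (beta : R) (n : nat) (f : config d -> R) : R :=
  gibbs_exp (n := n) beta (fun _ => beta) f.
Definition minus_exp (R : realType) d (beta : R) (n : nat) (f : config d -> R) : R :=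
  gibbs_exp (n := n) beta (fun _ => - beta) f.

Definition local_fun (R : realType) d (f : config d -> R) : Prop :=
  exists S : seq (site d), forall s t : config d,
    (forall z, z \in S -> s z = t z) -> f s = f t.

(* A state is identified with its expectation functional on local functions;
   weak convergence = convergence of expectations of all local functions. *)
Definition weak_limit (R : realType) d (E : nat -> (config d -> R) -> R)
    (nu : (config d -> R) -> R) : Prop :=
  forall f, local_fun f -> (fun n => E n f) @ \oo --> nu f.

Definition weak_limit_point (R : realType) d (E : nat -> (config d -> R) -> R)
    (nu : (config d -> R) -> R) : Prop :=
  exists phi : nat -> nat, (forall k, (phi k < phi k.+1)%N) /\
    weak_limit (fun k => E (phi k)) nu.

Definition limit_points_are_pm (R : realType) d (beta : R)
    (E : nat -> (config d -> R) -> R) : Prop :=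
  forall nu, weak_limit_point E nu <->
    (weak_limit (@plus_exp R d beta) nu \/ weak_limit (@minus_exp R d beta) nu).

Definition rf_exp (R : realType) d (beta : R) (lam : site d -> R) (n : nat)
    (f : config d -> R) : R :=
  gibbs_exp (n := n) beta (fun x => lam (site_of x)) f.

Definition iid_field d0 (T : measurableType d0) (R : realType)
    (P : probability T R) d (lam : site d -> {RV P >-> R}) : Prop :=
  (forall x (B : set R), measurable B ->
      P (lam x @^-1` B) = P (lam (origin d) @^-1` B)) /\
  (forall (s : seq (site d)) (B : site d -> set R), uniq s ->
      (forall x, measurable (B x)) ->
      P (\bigcap_(x in [set` s]) (lam x @^-1` B x)) =
      (\prod_(x <- s) P (lam x @^-1` B x))%E).

(* Main.v *)
(** For large [beta] the Gibbs measure in a box splits, by Peierls' argument,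
    into a phase which is plus outside all contours and the phase obtained from
    it by a global flip.  Boundary fields bounded by [lamstar] only change the
    energy of a contour by a small fraction, so that for any such fields the
    expectation of a local function in the plus phase is close to the one for
    plus boundary conditions: take two independent configurations, one from each
    measure, and exchange their contours near the support of the function; this
    fails only if a chain of contours reaches far away.  Hence everything depends
    on the ratio [Z+/Z-] of the weights of the two phases.

    Raising the field at a site of the boundary by [u] multiplies [Z+/Z-] by at
    least [1 + u].  Conditionally on the absolute values of the fields, the sign
    patterns for which [Z+/Z-] lies in a short window therefore contain no two
    comparable patterns differing at sites with a large field, and by Sperner's
    theorem and the symmetry of the law such a window has probability of order
    [|boundary|^(-1/2)].  This is summable along the given sequences of boxes,
    so that by Borel-Cantelli [Z+/Z-] eventually leaves every window [1/k, k).
    Both signs of [ln (Z+/Z-)] recur: flipping all fields on the boundary of one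
    box inverts its ratio, and boxes whose sizes differ by 2 have disjoint
    boundaries, so that a prescribed sign for [m] such boxes has probability at
    most [2^-m]. *)
Require Import Defs.
From HB Require Import structures.
From mathcomp Require Import all_boot all_order all_algebra.
From mathcomp Require Import zify ring lra.
Set Implicit Arguments. Unset Strict Implicit. Unset Printing Implicit Defensive.
Import Order.TTheory GRing.Theory Num.Theory.

(** * Cutsets and contours on a finite grid *)

Section Grid.
Variables (d N : nat).
Local Notation V := {ffun 'I_d -> 'I_N}.
Local Notation E := (V * 'I_d)%type.
Implicit Types (x y z : V) (i j k : 'I_d) (f g : V -> bool) (D A W : {set E}).

Definition setc x i (t : 'I_N) : V := [ffun j => if j == i then t else x j].
Definition succ_sat (a : 'I_N) : 'I_N := insubd a a.+1.
(* Saturating successor in direction [i]: [up x i = x] on the upper face, so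
   that the edge [(x, i)] is then degenerate and never belongs to a cutset. *)
Definition up x i : V := setc x i (succ_sat (x i)).
Definition cutset f : {set E} := [set e | f e.1 != f (up e.1 e.2)].

Definition even_set A : Prop :=
  (forall x i j, ((x, i) \in A) (+) ((up x i, j) \in A) =
                 ((x, j) \in A) (+) ((up x j, i) \in A)) /\
  (forall x i, up x i = x -> (x, i) \notin A).

Lemma val_succ_sat (a : 'I_N) : succ_sat a = (if a.+1 < N then a.+1 else a) :> nat.
Proof. by rewrite val_insubd. Qed.

Lemma setcE x i t j : setc x i t j = if j == i then t else x j.
Proof. by rewrite ffunE. Qed.

Lemma setc_id x i : setc x i (x i) = x.
Proof. by apply/ffunP => j; rewrite setcE; case: eqP => [->|]. Qed.

Lemma setc_setc x i t s : setc (setc x i t) i s = setc x i s.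
Proof. by apply/ffunP => j; rewrite !setcE; case: eqP. Qed.

Lemma setcC x i j t s : i != j -> setc (setc x i t) j s = setc (setc x j s) i t.
Proof.
move=> ij; apply/ffunP => k; rewrite !setcE.
by case: (k =P j) => [->|//]; rewrite eq_sym (negbTE ij).
Qed.

Lemma upC x i j : up (up x i) j = up (up x j) i.
Proof.
case: (eqVneq i j) => [->//|ij].
rewrite /up setcC // !setcE (negbTE ij).
by rewrite [j == i]eq_sym (negbTE ij).
Qed.

Lemma cut_even f : even_set (cutset f).
Proof.
split=> [x i j|x i e]; last by rewrite inE /= e eqxx.
rewrite !inE /= (upC x i j).
by case: (f x); case: (f (up x i)); case: (f (up x j)); case: (f _).
Qed.

Lemma cut_addb f g : cutset (fun x => f x (+) g x) = (cutset f :\: cutset g) :|: (cutset g :\: cutset f).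
Proof.
apply/setP => e; rewrite !inE.
by case: (f _); case: (f _); case: (g _); case: (g _).
Qed.

Lemma cut_negb f : cutset (fun x => ~~ f x) = cutset f.
Proof. by apply/setP => e; rewrite !inE; case: (f _); case: (f _). Qed.

Lemma eq_cut f g : f =1 g -> cutset f = cutset g.
Proof. by move=> fg; apply/setP => e; rewrite !inE !fg. Qed.

Lemma up_setc x i (t : 'I_N) : up (setc x i t) i = setc x i (succ_sat t).
Proof. by rewrite /up setc_setc setcE eqxx. Qed.

Lemma cut_line f x i t : f (setc x i t) != f x -> exists s, (setc x i s, i) \in cutset f.
Proof.
move=> h; apply/existsP; apply: contraT => /existsPn nc.
have st : forall n (a b : 'I_N), b = a + n :> nat -> f (setc x i a) = f (setc x i b).
  elim=> [|n IH] a b ab; first by congr (f (setc _ _ _)); apply: val_inj; rewrite /= ab addn0.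
  have aN : a.+1 < N by apply: leq_ltn_trans (ltn_ord b); rewrite ab addnS ltnS leq_addr.
  have := nc a; rewrite inE negbK /= up_setc => /eqP ->.
  by apply: IH; rewrite ab val_succ_sat aN addnS addSn.
case/negP: h; apply/eqP; rewrite -{2}(setc_id x i).
case: (leqP t (x i)) => le; first by apply: (st (x i - t)); rewrite subnKC.
by symmetry; apply: (st (t - x i)); rewrite subnKC // ltnW.
Qed.

Definition hyb n x y : V := [ffun j : 'I_d => if (j < n)%N then y j else x j].

Lemma hyb0 x y : hyb 0 x y = x.
Proof. by apply/ffunP => j; rewrite ffunE ltn0. Qed.

Lemma hybd x y : hyb d x y = y.
Proof. by apply/ffunP => j; rewrite ffunE ltn_ord. Qed.

Lemma hybS x y i : hyb i.+1 x y = setc (hyb i x y) i (y i).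
Proof.
apply/ffunP => j; rewrite setcE !ffunE ltnS leq_eqVlt.
by rewrite (inj_eq val_inj); case: eqP => [->|].
Qed.

Lemma hyb_change f x y : f x != f y ->
  exists k, f (hyb k x y) != f (setc (hyb k x y) k (y k)).
Proof.
move=> h; apply/existsP; apply: contraT => /existsPn nc.
have st n : n <= d -> f (hyb n x y) = f x.
  elim: n => [|n IH] nd; first by rewrite hyb0.
  rewrite -IH 1?ltnW //; move: (nc (Ordinal nd)).
  by rewrite -hybS negbK => /eqP ->.
by case/negP: h; rewrite -(st d) // hybd.
Qed.

Lemma slice_const f i x y : x i = y i ->
  (forall e, e \in cutset f -> e.2 != i -> e.1 i != x i) -> f x = f y.
Proof.
move=> xy nc; apply/eqP; apply: contraT => /hyb_change [k].
rewrite eq_sym => /[dup] h /cut_line [s hs].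
have hi : hyb k x y i = x i by rewrite ffunE -xy if_same.
have ki : k != i.
  apply: contraNneq h => ki.
  have -> : y k = hyb k x y k by rewrite ffunE ltnn ki xy.
  by rewrite setc_id.
by have := nc _ hs ki; rewrite /= setcE [i == k]eq_sym (negbTE ki) hi eqxx.
Qed.

Lemma cut0_const f x y : cutset f = set0 -> f x = f y.
Proof.
move=> c0; apply/eqP; apply: contraT => /hyb_change [k].
by rewrite eq_sym => /cut_line [s]; rewrite c0 inE.
Qed.

Lemma cut_inj f g x0 : cutset f = cutset g -> f x0 = g x0 -> f =1 g.
Proof.
move=> c e0 x; have := @cut0_const (fun x => f x (+) g x) x x0.
rewrite cut_addb c setDv setU0 => /(_ erefl); rewrite e0 addbb.
by case: (f x); case: (g x).
Qed.

Definition wt x : nat := \sum_i x i.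

Lemma up_neq x i : up x i != x -> (x i).+1 < N.
Proof.
apply: contraNT; rewrite -leqNgt => h; apply/eqP/ffunP => j; rewrite setcE.
case: eqP => [->|//]; apply: val_inj; rewrite /= val_succ_sat ltnNge h //.
Qed.

Lemma up_val x i j : up x i != x -> up x i j = (j == i) + x j :> nat.
Proof.
by move/up_neq=> h; rewrite setcE; case: eqP => [->|_] //; rewrite val_succ_sat h.
Qed.

Lemma wt_up x i : up x i != x -> wt (up x i) = (wt x).+1.
Proof.
move=> h; rewrite /wt (eq_bigr (fun j => (j == i) + x j)) => [|j _]; last by rewrite up_val.
rewrite big_split /= (bigD1 i) //= eqxx big1 ?addn0 ?add1n // => j /negbTE ->; by [].
Qed.

Lemma pot_ex A : even_set A -> exists f : V -> bool, cutset f = A.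
Proof.
move=> [pl dg].
have st s : exists f : V -> bool, forall x i, up x i != x -> wt (up x i) <= s ->
    f (up x i) = f x (+) ((x, i) \in A).
  elim: s => [|s [f IH]]; first by exists xpred0 => x i h; rewrite wt_up.
  pose f' y := if wt y <= s then f y else
    if [pick e : E | (up e.1 e.2 == y) && (e.1 != y)] is Some e
    then f e.1 (+) (e \in A) else false.
  exists f' => x i h; rewrite /f' wt_up // ltnS => wx; rewrite wx.
  case: ltnP => [lt|ge]; first by apply: IH; rewrite ?wt_up.
  case: pickP => [[z j] /= /andP[/eqP zj zx]|/(_ (x, i))]; last first.
    by rewrite /= eqxx eq_sym h.
  case: (eqVneq i j) => [ij|ij].
    subst j; suff -> : z = x by [].
    rewrite -zj eq_sym in zx.
    apply/ffunP => k; apply: val_inj; have /ffunP/(_ k)/(congr1 val) := zj.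
    by rewrite /= !up_val // => /addnI.
  have hz : up z j != z by rewrite zj eq_sym.
  have co k : (k == j) + z k = (k == i) + x k :> nat by rewrite -!up_val // zj.
  pose u := setc x j (z j).
  have ui : up u i = z.
    apply/ffunP => k; apply: val_inj; rewrite /= setcE setcE (negbTE ij).
    case: (k =P i) => [->|/eqP ki]; last first.
      by rewrite setcE; case: (k =P j) => [->//|/eqP kj]; have := co k; rewrite (negbTE ki) (negbTE kj).
    rewrite val_succ_sat up_neq //; have := co i; by rewrite eqxx (negbTE ij).
  have uj : up u j = x.
    apply/ffunP => k; apply: val_inj; rewrite /= setcE setcE eqxx.
    case: (k =P j) => [->|/eqP kj]; last by rewrite setcE (negbTE kj).
    rewrite val_succ_sat up_neq //; have := co j; by rewrite eqxx eq_sym (negbTE ij).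
  have ux : up u j != u.
    apply/eqP => e; have := co j; rewrite eqxx [j == i]eq_sym (negbTE ij).
    by rewrite -uj e setcE eqxx; lia.
  have uz : up u i != u.
    apply/eqP => e; have := co i; rewrite eqxx (negbTE ij).
    by rewrite -ui e setcE (negbTE ij); lia.
  have := IH u j ux; have := IH u i uz; have := wt_up ux; have := pl u i j.
  rewrite ui uj => P w /(_ _) F /(_ _) G.
  have wz : wt z = wt x by apply: succn_inj; rewrite -(wt_up hz) -(wt_up h) zj.
  rewrite F ?wz // G //; move: P.
  by case: (f u); case: (_ \in A); case: (_ \in A); case: (_ \in A); case: (_ \in A).
have [f hf] := st (\sum_(i < d) N).
exists f; apply/setP => [[x i]]; rewrite inE /=.
case: (eqVneq (up x i) x) => [e|h]; first by rewrite e eqxx (negbTE (dg _ _ e)).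
rewrite hf //; last by apply: leq_sum => j _; apply: ltnW.
by case: (f x); case: (_ \in A).
Qed.

End Grid.

Section Contours.
Variables (d N : nat).
Local Notation V := {ffun 'I_d -> 'I_N}.
Local Notation E := (V * 'I_d)%type.
Implicit Types (x y z : V) (i j k : 'I_d) (f g : V -> bool) (D A B W : {set E}) (e : E).

Definition nearby e e' : bool :=
  [forall k, (e.1 k <= (e'.1 k).+1) && (e'.1 k <= (e.1 k).+1)].
Definition link A : rel E := fun e e' => [&& e \in A, e' \in A & nearby e e'].
Definition isconn A : bool :=
  [forall e in A, forall e' in A, connect (link A) e e'].
(* [clos A D]: [A] is a union of connected components of [D]. *)
Definition clos A D : bool :=
  (A \subset D) && [forall e in A, forall e' in D :\: A, ~~ nearby e e'].
Definition comps D : {set {set E}} := [set W | [&& W != set0, isconn W & clos W D]].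

Lemma near_sym e e' : nearby e e' = nearby e' e.
Proof. by apply: eq_forallb => k; rewrite andbC. Qed.

Lemma link_sym A : connect_sym (link A).
Proof.
apply: sym_connect_sym => e e1; rewrite /link (near_sym e e1).
by case: (e \in A); case: (e1 \in A).
Qed.

Lemma closP A D : reflect ((A \subset D) /\
  forall e e', e \in A -> e' \in D -> nearby e e' -> e' \in A) (clos A D).
Proof.
apply: (iffP andP) => [[AD /forall_inP h]|[AD h]]; split => //.
  move=> e e' eA eD ne; apply: contraT => nA.
  have /forall_inP/(_ e') := h e eA.
  by rewrite in_setD nA eD ne => /(_ erefl).
apply/forall_inP => e eA; apply/forall_inP => e'; rewrite in_setD => /andP[nA eD].
by apply: contra nA; apply: h eA eD.
Qed.

Lemma clos_near A D e e' : clos A D -> e \in A -> nearby e e' -> (e' \in A) = (e' \in D).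
Proof.
move=> /closP[/subsetP AD h] eA ne; apply/idP/idP => [/AD //|eD].
exact: h eA eD ne.
Qed.

Lemma clos_sub A D : clos A D -> A \subset D.
Proof. by case/andP. Qed.

Lemma clos_setD A D : clos A D -> clos (D :\: A) D.
Proof.
move=> h; apply/closP; split; first exact: subsetDl.
move=> e e'; rewrite !in_setD => /andP[eA eD] eD' ne; rewrite eD' andbT.
apply: contra eA => eA'; rewrite near_sym in ne.
by rewrite (clos_near h eA' ne).
Qed.

Lemma clos_trans A B D : clos B A -> clos A D -> clos B D.
Proof.
move=> /closP[BA h] /closP[AD k]; apply/closP; split; first exact: subset_trans AD.
move=> e e' eB eD ne; apply: (h e) => //; apply: (k e) => //.
exact: (subsetP BA).
Qed.

Lemma clos_narrow A B D : clos B D -> B \subset A -> A \subset D -> clos B A.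
Proof.
move=> /closP[BD h] BA /subsetP AD; apply/closP; split => // e e' eB eA.
exact: (h e e' eB (AD _ eA)).
Qed.

Lemma clos_setI X A D : clos X D -> A \subset D -> clos (A :&: X) A.
Proof.
move=> /closP[XD h] /subsetP AD; apply/closP; split; first exact: subsetIl.
move=> e e'; rewrite !in_setI => /andP[_ eX] eA ne; rewrite eA.
exact: (h e e' eX (AD _ eA)).
Qed.

Lemma connectedP A : reflect (forall e e', e \in A -> e' \in A -> connect (link A) e e')
  (isconn A).
Proof.
apply: (iffP forall_inP) => h e; last by move=> eA; apply/forall_inP => e'; apply: h.
by move=> e' eA; have /forall_inP/(_ e') := h _ eA.
Qed.

Lemma conn_clos W A D e : isconn W -> W \subset D -> clos A D ->
  e \in W -> e \in A -> W \subset A.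
Proof.
move=> /connectedP cW /subsetP WD cA eW eA; apply/subsetP => e' eW'.
have cl : closed (link W) A.
  apply: intro_closed; first exact: link_sym.
  move=> u v /and3P[uW vW ne] uA; rewrite (clos_near cA uA ne); exact: WD.
by rewrite -(closed_connect cl (cW _ _ eW eW')).
Qed.

Lemma comps_conn D W : W \in comps D -> isconn W.
Proof. by rewrite inE => /and3P[]. Qed.

Lemma comps_clos D W : W \in comps D -> clos W D.
Proof. by rewrite inE => /and3P[]. Qed.

Lemma comps_uniq D W W' e : W \in comps D -> W' \in comps D ->
  e \in W -> e \in W' -> W = W'.
Proof.
rewrite !inE => /and3P[_ cW kW] /and3P[_ cW' kW'] eW eW'; apply/eqP.
rewrite eqEsubset (conn_clos cW (clos_sub kW) kW' eW eW').
by rewrite (conn_clos cW' (clos_sub kW') kW eW' eW).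
Qed.

Lemma comps_cover D e : e \in D -> exists2 W, W \in comps D & e \in W.
Proof.
move=> eD; pose W := [set e' | connect (link D) e e'].
have eW : e \in W by rewrite inE connect0.
have WD : W \subset D.
  apply/subsetP => e'; rewrite inE => c.
  have cl : closed (link D) D by move=> u v /and3P[-> ->].
  by rewrite -(closed_connect cl c).
have cW : clos W D.
  apply/closP; split=> // u v uW vD ne; move: (uW); rewrite !inE => h.
  by apply: connect_trans h (connect1 _); rewrite /link vD ne (subsetP WD).
have re u : u \in W -> connect (link W) e u.
  move=> uW; have := uW; rewrite inE => h.
  pose C := [set v | (v \in W) && connect (link W) e v].
  suff : u \in C by rewrite inE => /andP[].
  have cl : closed (link D) C.
    apply: intro_closed; first exact: link_sym.
    move=> a b /and3P[aD bD ne]; rewrite !inE => /andP[aW hc].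
    have bW : connect (link D) e b by apply: connect_trans aW (connect1 _); rewrite /link aD bD.
    rewrite bW /=; apply: connect_trans hc (connect1 _).
    by rewrite /link !inE aW bW.
  by rewrite -(closed_connect cl h) inE eW connect0.
exists W => //; rewrite inE cW andbT; apply/andP; split; first by apply/set0Pn; exists e.
apply/connectedP => a b aW bW; apply: connect_trans (re _ bW).
by rewrite link_sym re.
Qed.

Lemma in_comps_clos A D W : clos A D -> W \subset A -> (W \in comps A) = (W \in comps D).
Proof.
move=> cA WA; rewrite !inE; case: (W != set0) => //=; case: (isconn W) => //=.
apply/idP/idP => h; first exact: clos_trans h cA.
exact: clos_narrow h WA (clos_sub cA).
Qed.

Lemma comps_sub D W : W \in comps D -> W \subset D.
Proof. by move/comps_clos/clos_sub. Qed.

Lemma comps_neq0 D W : W \in comps D -> exists e, e \in W.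
Proof. by rewrite inE => /and3P[/set0Pn]. Qed.

Lemma comps_split A D : clos A D -> comps D = comps A :|: comps (D :\: A).
Proof.
move=> cA; have cD := clos_setD cA; apply/setP => W; rewrite in_setU.
apply/idP/orP => [hW|[] h]; last 2 first.
- by rewrite -(in_comps_clos cA) // comps_sub.
- by rewrite -(in_comps_clos cD) // comps_sub.
have [e eW] := comps_neq0 hW; have eD := subsetP (comps_sub hW) _ eW.
have [eA|eA] := boolP (e \in A); [left|right].
  by rewrite (in_comps_clos cA) // (conn_clos (comps_conn hW) (comps_sub hW) cA eW eA).
have eDA : e \in D :\: A by rewrite in_setD eA.
by rewrite (in_comps_clos cD) // (conn_clos (comps_conn hW) (comps_sub hW) cD eW eDA).
Qed.

Lemma comps_disj A B : [disjoint A & B] -> [disjoint comps A & comps B].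
Proof.
rewrite -!setI_eq0 => /eqP AB; rewrite -subset0; apply/subsetP => W; rewrite in_setI => /andP[hA hB].
have [e eW] := comps_neq0 hA; have := in_set0 e; rewrite -AB in_setI.
by rewrite (subsetP (comps_sub hA)) // (subsetP (comps_sub hB)).
Qed.

Lemma big_comps_split A D (F : {set E} -> bool) : clos A D ->
  \big[addb/false]_(W in comps D) F W =
  \big[addb/false]_(W in comps A) F W (+) \big[addb/false]_(W in comps (D :\: A)) F W.
Proof.
move=> cA; rewrite (comps_split cA) -bigU /=; first by apply: eq_bigl => W; rewrite in_setU.
by apply: comps_disj; rewrite -setI_eq0 setIDA setDIl setDv set0I.
Qed.

Lemma big_comps_mem D e : \big[addb/false]_(W in comps D) (e \in W) = (e \in D).
Proof.
have [eD|eD] := boolP (e \in D); last first.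
  by apply: big1 => W hW; apply: contraNF eD; apply: (subsetP (comps_sub hW)).
have [W hW eW] := comps_cover eD.
rewrite (bigD1 W) //= eW big1 ?addbF // => W' /andP[hW'].
by apply: contraNF => eW'; rewrite (comps_uniq hW' hW eW' eW).
Qed.

Lemma up_bounds x i k : (x k <= up x i k) && (up x i k <= (x k).+1).
Proof. by rewrite setcE; case: eqP => [->|_]; rewrite ?val_succ_sat; [case: ifP|]; lia. Qed.

Lemma clos_even A D : clos A D -> even_set D -> even_set A.
Proof.
move=> cA [pl dg]; split=> [x i j|x i h]; last first.
  by apply: contra (dg _ _ h); apply: (subsetP (clos_sub cA)).
have nr y z : (forall k, (x k <= y k <= (x k).+1) && (x k <= z k <= (x k).+1)) ->
    forall a b, nearby (y, a) (z, b).
  by move=> h a b; apply/forallP => k /=; have := h k; lia.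
pose s := [:: (x, i); (up x i, j); (x, j); (up x j, i)].
have bd (e : E) : e \in s -> forall k, x k <= e.1 k <= (x k).+1.
  rewrite !inE => h k; have := up_bounds x i k; have := up_bounds x j k.
  by case/or4P: h => /eqP -> /=; lia.
have ns e1 e2 : e1 \in s -> e2 \in s -> nearby e1 e2.
  move=> /bd h1 /bd h2; rewrite (surjective_pairing e1) (surjective_pairing e2).
  by apply: nr => k; rewrite h1 h2.
have [/hasP[e1 e1s e1A]|/hasPn h] := boolP (has (mem A) s); last first.
  have h' e : e \in s -> (e \in A) = false by move=> /h /negbTE.
  by rewrite !h' // !inE eqxx ?orbT.
have key e2 : e2 \in s -> (e2 \in A) = (e2 \in D).
  by move=> e2s; apply: clos_near cA e1A _; apply: ns.
by rewrite !key //; rewrite !inE eqxx ?orbT.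
Qed.

Lemma conn_diam W e e' k : isconn W -> e \in W -> e' \in W -> e'.1 k <= e.1 k + #|W|.
Proof.
move=> /connectedP cW eW eW'; have /connectP[p pp le] := cW _ _ eW eW'.
move: pp le; case/shortenP => p' pp' up' _ le.
have pW : {subset e :: p' <= W}.
  move=> u; rewrite inE => /predU1P[-> //|].
  elim: p' e pp' {up' le eW} => //= v p' IH e /andP[/and3P[_ vW _] pv].
  by rewrite inE => /predU1P[-> //|]; apply: IH pv.
have sz : size p' <= #|W|.
  have := uniq_leq_size up' (_ : {subset e :: p' <= enum W}) => /=.
  by rewrite -cardE => h; apply: ltnW; apply: h => u /pW; rewrite mem_enum.
apply: leq_trans (_ : e.1 k + size p' <= _); last by rewrite leq_add2l.
rewrite le; elim: p' e pp' {up' le eW pW sz} => [|v p' IH] e //=; first by rewrite addn0.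
move=> /andP[/and3P[_ _ /forallP/(_ k)/andP[_ h]] /IH q].
by apply: leq_trans q _; rewrite addnS -addSn leq_add2r.
Qed.

End Contours.

Section Isoperimetry.
Variables (d N : nat).
Local Notation V := {ffun 'I_d -> 'I_N}.
Local Notation E := (V * 'I_d)%type.
Implicit Types (x y z : V) (i j k : 'I_d) (f g : V -> bool) (D A B W : {set E}) (e : E).

Lemma card_bigcup_le (I T : finType) (P : pred I) (F : I -> {set T}) :
  #|\bigcup_(i | P i) F i| <= \sum_(i | P i) #|F i|.
Proof.
elim/big_ind2: _ => [|m A n B hA hB|//]; first by rewrite cards0.
by apply: leq_trans (leq_card_setU _ _) (leq_add hA hB).
Qed.

Lemma disjoint_nmem (T : finType) (A B : {set T}) (x : T) :
  [disjoint A & B] -> ~~ ((x \in A) && (x \in B)).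
Proof. by rewrite -setI_eq0 => /eqP/setP/(_ x); rewrite in_set0 in_setI => ->. Qed.

Lemma card_exchange (T : finType) (D B1 B2 : {set T}) : B1 \subset D -> [disjoint D :\: B1 & B2] ->
  (#|D :\: B1 :|: B2| + #|B1| = #|D| + #|B2|)%N.
Proof.
move=> s dj; rewrite cardsU (_ : _ :&: _ = set0) ?cards0 ?subn0; last by apply/eqP; rewrite setI_eq0.
by have := cardsID B1 D; rewrite (setIidPr s); lia.
Qed.

Lemma card_grid : #|{: V}| = N ^ d.
Proof. by rewrite card_ffun !card_ord. Qed.

Lemma sum_setc (F : V -> nat) j :
  \sum_y \sum_t F (setc y j t) = N * \sum_y F y.
Proof.
pose h (p : V * 'I_N) := (setc p.1 j p.2, p.1 j).
have hK : involutive h.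
  by move=> [y t]; rewrite /h /= setc_setc setc_id setcE eqxx.
rewrite pair_big /= (reindex_inj (inv_inj hK)) /= (eq_bigr (fun p => F p.1)) => [|p _].
  rewrite -(pair_bigA _ (fun y _ => F y)) /= big_distrr /=.
  by apply: eq_bigr => y _; rewrite sum_nat_const card_ord.
by rewrite setc_setc setc_id.
Qed.

Lemma sum_face (F : V -> nat) j (c : 'I_N) :
  \sum_(x : V | x j == c) \sum_t F (setc x j t) = \sum_y F y.
Proof.
rewrite pair_big_dep /= (reindex_onto (fun y => (setc y j c, y j)) (fun p => setc p.1 j p.2)).
  apply: eq_big => [y|y _] /=; last by rewrite setc_setc setc_id.
  by rewrite setcE eqxx setc_setc setc_id !eqxx.
by case=> x t /= /andP[/eqP <- _]; rewrite setc_setc setc_id setcE eqxx.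
Qed.

Lemma cut_line_sum f x i t :
  (f x != f (setc x i t)) <= \sum_s ((setc x i s, i) \in cutset f).
Proof.
case: eqVneq => //=; rewrite eq_sym => /cut_line [s hs].
by rewrite (bigD1 s) //= hs.
Qed.

Lemma card_cut_dir f : \sum_i \sum_(x : V) ((x, i) \in cutset f) = #|cutset f|.
Proof.
rewrite exchange_big pair_big /= -sum1_card [RHS]big_mkcond /=.
by apply: eq_bigr => -[x i] _ /=; case: (_ \in _).
Qed.

Lemma hyb_pairs (G : V -> V -> nat) n :
  \sum_x \sum_y G (hyb n x y) (hyb n y x) = \sum_x \sum_y G x y.
Proof.
pose h (p : V * V) := (hyb n p.1 p.2, hyb n p.2 p.1).
have hK : involutive h.
  by move=> [x y]; rewrite /h /=; congr pair; apply/ffunP => j; rewrite !ffunE; case: ltnP.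
by rewrite !pair_big /= [RHS](reindex_inj (inv_inj hK)).
Qed.

(* Every pair of points is joined by the path which changes the coordinates
   one after the other; a given edge lies on at most [N ^ d.+1] of these. *)
Lemma cheeger f : 2 * #|[set x | f x]| <= N ^ d -> #|[set x | f x]| <= N * #|cutset f|.
Proof.
set a := #|_| => ha.
have [d0|dpos] := posnP (N ^ d); first by move: ha; rewrite d0; lia.
have S1 : \sum_(x : V) \sum_(y : V) (f x != f y) <= N ^ d * (N * #|cutset f|).
  apply: leq_trans (_ : \sum_(k < d) \sum_(x : V) \sum_(y : V) (f (hyb k x y) != f (setc (hyb k x y) k (y k))) <= _).
    rewrite [X in _ <= X]exchange_big /=; apply: leq_sum => x _.
    rewrite [X in _ <= X]exchange_big /=; apply: leq_sum => y _.
    case: eqVneq => //= /hyb_change [k hk].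
    by rewrite (bigD1 k) //= hk.
  rewrite -card_cut_dir !big_distrr /=; apply: leq_sum => k _.
  rewrite (eq_bigr (fun x : V => \sum_(y : V) (f (hyb k x y) != f (setc (hyb k x y) k (hyb k y x k))))); last first.
    by move=> x _; apply: eq_bigr => y _; rewrite [hyb k y x k]ffunE ltnn.
  rewrite (hyb_pairs (fun x y => (f x != f (setc x k (y k)) : nat))).
  apply: leq_trans (_ : \sum_x \sum_(y : V) \sum_s ((setc x k s, k) \in cutset f) <= _).
    by apply: leq_sum => x _; apply: leq_sum => y _; apply: cut_line_sum.
  rewrite exchange_big sum_nat_const /= card_grid leq_mul2l.
  by rewrite (sum_setc (fun x => ((x, k) \in cutset f : nat))) leqnn orbT.
have S2 : 2 * (a * (N ^ d - a)) = \sum_(x : V) \sum_(y : V) (f x != f y).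
  have cA : \sum_y (f y : nat) = a.
    by rewrite /a -sum1_card [RHS]big_mkcond; apply: eq_bigr => y _; rewrite inE; case: (f y).
  have cN : \sum_y (~~ f y : nat) = N ^ d - a.
    rewrite -cA -[N ^ d]card_grid -sum1_card -sumnB => [|y _]; last by case: (f y).
    by apply: eq_bigr => y _; case: (f y).
  have -> : \sum_(x : V) \sum_(y : V) (f x != f y) = \sum_x (f x * (N ^ d - a) + ~~ f x * a).
    apply: eq_bigr => x _; case: (f x) => /=; rewrite ?mul0n ?mul1n ?addn0 ?add0n.
      by rewrite -cN; apply: eq_bigr => y _; case: (f y).
    by rewrite -cA; apply: eq_bigr => y _; case: (f y).
  by rewrite big_split /= -!big_distrl /= cA cN; lia.
rewrite -(leq_pmul2l dpos); apply: leq_trans S1; rewrite -S2.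
rewrite mulnCA mulnC leq_mul2l; apply/orP; right; lia.
Qed.

Definition on_face x : bool := [exists i, ((x i : nat) == 0) || ((x i).+1 == N)].

Lemma face_isoperimetry f i (c : 'I_N) : 2 * #|[set x | f x]| <= N ^ d ->
  #|[set x : V | f x & x i == c]| <= 2 * #|cutset f|.
Proof.
move=> hf; have N0 : 0 < N by apply: leq_ltn_trans (ltn_ord c).
rewrite -(leq_pmul2l N0).
apply: leq_trans (_ : \sum_(x : V | x i == c) \sum_t (f (setc x i t) + N * ((setc x i t, i) \in cutset f)) <= _).
  rewrite -sum1_card big_distrr /= [X in X <= _]big_mkcond [X in _ <= X]big_mkcond /=.
  apply: leq_sum => x _; rewrite inE; case: (x i == c); rewrite ?andbF //= andbT.
  case fx: (f x) => //; rewrite big_split /= -big_distrr /= muln1.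
  have [s cs|nc] := pickP (fun s => (setc x i s, i) \in cutset f).
    rewrite (bigD1 s) //= [in X in _ + X](bigD1 s) //= cs; lia.
  rewrite (eq_bigr (fun _ => 1)) ?sum_nat_const ?card_ord ?muln1 ?leq_addr // => t _.
  case: (f (setc x i t) =P f x) => [->|/eqP]; first by rewrite fx.
  by move/cut_line => [s]; rewrite nc.
rewrite (sum_face (fun x => f x + N * ((x, i) \in cutset f))) big_split /= -big_distrr /=.
have h1 : \sum_(x : V) ((x, i) \in cutset f) <= #|cutset f|.
  by rewrite -card_cut_dir [X in _ <= X](bigD1 i) //= leq_addr.
have h2 : \sum_x (f x : nat) <= N * #|cutset f|.
  apply: leq_trans (cheeger hf); rewrite -sum1_card [X in _ <= X]big_mkcond /=.
  by apply: leq_sum => x _; rewrite inE; case: (f x).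
apply: leq_trans (leq_add h2 (_ : _ <= N * #|cutset f|)) _; last by rewrite addnn -mul2n mulnCA.
by rewrite leq_mul2l h1 orbT.
Qed.

Lemma boundary_isoperimetry f : 2 * #|[set x | f x]| <= N ^ d ->
  #|[set x | f x & on_face x]| <= 4 * d * #|cutset f|.
Proof.
move=> hf; case: (posnP N) => [N0|N0].
  rewrite (_ : [set x | _ & _] = set0) ?cards0 //; apply/setP => x; rewrite !inE.
  by apply/andP => -[_ /existsP[i _]]; case: (x i); rewrite N0.
pose c0 : 'I_N := Ordinal N0.
have N1 : N.-1 < N by rewrite prednK.
pose c1 : 'I_N := Ordinal N1.
pose F i := [set x : V | f x & x i == c0] :|: [set x : V | f x & x i == c1].
apply: leq_trans (_ : #|\bigcup_i F i| <= _).
  apply/subset_leq_card/subsetP => x; rewrite inE => /andP[fx /existsP[i hi]].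
  apply/bigcupP; exists i => //; rewrite !inE fx /= -!(inj_eq val_inj) /=.
  by case/orP: hi => [->//|/eqP h]; apply/orP; right; apply/eqP; lia.
apply: leq_trans (card_bigcup_le _ _) _.
apply: leq_trans (_ : \sum_(i < d) 4 * #|cutset f| <= _); last first.
  by rewrite sum_nat_const card_ord; lia.
apply: leq_sum => i _; apply: leq_trans (leq_card_setU _ _) _.
have := face_isoperimetry i c0 hf; have := face_isoperimetry i c1 hf; lia.
Qed.

Definition in_range r x e : bool := [forall k, (e.1 k <= x k + r) && (x k <= e.1 k + r)].

Lemma within_le r r' x e : (r <= r')%N -> in_range r x e -> in_range r' x e.
Proof.
move=> rr /forallP h; apply/forallP => k; have := h k.
by move: (e.1 k : nat) (x k : nat) => u v; lia.
Qed.

Lemma card_window (a : 'I_d -> nat) (c : nat) :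
  #|[set x : V | [forall k, (a k <= x k) && (x k <= a k + c)]]| <= c.+1 ^ d.
Proof.
pose F (x : V) : {ffun 'I_d -> 'I_c.+1} := [ffun k => inord (x k - a k)].
set S := [set x | _].
have Fi : {in S &, injective F}.
  move=> x y; rewrite !inE => /forallP hx /forallP hy /ffunP h.
  apply/ffunP => k; apply: val_inj; have := h k; rewrite !ffunE => /(congr1 val) /=.
  have /andP[x1 x2] := hx k; have /andP[y1 y2] := hy k.
  by rewrite !inordK; lia.
by rewrite -(card_in_imset Fi) (leq_trans (max_card _)) // card_ffun !card_ord.
Qed.

Lemma card_within (r : nat) x : #|[set e | in_range r x e]| <= (r.*2).+1 ^ d * d.
Proof.
pose S := [set y : V | [forall k, (x k - r <= y k) && (y k <= x k - r + r.*2)]].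
apply: leq_trans (_ : #|setX S [set: 'I_d]| <= _).
  apply/subset_leq_card/subsetP => e; rewrite !inE andbT => /forallP h.
  by apply/forallP => k; have := h k; move: (e.1 k : nat) (x k : nat) => u v; lia.
by rewrite cardsX cardsT card_ord leq_mul2r card_window orbT.
Qed.

End Isoperimetry.

Section Interiors.
Variables (d N : nat).
Local Notation V := {ffun 'I_d -> 'I_N}.
Local Notation E := (V * 'I_d)%type.
Variables (x0 : V).
Implicit Types (x y z : V) (i j k : 'I_d) (f g : V -> bool) (D A B W : {set E}) (e : E).

Definition pot A : V -> bool := fun x =>
  if [pick f : {ffun V -> bool} | (cutset f == A) && ~~ f x0] is Some f then f x else false.

Lemma pot_base A : pot A x0 = false.
Proof. by rewrite /pot; case: pickP => // f /andP[_ /negbTE]. Qed.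

Lemma pot_cut f : f x0 = false -> pot (cutset f) =1 f.
Proof.
move=> f0 x; rewrite /pot; case: pickP => [g /andP[/eqP cg /negbTE g0]|/(_ (finfun f))].
  by apply: (cut_inj (x0 := x0)); rewrite ?cg ?g0.
have e : finfun f =1 f by move=> y; rewrite ffunE.
by rewrite (eq_cut e) e eqxx f0.
Qed.

Lemma cut_pot A : even_set A -> cutset (pot A) = A.
Proof.
move=> /pot_ex [f cf].
have h : cutset (fun x => f x (+) f x0) = A.
  by rewrite -cf; apply/setP => e; rewrite !inE; case: (f x0); rewrite ?addbT ?addbF //; case: (f _); case: (f _).
by rewrite -[in LHS]h (eq_cut (pot_cut _)) // addbb.
Qed.

Lemma pot_slice A i j x : even_set A -> i != j ->
  (forall e, e \in A -> e.2 != i -> e.1 i != x i) ->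
  (forall e, e \in A -> e.2 != j -> e.1 j != x0 j) -> pot A x = false.
Proof.
move=> eA ij hi hj; rewrite -(pot_base A) (@slice_const _ _ _ i x (setc x j (x0 j))).
- by apply: (@slice_const _ _ _ j); [rewrite setcE eqxx|rewrite cut_pot // setcE eqxx].
- by rewrite setcE (negbTE ij).
- by rewrite cut_pot.
Qed.

Definition inside A : V -> bool := fun x =>
  if 2 * #|[set y | pot A y]| <= N ^ d then pot A x else ~~ pot A x.

Lemma cut_interior A : even_set A -> cutset (inside A) = A.
Proof.
move=> eA; have [le|gt] := leqP (2 * #|[set y | pot A y]|) (N ^ d).
  by rewrite (eq_cut (g := pot A)) ?cut_pot // => x; rewrite /inside le.
rewrite (eq_cut (g := fun x => ~~ pot A x)) ?cut_negb ?cut_pot // => x.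
by rewrite /inside leqNgt gt.
Qed.

Lemma interior_small A : 2 * #|[set x | inside A x]| <= N ^ d.
Proof.
have [le|gt] := leqP (2 * #|[set y | pot A y]|) (N ^ d).
  by rewrite (_ : [set x | _] = [set y | pot A y]) //; apply/setP => x; rewrite !inE /inside le.
have := cardsC [set y | pot A y]; rewrite card_grid.
rewrite (_ : ~: _ = [set x | inside A x]); first by lia.
by apply/setP => x; rewrite !inE /inside leqNgt gt.
Qed.

Hypotheses (x0E : forall i, x0 i = 0 :> nat) (d2 : 2 <= d).

Lemma other_dir i : exists j : 'I_d, i != j.
Proof.
have d0 : 0 < d by rewrite (leq_trans _ d2).
case: (eqVneq (i : nat) 0) => h; [exists (Ordinal d2)|exists (Ordinal d0)];
  by rewrite -(inj_eq val_inj) /= ?h.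
Qed.

Lemma interior_slice A x i : even_set A -> 4 * #|A| < N -> inside A x ->
  exists2 e, e \in A & e.1 i = x i.
Proof.
move=> eA small hx.
have [e /andP[eA' /eqP ei]|nc] := pickP (fun e => (e \in A) && (e.1 i == x i)); first by exists e.
have [j ij] := other_dir i.
pose I := [set e.1 j | e : E in A]; pose U := ~: I.
have cU : N - #|A| <= #|U|.
  have cI : #|I| <= #|A| by apply: leq_imset_card.
  by have := cardsC I; rewrite card_ord -/U; move: cI; move: #|I| #|U| #|A| => *; lia.
have full y : y j \in U -> inside A y.
  move=> yU; suff -> : inside A y = inside A x by [].
  rewrite (@slice_const _ _ (inside A) j y (setc x j (y j))) ?setcE ?eqxx //; last first.
    by move=> e; rewrite cut_interior // => h _; apply: contraTneq yU => <-; rewrite in_setC negbK; apply: imset_f.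
  rewrite (@slice_const _ _ (inside A) i x (setc x j (y j))) ?setcE ?(negbTE ij) //.
  by move=> e; rewrite cut_interior // => h _; have := nc e; rewrite h => /negbT.
have S := sum_setc (fun y => (y j \in U : nat)) j.
have h1 : \sum_(y : V) (y j \in U : nat) <= #|[set y | inside A y]|.
  rewrite -sum1_card [X in _ <= X]big_mkcond; apply: leq_sum => y _; rewrite inE.
  by case: (boolP (y j \in U)) => // /full ->.
have h2 : \sum_(y : V) \sum_t ((setc y j t) j \in U : nat) = N ^ d * #|U|.
  rewrite -card_grid -sum_nat_const; apply: eq_bigr => y _.
  by rewrite -sum1_card [RHS]big_mkcond; apply: eq_bigr => t _; rewrite setcE eqxx; case: (t \in U).
have N0 : 0 < N by lia.
have Nd : 0 < N ^ d by rewrite expn_gt0 N0.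
have h3 := interior_small A.
have h4 : N ^ d * (2 * (N - #|A|)) <= N ^ d * N.
  apply: leq_trans (_ : 2 * (N ^ d * #|U|) <= _).
    by rewrite mulnCA; apply: leq_mul => //; apply: leq_mul.
  rewrite -h2 S mulnCA [X in _ <= X]mulnC; apply: leq_mul => //.
  by apply: leq_trans h3; apply: leq_mul.
by move: h4; rewrite leq_pmul2l //; lia.
Qed.

Lemma interior_near A x e : even_set A -> isconn A -> inside A x -> e \in A ->
  in_range (4 * #|A|) x e.
Proof.
move=> eA cA hx he; apply/forallP => i.
have [big|small] := leqP N (4 * #|A|).
  move: (4 * #|A|) big (ltn_ord (x i)) (ltn_ord (e.1 i)) => r.
  by move: (x i : nat) (e.1 i : nat) => u v; lia.
have [e' he' <-] := interior_slice i eA small hx.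
have := conn_diam i cA he he'; have := conn_diam i cA he' he.
by move: #|A| (e'.1 i : nat) (e.1 i : nat) => r u v; lia.
Qed.

Lemma pot_near A x e : even_set A -> isconn A -> (forall e j, e \in A -> e.2 != j -> e.1 j != x0 j) ->
  pot A x -> e \in A -> in_range (4 * #|A|) x e.
Proof.
move=> eA cA fr hx he; apply/forallP => i.
have [j ij] := other_dir i.
have [e' /andP[he' /eqP <-]|nc] := pickP (fun e => (e \in A) && (e.1 i == x i)); last first.
  suff : pot A x = false by rewrite hx.
  apply: (pot_slice (i := i) (j := j)) => // e' he'; last exact: fr.
  by have := nc e'; rewrite he' => /negbT.
have := conn_diam i cA he he'; have := conn_diam i cA he' he.
by move: #|A| (e'.1 i : nat) (e.1 i : nat) => r u v; lia.
Qed.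

Definition inner (a b : nat) : {set E} :=
  [set e : E | [forall k, (a <= e.1 k) && (e.1 k < b)]].

Lemma pot_inner (a b : nat) A x : 0 < a -> even_set A -> A \subset inner a b ->
  pot A x -> forall k, a <= x k <= b.
Proof.
move=> a0 eA /subsetP sA hx k; apply: contraTT hx => out.
have [j ij] := other_dir k.
rewrite (pot_slice (i := k) (j := j)) // => e /sA; rewrite inE => /forallP h _.
  by have := h k; apply: contraTneq => ->; lia.
by rewrite -(inj_eq val_inj) /= x0E; have := h j; lia.
Qed.

End Interiors.

(** * Counting contours *)

Section Entropy.
Variables (d N : nat).
Local Notation V := {ffun 'I_d -> 'I_N}.
Local Notation E := (V * 'I_d)%type.
Implicit Types (x y z : V) (W : {set E}) (e u v : E) (p : seq E).

(* A connected set is the support of a walk of length [2 * (#|W| - 1)]: repeatedly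
   insert a detour [x, y, x] to a site [y] not yet visited. *)
Lemma conn_walk W e : isconn W -> e \in W ->
  exists p, [/\ path (@nearby d N) e p, size p = 2 * #|W|.-1 & W = [set u in e :: p]].
Proof.
move=> cW eW.
have W0 : 0 < #|W| by apply/card_gt0P; exists e.
have st n : n < #|W| -> exists p, [/\ path (@nearby d N) e p, size p = 2 * n,
    [set u in e :: p] \subset W & #|[set u in e :: p]| = n.+1].
  elim: n => [_|n IH nW].
    exists [::]; split => //; last by rewrite (_ : [set u in _] = [set e]) ?cards1 //; apply/setP => u; rewrite !inE.
    by apply/subsetP => u; rewrite !inE => /eqP ->.
  have [p [pp sp sW cp]] := IH (ltnW nW).
  set C := [set u in e :: p] in sW cp.
  have [[x y] /= /and4P[xC yW yC nxy]|nc] := pickP (fun q : E * E =>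
     [&& q.1 \in C, q.2 \in W, q.2 \notin C & nearby q.1 q.2]); last first.
    have cC : clos C W.
      apply/closP; split=> // u v uC vW ne; apply: contraT => vC.
      by have := nc (u, v); rewrite /= uC vW vC ne.
    have eC : e \in C by rewrite !inE eqxx.
    have := conn_clos cW (subxx W) cC eW eC.
    by move/subset_leq_card; rewrite cp leqNgt nW.
  move: xC; rewrite inE => xC.
  case/splitPl: xC pp sp @C sW cp yC => p1 p2 lx; rewrite cat_path size_cat lx.
  move=> /andP[pp1 pp2] sp C sW cp yC.
  exists (p1 ++ y :: x :: p2).
  have eC : [set u in e :: p1 ++ y :: x :: p2] = y |: C.
    apply/setP => u; rewrite !(inE, mem_cat).
    have xin : x \in e :: p1 by rewrite -lx mem_last.
    case: (eqVneq u x) => [->|_]; last by case: (u == e); case: (u \in p1); case: (u == y); case: (u \in p2).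
    by move: xin; rewrite inE => /orP[] ->; rewrite ?orbT.
  split.
  - by rewrite cat_path pp1 lx /= nxy near_sym nxy pp2.
  - by rewrite size_cat /= !addnS sp; lia.
  - by rewrite eC subUset sub1set yW sW.
  - by rewrite eC cardsU1 yC cp.
have [|p [pp sp sW cp]] := st #|W|.-1; first by rewrite prednK.
exists p; split => //; apply/eqP; rewrite eq_sym eqEcard sW /= cp prednK //.
Qed.

Fixpoint walks n e : seq (seq E) :=
  if n is n'.+1 then flatten [seq [seq u :: p | p <- walks n' u] | u <- enum (nearby e)]
  else [:: [::]].

Lemma walksP n e p : path (@nearby d N) e p -> size p = n -> p \in walks n e.
Proof.
elim: n e p => [|n IH] e [|u p] //= /andP[eu pp] [sp].
apply/flatten_mapP; exists u; first by rewrite mem_enum.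
by apply/mapP; exists p => //; apply: IH.
Qed.

Lemma card_near e : #|[set u | nearby e u]| <= 3 ^ d * d.
Proof.
apply: leq_trans (card_within 1 e.1); apply/subset_leq_card/subsetP => u.
rewrite !inE => /forallP h; apply/forallP => k; have := h k.
by rewrite !addn1 andbC.
Qed.

Lemma size_walks n e : size (walks n e) <= (3 ^ d * d) ^ n.
Proof.
elim: n e => [|n IH] e //=; rewrite size_flatten /shape -map_comp sumnE big_map /=.
apply: leq_trans (_ : \sum_(u <- enum (nearby e)) (3 ^ d * d) ^ n <= _).
  by apply: leq_sum => u _; rewrite size_map.
rewrite big_const_seq count_predT iter_addn_0 expnS mulnC leq_mul2r -cardE.
by apply/orP; right; rewrite -(cardsE (nearby e)) card_near.
Qed.

Lemma card_conn e L :
  #|[set W : {set E} | [&& isconn W, e \in W & #|W| == L]]| <= (3 ^ d * d) ^ (2 * L).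
Proof.
have D0 : 0 < 3 ^ d * d by rewrite muln_gt0 expn_gt0 /= (leq_ltn_trans _ (ltn_ord e.2)).
apply: leq_trans (leq_trans (size_walks (2 * L.-1) e) _); last first.
  by rewrite leq_pexp2l // leq_mul2l leq_pred orbT.
rewrite -(size_map (fun p => [set u in e :: p])) cardE.
apply: uniq_leq_size (enum_uniq _) _ => W; rewrite mem_enum inE => /and3P[cW eW /eqP <-].
have [p [pp sp eW']] := conn_walk cW eW.
by apply/mapP; exists p; [apply: walksP|].
Qed.

Definition entropy : nat := 9 ^ d * d * (3 ^ d * d) ^ 2.

Definition reaches x W : bool := isconn W && [exists e in W, in_range (4 * #|W|) x e].

Lemma card_reaches x L : 0 < L -> #|[set W | reaches x W && (#|W| == L)]| <= entropy ^ L.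
Proof.
move=> L0.
pose F e : {set {set E}} := [set W | [&& isconn W, e \in W & #|W| == L]].
apply: leq_trans (_ : #|\bigcup_(e in [set e | in_range (4 * L) x e]) F e| <= _).
  apply/subset_leq_card/subsetP => W; rewrite !inE => /andP[/andP[cW /exists_inP[e eW we]] /eqP sW].
  by apply/bigcupP; exists e; rewrite !inE -?sW ?we ?cW ?eW ?eqxx.
apply: leq_trans (card_bigcup_le _ _) _.
apply: leq_trans (_ : \sum_(e in [set e | in_range (4 * L) x e]) (3 ^ d * d) ^ (2 * L) <= _).
  by apply: leq_sum => e _; apply: card_conn.
rewrite sum_nat_const /entropy [X in _ <= X]expnMn; apply: leq_mul; last by rewrite -expnM.
apply: leq_trans (card_within _ _) _; rewrite expnMn -expnM; apply: leq_mul; last first.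
  by case: (d) => [//|d']; rewrite -[X in X <= _]expn1 leq_pexp2l.
rewrite [d * L]mulnC expnM; case: (d) => [//|d']; rewrite leq_exp2r //.
elim: L L0 {F} => [//|[//|L] IH] _; have := IH isT; rewrite [9 ^ L.+2]expnS; lia.
Qed.

Lemma geometric_tail (R : realFieldType) (t : R) (r m : nat) : (0 <= t)%R -> (t <= 2^-1)%R ->
  (\sum_(r <= L < m) t ^+ L <= 2 * t ^+ r)%R.
Proof.
move=> t0 t2; have [mr|rm] := leqP m r; first by rewrite big_geq // mulr_ge0 ?exprn_ge0.
rewrite -[m](subnK (ltnW rm)) -[X in (\sum_(X <= _ < _) _)%R]add0n big_addn addnK.
under eq_bigr do rewrite exprD.
rewrite -mulr_suml ler_wpM2r ?exprn_ge0 // big_mkord.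
set n := m - r; have := subrX1 t n; set S := (\sum_(i < n) _)%R => h.
have S0 : (0 <= S)%R by apply: sumr_ge0 => i _; rewrite exprn_ge0.
have p0 : (0 <= t ^+ n)%R by rewrite exprn_ge0.
by nra.
Qed.

Lemma sum_reaches (R : realFieldType) (q : R) x r : 0 < r ->
  (0 <= q)%R -> (entropy%:R * q <= 2^-1)%R ->
  (\sum_(W | reaches x W && (r <= #|W|)%N) q ^+ #|W| <= 2 * (entropy%:R * q) ^+ r)%R.
Proof.
move=> r0 q0 hq.
apply: le_trans (geometric_tail r #|{: E}|.+1 _ hq); last by rewrite mulr_ge0.
rewrite (partition_big (fun W => inord #|W| : 'I_(#|{: E}|.+1)) (fun L => r <= L)) /=; last first.
  by move=> W /andP[_ h]; rewrite inordK // ltnS max_card.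
rewrite big_geq_mkord /=; apply: ler_sum => L rL.
apply: le_trans (_ : \sum_(W in [set W | reaches x W && (#|W| == L :> nat)]) q ^+ L <= _)%R; last first.
  rewrite sumr_const exprMn -[X in (X <= _)%R]mulr_natl ler_wpM2r ?exprn_ge0 // -natrX ler_nat card_reaches //.
  exact: leq_trans rL.
rewrite (eq_bigr (fun=> q ^+ L))%R => [|W /andP[_ /eqP <-]]; last first.
  by rewrite inordK // ltnS max_card.
rewrite [X in (X <= _)%R]big_mkcond [X in (_ <= X)%R]big_mkcond; apply: ler_sum => W _.
rewrite inE -(inj_eq val_inj) /= inordK ?ltnS ?max_card //.
case: (#|W| == L) => /=; rewrite ?andbF ?andbT //.
by case: (reaches x W); case: (r <= #|W|); rewrite /= ?exprn_ge0.
Qed.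
End Entropy.

(** * Swapping two configurations along their disagreement *)

Section Swap.
Local Open Scope ring_scope.
Variables (d N : nat).
Local Notation V := {ffun 'I_d -> 'I_N}.
Local Notation E := (V * 'I_d)%type.
Local Notation C := {ffun V -> bool}.
Implicit Types (x y z : V) (D A B W X : {set E}) (e : E) (m : C) (chi : {set E} -> V -> bool).

Definition chis chi D : V -> bool := fun x => \big[addb/false]_(W in comps D) chi W x.

Lemma in_cut_addb (f g : V -> bool) e :
  (e \in cutset (fun x => f x (+) g x)) = (e \in cutset f) (+) (e \in cutset g).
Proof. by rewrite !inE; case: (f _); case: (f _); case: (g _); case: (g _). Qed.

Lemma cut_chis chi D : (forall A, even_set A -> cutset (chi A) = A) -> even_set D ->
  cutset (chis chi D) = D.
Proof.
move=> hc eD; apply/setP => e; rewrite -[RHS]big_comps_mem inE.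
rewrite negb_eqb /chis -big_split /=; apply: eq_bigr => W hW.
by have := hc W (clos_even (comps_clos hW) eD) => /setP/(_ e) <-; rewrite inE; case: (chi _ _); case: (chi _ _).
Qed.

Lemma chis_split chi A D : clos A D ->
  chis chi D =1 (fun x => chis chi A x (+) chis chi (D :\: A) x).
Proof. by move=> cA x; apply: big_comps_split. Qed.

Lemma eq_chis chi1 chi2 D : (forall W, W \in comps D -> chi1 W =1 chi2 W) ->
  chis chi1 D =1 chis chi2 D.
Proof. by move=> h x; apply: eq_bigr => W hW; rewrite h. Qed.

Lemma chis_pot (x0 : V) D : even_set D -> chis (pot x0) D =1 pot x0 D.
Proof.
move=> eD; apply: (cut_inj (x0 := x0)).
  by rewrite cut_pot // cut_chis // => A; apply: cut_pot.
by rewrite pot_base; apply: big1 => W _; rewrite pot_base.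
Qed.

Definition addc m (f : V -> bool) : C := [ffun x => m x (+) f x].

Lemma cut_addc m f e : (e \in cutset (addc m f)) = (e \in cutset m) (+) (e \in cutset f).
Proof.
rewrite -in_cut_addb (eq_cut (g := fun x => m x (+) f x)) // => x.
by rewrite ffunE.
Qed.

Lemma mul_cancel_cross (F : fieldType) (a b u1 u2 v1 v2 : F) : a != 0 -> b != 0 ->
  u1 * a = v1 * b -> u2 * b = v2 * a -> u1 * u2 = v1 * v2.
Proof.
move=> a0 b0 h1 h2; apply: (mulIf a0); apply: (mulIf b0).
have -> : u1 * u2 * a * b = (u1 * a) * (u2 * b) by ring.
by rewrite h1 h2; ring.
Qed.

Section TwoModels.
Variables (R : realFieldType) (x0 : V) (In : {set E}).
Variables (chi : bool -> {set E} -> V -> bool) (Om : bool -> pred C) (w : bool -> C -> R) (q t : R).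
Hypothesis Om_chis : forall b m, Om b m -> m =1 chis (chi b) (cutset m).
Hypothesis chi_near : forall b m W x e, Om b m -> W \in comps (cutset m) ->
  chi b W x -> e \in W -> in_range (4 * #|W|) x e.
Hypothesis chi_inner : forall b A, even_set A -> A \subset In -> chi b A =1 pot x0 A.
Definition Zpart b : R := \sum_(m | Om b m) w b m.
Hypothesis w_ge0 : forall b m, 0 <= w b m.
Hypothesis part_gt0 : forall b, 0 < Zpart b.
Hypotheses (q0 : 0 <= q) (q1 : q <= 1) (t0 : 0 < t).
Hypothesis peierls : forall b A,
  \sum_(m | Om b m && clos A (cutset m)) w b m <= q ^+ #|A| * Zpart b.
Hypothesis exchange : forall b m B1 B2, Om b m -> clos B1 (cutset m) -> B1 \subset In ->
  even_set B2 -> B2 \subset In -> clos B2 ((cutset m :\: B1) :|: B2) ->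
  [disjoint cutset m :\: B1 & B2] ->
  let m' := addc m (fun x => pot x0 B1 x (+) pot x0 B2 x) in
  Om b m' /\ w b m' * t ^+ #|B1| = w b m * t ^+ #|B2|.

Definition inner_part D : {set E} := \bigcup_(W in comps D | W \subset In) W.

Lemma inner_part_clos D : clos (inner_part D) D.
Proof.
apply/closP; split; first by apply/bigcupsP => W /andP[hW _]; apply: comps_sub.
move=> e e' /bigcupP[W /andP[hW sW] eW] eD ne; apply/bigcupP; exists W; first by rewrite hW.
by rewrite (clos_near (comps_clos hW) eW ne).
Qed.

Lemma inner_part_sub D : inner_part D \subset In.
Proof. by apply/bigcupsP => W /andP[]. Qed.

Definition disagree (p : C * C) : V -> bool :=
  let X := inner_part (cutset p.1 :|: cutset p.2) in
  fun x => pot x0 (cutset p.1 :&: X) x (+) pot x0 (cutset p.2 :&: X) x.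
Definition swap (p : C * C) : C * C :=
  (addc p.1 (disagree p), addc p.2 (disagree p)).
Definition good (S : {set V}) (p : C * C) : bool :=
  let X := inner_part (cutset p.1 :|: cutset p.2) in
  [forall x in S, (p.1 x == pot x0 (cutset p.1 :&: X) x) && (p.2 x == pot x0 (cutset p.2 :&: X) x)].
Definition Om2 (p : C * C) : bool := Om false p.1 && Om true p.2.

Lemma even_cutI m X D : clos X D -> cutset m \subset D -> even_set (cutset m :&: X).
Proof. by move=> cX sD; apply: clos_even (clos_setI cX sD) (cut_even _). Qed.

Lemma cut_swap (p : C * C) : let X := inner_part (cutset p.1 :|: cutset p.2) in
  cutset (swap p).1 = (cutset p.1 :\: X) :|: (cutset p.2 :&: X) /\
  cutset (swap p).2 = (cutset p.2 :\: X) :|: (cutset p.1 :&: X).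
Proof.
set X := inner_part _; have cX : clos X _ := inner_part_clos _.
have e1 : even_set (cutset p.1 :&: X) := even_cutI cX (subsetUl _ _).
have e2 : even_set (cutset p.2 :&: X) := even_cutI cX (subsetUr _ _).
have cd e : (e \in cutset (disagree p)) = (e \in cutset p.1 :&: X) (+) (e \in cutset p.2 :&: X).
  by rewrite in_cut_addb !cut_pot.
by split; apply/setP => e; rewrite cut_addc cd !in_setU !in_setI !in_setD;
  case: (e \in X); case: (e \in cutset p.1); case: (e \in cutset p.2).
Qed.

Lemma swap_cuts (p : C * C) : let X := inner_part (cutset p.1 :|: cutset p.2) in
  [/\ cutset (swap p).1 :|: cutset (swap p).2 = cutset p.1 :|: cutset p.2,
      cutset (swap p).1 :&: X = cutset p.2 :&: X & cutset (swap p).2 :&: X = cutset p.1 :&: X].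
Proof.
have [e1 e2] := cut_swap p; move: e1 e2; set X := inner_part _ => e1 e2.
by split; rewrite ?e1 ?e2; apply/setP => e; rewrite !(in_setU, in_setI, in_setD);
  case: (e \in X); case: (e \in cutset p.1); case: (e \in cutset p.2).
Qed.

Lemma disagree_swap p : disagree (swap p) =1 disagree p.
Proof.
move=> x; have [eU e1 e2] := swap_cuts p.
by rewrite /disagree eU e1 e2 addbC.
Qed.

Lemma swapK : involutive swap.
Proof.
move=> p; rewrite [RHS]surjective_pairing; congr pair; apply/ffunP => x;
  by rewrite !ffunE disagree_swap -addbA addbb addbF.
Qed.

Lemma good_swap (S : {set V}) p : good S p -> good S (swap p).
Proof.
have [eU e1 e2] := swap_cuts p; move=> /forall_inP h; apply/forall_inP => x /h.
rewrite eU e1 e2 !ffunE /disagree => /andP[/eqP -> /eqP ->].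
by rewrite addKb [X in _ && (X == _)]addbC addbK !eqxx.
Qed.

Lemma swap_weight p : Om2 p -> Om2 (swap p) /\
  w false (swap p).1 * w true (swap p).2 = w false p.1 * w true p.2.
Proof.
case: p => m1 m2 /andP[/= o1 o2]; set p := (m1, m2).
set X := inner_part (cutset m1 :|: cutset m2).
have cX : clos X (cutset m1 :|: cutset m2) := inner_part_clos _.
have sX : X \subset In := inner_part_sub _.
have c1 := clos_setI cX (subsetUl _ _); have c2 := clos_setI cX (subsetUr _ _).
have e1 := even_cutI cX (subsetUl _ _); have e2 := even_cutI cX (subsetUr _ _).
have i1 : cutset m1 :&: X \subset In := subset_trans (subsetIr _ _) sX.
have i2 : cutset m2 :&: X \subset In := subset_trans (subsetIr _ _) sX.
have sep A B : A \subset cutset m1 :|: cutset m2 -> B \subset cutset m1 :|: cutset m2 ->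
  clos (B :&: X) ((A :\: (A :&: X)) :|: (B :&: X)) /\ [disjoint A :\: (A :&: X) & B :&: X].
  move=> sA sB; have -> : A :\: (A :&: X) = A :\: X by rewrite setDIr setDv set0U.
  split; last by rewrite -setI_eq0; apply/eqP/setP => e; rewrite !inE; case: (e \in X); rewrite ?andbF.
  have -> : B :&: X = ((A :\: X) :|: (B :&: X)) :&: X.
    by apply/setP => e; rewrite !inE; case: (e \in X); rewrite ?andbF ?andbT ?orbF.
  have -> : A :\: X :|: (A :\: X :|: B :&: X) :&: X = A :\: X :|: B :&: X.
    by apply/setP => e; rewrite !inE; case: (e \in X); rewrite ?andbF ?andbT ?orbF.
  apply: clos_setI cX _; rewrite subUset; apply/andP; split.
    exact: subset_trans (subsetDl _ _) sA.
  exact: subset_trans (subsetIl _ _) sB.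
have [s1 s1'] := sep _ _ (subsetUl _ _) (subsetUr (cutset m1) (cutset m2)).
have [s2 s2'] := sep _ _ (subsetUr (cutset m1) (cutset m2)) (subsetUl _ _).
have [k1 h1] := exchange o1 c1 i1 e2 i2 s1 s1'.
have [k2 h2] := exchange o2 c2 i2 e1 i1 s2 s2'.
have S1 : (swap p).1 = addc m1 (fun x => pot x0 (cutset m1 :&: X) x (+) pot x0 (cutset m2 :&: X) x) by [].
have S2 : (swap p).2 = addc m2 (fun x => pot x0 (cutset m2 :&: X) x (+) pot x0 (cutset m1 :&: X) x).
  by apply/ffunP => x; rewrite !ffunE /disagree [pot _ _ _ (+) _ in LHS]addbC.
rewrite /Om2 S1 S2; split; first by rewrite k1 k2.
have tn n : t ^+ n != 0 by rewrite expf_neq0 // gt_eqF.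
move: h1 h2 S2 => /= h1 h2 ->; exact (mul_cancel_cross (tn _) (tn _) h1 h2).
Qed.

Lemma good_sum0 (S : {set V}) (g : C -> R) : (forall m m', {in S, m =1 m'} -> g m = g m') ->
  \sum_(p | Om2 p && good S p) (g p.1 - g p.2) * (w false p.1 * w true p.2) = 0.
Proof.
move=> gS; under eq_bigr do rewrite mulrBl.
rewrite sumrB; apply/eqP; rewrite subr_eq0; apply/eqP.
have st p : Om2 p && good S p -> Om2 (swap p) && good S (swap p).
  by move=> /andP[o gd]; rewrite good_swap // andbT; have [] := swap_weight o.
rewrite (reindex_onto swap swap) /=; last by move=> p _; rewrite swapK.
apply: eq_big => [p|p /andP[o _]].
  rewrite swapK eqxx andbT; apply/idP/idP => h; last exact: (st _ h).
  by have := st _ h; rewrite swapK.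
have {o} := st _ o; rewrite swapK => /andP[o gd].
have [_ ->] := swap_weight o; congr (_ * _); apply: gS => x xS.
rewrite ffunE; move/forall_inP: gd => /(_ x xS) /andP[/eqP h1 /eqP h2].
by rewrite h2 {1}h1 /disagree addKb.
Qed.

Lemma bad_reaches (S : {set V}) p : Om2 p -> ~~ good S p ->
  exists x W, [/\ x \in S, reaches x W, ~~ (W \subset In) &
    [/\ clos (cutset p.1 :&: W) (cutset p.1), clos (cutset p.2 :&: W) (cutset p.2) & W \subset cutset p.1 :|: cutset p.2]].
Proof.
move=> /andP[o1 o2]; rewrite /good; set D := cutset p.1 :|: cutset p.2.
set X := inner_part D; have cX : clos X D := inner_part_clos _.
have key b (m : C) x : Om b m -> cutset m \subset D -> m x != pot x0 (cutset m :&: X) x ->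
    exists W, [/\ W \in comps D, reaches x W & ~~ (W \subset In)].
  move=> o sD ne; have cI := clos_setI cX sD; have eI := even_cutI cX sD.
  have hne : chis (chi b) (cutset m :\: (cutset m :&: X)) x.
    move: ne; rewrite (Om_chis o x) (chis_split _ cI) -(chis_pot x0 eI).
    rewrite (eq_chis (chi1 := chi b) (chi2 := pot x0)).
      by case: (chis _ _ _); case: (chis _ _ _).
    move=> W hW; apply: chi_inner; first exact: clos_even (comps_clos hW) eI.
    apply: subset_trans (comps_sub hW) (subset_trans (subsetIr _ _) (inner_part_sub _)).
  have [W0 /andP[hW0 chW0]|nc] := pickP (fun W => (W \in comps (cutset m :\: (cutset m :&: X))) && chi b W x); last first.
    by move: hne; rewrite /chis big1 // => W hW; have := nc W; rewrite hW.
  have [e eW0] := comps_neq0 hW0.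
  have := subsetP (comps_sub hW0) _ eW0; rewrite in_setD in_setI => /andP[eX em].
  have eD : e \in D := subsetP sD _ em.
  have [W hW eW] := comps_cover eD.
  have sW0 : W0 \subset W.
    apply: (conn_clos (comps_conn hW0) _ (comps_clos hW) eW0 eW).
    exact: subset_trans (comps_sub hW0) (subset_trans (subsetDl _ _) sD).
  exists W; split => //.
    apply/andP; split; first exact: comps_conn hW.
    apply/exists_inP; exists e => //.
    have hW0' : W0 \in comps (cutset m).
      by rewrite -(in_comps_clos (clos_setD cI)) // comps_sub.
    apply: within_le (chi_near o hW0' chW0 eW0).
    by rewrite leq_mul2l subset_leq_card.
  apply: contra eX => sW; have -> : (e \in X) by apply/bigcupP; exists W; rewrite ?hW.
  by rewrite em.
move=> /forall_inPn[x xS]; rewrite negb_and => h.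
have [W [hW rW iW]] : exists W, [/\ W \in comps D, reaches x W & ~~ (W \subset In)].
  by case/orP: h; [apply: key o1 (subsetUl _ _)|apply: key o2 (subsetUr _ _)].
have cW := comps_clos hW.
exists x, W; split => //; split; last exact: clos_sub.
  exact: clos_setI cW (subsetUl _ _).
exact: clos_setI cW (subsetUr _ _).
Qed.

Lemma bad_sum (S : {set V}) :
  \sum_(p | Om2 p && ~~ good S p) (w false p.1 * w true p.2) <=
  \sum_(x in S) \sum_(W | reaches x W && ~~ (W \subset In)) (4 * q) ^+ #|W| * (Zpart false * Zpart true).
Proof.
pose P (x : V) W := reaches x W && ~~ (W \subset In).
pose G A B (p : C * C) : R := (Om false p.1 && clos A (cutset p.1))%:R * w false p.1 *
   ((Om true p.2 && clos B (cutset p.2))%:R * w true p.2).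
have G0 A B p : 0 <= G A B p by rewrite !mulr_ge0.
have GS A B : \sum_p G A B p <= q ^+ (#|A| + #|B|) * (Zpart false * Zpart true).
  rewrite -(pair_bigA _ (fun m1 m2 => G A B (m1, m2))) /= /G /=.
  rewrite -big_distrlr /= exprD mulrACA.
  have e b A' : \sum_m (Om b m && clos A' (cutset m))%:R * w b m = \sum_(m | Om b m && clos A' (cutset m)) w b m.
    by rewrite [RHS]big_mkcond; apply: eq_bigr => m _; case: ifP; rewrite ?mul1r ?mul0r.
  by rewrite !e; apply: ler_pM => //; apply: sumr_ge0.
apply: le_trans (_ : \sum_(x in S) \sum_(W | P x W) \sum_(A in powerset W) \sum_(B in powerset W | W \subset A :|: B)
    \sum_p G A B p <= _); last first.
  apply: ler_sum => x _; apply: ler_sum => W _.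
  apply: le_trans (_ : \sum_(A in powerset W) \sum_(B in powerset W) q ^+ #|W| * (Zpart false * Zpart true) <= _).
    apply: ler_sum => A _; rewrite [X in X <= _]big_mkcondr; apply: ler_sum => B _.
    have Zp : 0 <= Zpart false * Zpart true by rewrite mulr_ge0 // ltW.
    case: ifP => [sW|_]; last by rewrite mulr_ge0 // exprn_ge0.
    apply: le_trans (GS A B) _; rewrite ler_wpM2r // ler_wiXn2l //.
    by rewrite (leq_trans (subset_leq_card sW)) // leq_card_setU.
  rewrite !sumr_const !card_powerset -mulrnA -[X in X <= _]mulr_natl mulrA.
  by rewrite natrM natrX -!exprMn (_ : 2%:R * 2%:R = 4 :> R) // -natrM.
apply: le_trans (_ : \sum_p \sum_(x in S) \sum_(W | P x W) \sum_(A in powerset W)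
    \sum_(B in powerset W | W \subset A :|: B) G A B p <= _); last first.
  rewrite exchange_big /=; apply: ler_sum => x _.
  rewrite exchange_big /=; apply: ler_sum => W _.
  rewrite exchange_big /=; apply: ler_sum => A _.
  by rewrite exchange_big.
rewrite big_mkcond; apply: ler_sum => p _.
have R0 x W A : 0 <= \sum_(B in powerset W | W \subset A :|: B) G A B p by apply: sumr_ge0.
have R1 x W : 0 <= \sum_(A in powerset W) \sum_(B in powerset W | W \subset A :|: B) G A B p.
  by apply: sumr_ge0 => A _; apply: R0.
have R2 x : 0 <= \sum_(W | P x W) \sum_(A in powerset W) \sum_(B in powerset W | W \subset A :|: B) G A B p.
  by apply: sumr_ge0 => W _; apply: R1.
case: ifP => [/andP[o bd]|_]; last by apply: sumr_ge0 => x _; apply: R2.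
have [x [W [xS rW iW [c1 c2 sW]]]] := bad_reaches o bd.
have [o1 o2] := andP o.
rewrite (bigD1 x) //= ler_wpDr //; first by apply: sumr_ge0 => y _; apply: R2.
rewrite (bigD1 W) /=; last by rewrite /P rW.
rewrite ler_wpDr //; first by apply: sumr_ge0 => y _; apply: (R1 x).
rewrite (bigD1 (cutset p.1 :&: W)) /=; last by rewrite inE subsetIr.
rewrite ler_wpDr //; first by apply: sumr_ge0 => y _; apply: (R0 x).
rewrite (bigD1 (cutset p.2 :&: W)) /=; last first.
  by rewrite inE subsetIr -setIUl subsetI subxx andbT.
rewrite ler_wpDr //; first by apply: sumr_ge0.
by rewrite /G o1 o2 c1 c2 !mul1r.
Qed.

Definition expect b (g : C -> R) : R := (\sum_(m | Om b m) g m * w b m) / Zpart b.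

Lemma expect_close (S : {set V}) (g : C -> R) (M : R) :
  (forall m m', {in S, m =1 m'} -> g m = g m') -> (forall m, `|g m| <= M) ->
  `|expect false g - expect true g| <=
  2 * M * \sum_(x in S) \sum_(W | reaches x W && ~~ (W \subset In)) (4 * q) ^+ #|W|.
Proof.
move=> gS gM; set T := \sum_(x in S) _.
have Z0 := part_gt0 false; have Z1 := part_gt0 true.
have -> : expect false g - expect true g =
    (\sum_(p | Om2 p) (g p.1 - g p.2) * (w false p.1 * w true p.2)) / (Zpart false * Zpart true).
  rewrite /Om2 -(pair_big (Om false) (Om true)
     (fun m1 m2 => (g m1 - g m2) * (w false m1 * w true m2))) /=.
  have -> : \sum_(m1 | Om false m1) \sum_(m2 | Om true m2) (g m1 - g m2) * (w false m1 * w true m2) =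
    (\sum_(m1 | Om false m1) g m1 * w false m1) * Zpart true -
    (\sum_(m2 | Om true m2) g m2 * w true m2) * Zpart false.
    rewrite [X in _ - X]mulrC !big_distrlr /= -sumrB; apply: eq_bigr => m1 _.
    by rewrite -sumrB; apply: eq_bigr => m2 _; ring.
  by rewrite /expect; field; rewrite !gt_eqF.
rewrite normrM [`|_^-1|]ger0_norm; last by rewrite invr_ge0 mulr_ge0 // ltW.
rewrite ler_pdivrMr ?mulr_gt0 // (bigID (good S)) /= good_sum0 // add0r.
apply: le_trans (ler_norm_sum _ _ _) _.
apply: le_trans (_ : \sum_(p | Om2 p && ~~ good S p) 2 * M * (w false p.1 * w true p.2) <= _).
  apply: ler_sum => p _; rewrite normrM [X in _ * X <= _]ger0_norm ?mulr_ge0 //.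
  rewrite ler_wpM2r ?mulr_ge0 // (le_trans (ler_normB _ _)) // mulrDl !mul1r lerD //.
have M0 : 0 <= M by apply: le_trans (normr_ge0 _) (gM (finfun xpred0)).
rewrite -mulr_sumr -!mulrA ler_wpM2l // ler_wpM2l //.
apply: le_trans (bad_sum S) _; rewrite /T [X in _ <= X]mulr_suml.
by apply: ler_sum => x _; rewrite [X in _ <= X]mulr_suml.
Qed.

End TwoModels.
End Swap.

(** * Peierls estimates for the two models *)

Section FreeModel.
Local Open Scope ring_scope.
Variables (d N : nat).
Local Notation V := {ffun 'I_d -> 'I_N}.
Local Notation E := (V * 'I_d)%type.
Local Notation C := {ffun V -> bool}.
Variables (R : realFieldType) (x0 : V) (t c : R) (bf : C -> R).
Hypotheses (x0E : forall i, x0 i = 0%N :> nat) (d2 : (2 <= d)%N).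
Hypotheses (t0 : 0 < t) (c1 : 1 <= c) (bf0 : forall m, 0 < bf m).
(* [bf] is the weight of the boundary fields. *)
Hypothesis bf_le : forall m m' : C,
  bf m <= c ^+ #|[set x | on_face x & m x != m' x]| * bf m'.
Implicit Types (x y z : V) (A B D W : {set E}) (e : E) (m : C).

(* The configurations which are plus outside all contours. *)
Definition plus_phase m : bool := [forall x, m x == chis (inside x0) (cutset m) x].
Definition free_weight m : R := t ^+ #|cutset m| * bf m.

Lemma plus_phaseP m : reflect (m =1 chis (inside x0) (cutset m)) (plus_phase m).
Proof. by apply: (iffP forallP) => h x; apply/eqP. Qed.

Lemma free_weight_gt0 m : 0 < free_weight m.
Proof. by rewrite mulr_gt0 ?exprn_gt0. Qed.

Lemma plus_phase0 : plus_phase [ffun => false].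
Proof.
apply/plus_phaseP => x; rewrite ffunE (_ : cutset _ = set0); last first.
  by apply/setP => e; rewrite !inE !ffunE.
rewrite /chis big1 // => W hW; have [e eW] := comps_neq0 hW.
by have := subsetP (comps_sub hW) _ eW; rewrite inE.
Qed.

Lemma free_part_gt0 : 0 < \sum_(m | plus_phase m) free_weight m.
Proof.
rewrite (bigD1 _ plus_phase0) /= ltr_wpDr ?free_weight_gt0 //.
by apply: sumr_ge0 => m _; rewrite ltW ?free_weight_gt0.
Qed.

Lemma addcK (f : V -> bool) : involutive (fun m => addc m f).
Proof. by move=> m; apply/ffunP => x; rewrite !ffunE -addbA addbb addbF. Qed.

Lemma plus_phase_erase m A : plus_phase m -> clos A (cutset m) ->
  cutset (addc m (chis (inside x0) A)) = cutset m :\: A /\ plus_phase (addc m (chis (inside x0) A)).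
Proof.
move=> /plus_phaseP hm cA; have eD := cut_even m; have eA := clos_even cA eD.
have cE : cutset (addc m (chis (inside x0) A)) = cutset m :\: A.
  apply/setP => e; rewrite cut_addc cut_chis // ?in_setD; last exact: cut_interior.
  by case: (boolP (e \in A)) => [/(subsetP (clos_sub cA)) ->|]; rewrite ?addbF.
split => //; apply/plus_phaseP => x; rewrite cE ffunE hm (chis_split _ cA).
by rewrite addbAC addbb.
Qed.

Lemma sum_comps_card D : (\sum_(W in comps D) #|W| <= #|D|)%N.
Proof.
rewrite (eq_bigr (fun W : {set E} => \sum_(e in D) (e \in W))%N) => [|W hW].
  rewrite exchange_big /= -sum1_card; apply: leq_sum => e eD.
  have [W hW eW] := comps_cover eD.
  rewrite (bigD1 W) //= eW big1 // => W' /andP[hW' ne].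
  by case: (boolP (e \in W')) => // eW'; rewrite (comps_uniq hW' hW eW' eW) eqxx in ne.
rewrite -sum1_card [LHS]big_mkcond [RHS]big_mkcond; apply: eq_bigr => e _.
by case: (boolP (e \in W)) => [/(subsetP (comps_sub hW)) ->|_] //; case: ifP.
Qed.

Lemma card_face_chis A : even_set A ->
  (#|[set x | on_face x & chis (inside x0) A x]| <= 4 * d * #|A|)%N.
Proof.
move=> eA.
apply: leq_trans (_ : #|\bigcup_(W in comps A) [set x | inside x0 W x & on_face x]| <= _)%N.
  apply/subset_leq_card/subsetP => x; rewrite inE => /andP[fx hx].
  have [W /andP[hW cW]|nc] := pickP (fun W => (W \in comps A) && inside x0 W x).
    by apply/bigcupP; exists W; rewrite // inE cW.
  by move: hx; rewrite /chis big1 // => W hW; have := nc W; rewrite hW.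
apply: leq_trans (card_bigcup_le _ _) _.
apply: leq_trans (_ : \sum_(W in comps A) 4 * d * #|W| <= _)%N; last first.
  by rewrite -big_distrr leq_mul2l sum_comps_card orbT.
apply: leq_sum => W hW; apply: leq_trans (boundary_isoperimetry (interior_small x0 W)) _.
by rewrite cut_interior //; apply: clos_even (comps_clos hW) eA.
Qed.

Lemma free_peierls A :
  \sum_(m | plus_phase m && clos A (cutset m)) free_weight m <=
  (t * c ^+ (4 * d)) ^+ #|A| * \sum_(m | plus_phase m) free_weight m.
Proof.
set q := t * _; pose phi := fun m : C => addc m (chis (inside x0) A).
have phiK : involutive phi := addcK _.
have c0 : 0 <= c by rewrite (le_trans _ c1).
apply: le_trans (_ : \sum_(m | plus_phase m && clos A (cutset m)) q ^+ #|A| * free_weight (phi m) <= _).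
  apply: ler_sum => m /andP[pm cA]; have [cE _] := plus_phase_erase pm cA.
  rewrite /free_weight cE; have := cardsID A (cutset m); rewrite (setIidPr (clos_sub cA)) => <-.
  rewrite exprMn exprD -!mulrA ler_pM2l ?exprn_gt0 // [X in _ <= X]mulrCA ler_pM2l ?exprn_gt0 //.
  apply: le_trans (bf_le m (phi m)) _; rewrite ler_pM2r // -exprM; apply: ler_weXn2l => //.
  apply: leq_trans (card_face_chis (clos_even cA (cut_even m))).
  apply/subset_leq_card/subsetP => x; rewrite !inE ffunE => /andP[-> /=].
  by case: (m x); case: (chis _ _ _).
have q0 : 0 <= q by rewrite mulr_ge0 ?exprn_ge0 // ltW.
rewrite -mulr_sumr ler_wpM2l ?exprn_ge0 //.
rewrite (reindex_inj (inv_inj phiK)) /=.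
under eq_bigr do rewrite phiK.
rewrite [X in X <= _]big_mkcond [X in _ <= X]big_mkcond /=; apply: ler_sum => m _.
case: ifP => [/andP[pm cA]|_]; last by case: ifP => // _; rewrite ltW ?free_weight_gt0.
by have [_] := plus_phase_erase pm cA; rewrite -/(phi _) phiK => ->.
Qed.

Section Inner.
Variables (a b : nat).
Hypotheses (a0 : (0 < a)%N) (ab : (a <= b)%N) (bN : (b.+1 < N)%N).
Hypothesis vol : (2 * (b - a).+1 ^ d <= N ^ d)%N.

Lemma interior_inner A : even_set A -> A \subset inner d N a b -> inside x0 A =1 pot x0 A.
Proof.
move=> eA sA x; rewrite /inside ifT //; apply: leq_trans vol; rewrite leq_mul2l /=.
apply: (leq_trans _ (card_window N (fun=> a) (b - a))); apply/subset_leq_card/subsetP => y.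
rewrite !inE => hy; apply/forallP => k; rewrite subnKC //.
exact: (pot_inner x0E d2 a0 eA sA hy k).
Qed.

Lemma pot_inner_face A x : even_set A -> A \subset inner d N a b -> on_face x -> pot x0 A x = false.
Proof.
move=> eA sA /existsP[k hk]; apply/negP => /(pot_inner x0E d2 a0 eA sA)/(_ k).
case/orP: hk => /eqP h /andP[h1 h2]; first by rewrite h leqNgt a0 in h1.
by rewrite -ltnS h leqNgt bN in h2.
Qed.

Lemma cut_exchange m B1 B2 : even_set B1 -> even_set B2 -> B1 \subset cutset m ->
  [disjoint cutset m :\: B1 & B2] ->
  cutset (addc m (fun x => pot x0 B1 x (+) pot x0 B2 x)) = cutset m :\: B1 :|: B2.
Proof.
move=> e1 e2 /subsetP s dj; apply/setP => e; rewrite cut_addc in_cut_addb !cut_pot // in_setU in_setD.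
have /implyP := s e; have := disjoint_nmem e dj; rewrite in_setD.
by case: (e \in B1); case: (e \in cutset m); case: (e \in B2).
Qed.

Lemma free_exchange m B1 B2 : plus_phase m -> clos B1 (cutset m) -> B1 \subset inner d N a b ->
  even_set B2 -> B2 \subset inner d N a b -> clos B2 ((cutset m :\: B1) :|: B2) ->
  [disjoint cutset m :\: B1 & B2] ->
  let m' := addc m (fun x => pot x0 B1 x (+) pot x0 B2 x) in
  plus_phase m' /\ free_weight m' * t ^+ #|B1| = free_weight m * t ^+ #|B2|.
Proof.
move=> pm c1' s1 e2 s2 c2 dj m'; have e1 := clos_even c1' (cut_even m).
have cE : cutset m' = cutset m :\: B1 :|: B2 by apply: cut_exchange; rewrite ?clos_sub.
have chisE B : even_set B -> B \subset inner d N a b -> chis (inside x0) B =1 pot x0 B.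
  move=> eB sB x; rewrite -(chis_pot x0 eB); apply: eq_chis => W hW.
  apply: interior_inner; first exact: clos_even (comps_clos hW) eB.
  exact: subset_trans (comps_sub hW) sB.
split.
  apply/plus_phaseP => x; rewrite ffunE cE (chis_split _ c2) (plus_phaseP _ pm) (chis_split _ c1').
  rewrite (chisE B1) // (chisE B2) // (_ : (_ :|: _) :\: _ = cutset m :\: B1).
    by case: (pot _ _ _); case: (pot _ _ _); case: (chis _ _ _).
  apply/setP => e; have := disjoint_nmem e dj; rewrite !in_setD in_setU in_setD.
  by case: (e \in B1); case: (e \in cutset m); case: (e \in B2).
have bE : bf m' = bf m.
  have z (m1 m2 : C) : (forall x, on_face x -> m1 x = m2 x) -> bf m1 <= bf m2.
    move=> h; apply: le_trans (bf_le m1 m2) _; rewrite (_ : [set x | _ & _] = set0) ?cards0 ?mul1r //.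
    by apply/setP => x; rewrite !inE; apply/negP => /andP[/h ->]; rewrite eqxx.
  by apply/le_anti/andP; split; apply: z => x fx; rewrite ffunE !pot_inner_face // !addbF.
rewrite /free_weight bE cE mulrAC -exprD card_exchange ?clos_sub // exprD mulrAC //.
Qed.

End Inner.
End FreeModel.

Section FrozenModel.
Local Open Scope ring_scope.
Variables (d N : nat).
Local Notation V := {ffun 'I_d -> 'I_N}.
Local Notation E := (V * 'I_d)%type.
Local Notation C := {ffun V -> bool}.
Variables (R : realFieldType) (x0 : V) (s : R) (lo hi : nat).
Hypotheses (x0E : forall i, x0 i = 0%N :> nat) (d2 : (2 <= d)%N).
Hypotheses (s0 : 0 < s) (s1 : s <= 1) (lo0 : (0 < lo)%N) (hiN : (hi.+1 < N)%N).
Implicit Types (x y z : V) (A B D W : {set E}) (e : E) (m : C).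

Definition window x : bool := [forall k, (lo <= x k)%N && (x k <= hi)%N].
Definition frozen m : bool := [forall x, m x ==> window x].
Definition rim x : bool := window x && [exists k, (x k == lo :> nat) || (x k == hi :> nat)].
Definition window_edges : {set E} := [set e | window e.1 && window (up e.1 e.2)].
Definition frozen_weight m : R :=
  (s ^+ (2 * d)) ^+ (#|cutset m :&: window_edges| + #|[set x | rim x & m x]|).

Lemma frozenP m : reflect (forall x, m x -> window x) (frozen m).
Proof. by apply: (iffP forallP) => h x; [move/implyP: (h x)|apply/implyP; apply: h]. Qed.

Lemma frozen_out m x : frozen m -> ~~ window x -> m x = false.
Proof. by move=> /frozenP h; apply: contraNF; apply: h. Qed.

Lemma up_inj x y i : up x i = up y i -> up x i != x -> up y i != y -> x = y.
Proof.
move=> e hx hy; apply/ffunP => k; apply: val_inj.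
by have := up_val k hx; rewrite e up_val // => /addnI.
Qed.

Lemma frozen_slice m i x e : frozen m -> ~~ ((lo <= x i)%N && (x i <= hi)%N) ->
  e \in cutset m -> e.2 != i -> e.1 i != x i.
Proof.
move=> fm out ec ei; apply: contraL ec => /eqP h; rewrite inE negbK.
have nw y : y i = x i -> ~~ window y by move=> yi; apply/forallPn; exists i; rewrite yi.
by rewrite !(frozen_out fm) //; apply: nw; rewrite // setcE eq_sym (negbTE ei).
Qed.

Lemma base_out i : ~~ ((lo <= x0 i)%N && (x0 i <= hi)%N).
Proof. by rewrite x0E leqNgt lo0. Qed.

Lemma pot_window m A x : frozen m -> even_set A -> A \subset cutset m -> pot x0 A x -> window x.
Proof.
move=> fm eA /subsetP sA; apply: contraTT => /forallPn[i out].
have [j ij] := other_dir d2 i.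
rewrite (pot_slice (i := i) (j := j)) // => e /sA ec.
  exact: frozen_slice fm out ec.
exact: frozen_slice fm (base_out j) ec.
Qed.

Lemma frozen_chis m : frozen m -> m =1 chis (pot x0) (cutset m).
Proof.
move=> fm x; rewrite (chis_pot x0 (cut_even m)) pot_cut //.
have d0 : (0 < d)%N := ltnW d2.
by apply: (frozen_out fm); apply/forallPn; exists (Ordinal d0); apply: base_out.
Qed.

Lemma frozen_near m W x e : frozen m -> W \in comps (cutset m) -> pot x0 W x -> e \in W ->
  in_range (4 * #|W|) x e.
Proof.
move=> fm hW px eW; apply: (pot_near d2) px eW; last first.
- move=> e' j /(subsetP (comps_sub hW)); exact: frozen_slice fm (base_out j).
- exact: comps_conn hW.
- exact: clos_even (comps_clos hW) (cut_even m).
Qed.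

Lemma cut_nondeg (f : V -> bool) e : e \in cutset f -> up e.1 e.2 != e.1.
Proof. by rewrite inE; apply: contraNneq => ->. Qed.

Lemma leave_window x i : window x -> ~~ window (up x i) -> x i = hi :> nat.
Proof.
move=> /forallP hx /forallPn[k]; have := hx k; have := hx i; rewrite setcE.
case: eqP => [->|_]; last by move=> _ ->.
rewrite val_succ_sat; case: ifP => _; move: (x i : nat) => u; lia.
Qed.

Lemma enter_window x i : ~~ window x -> window (up x i) -> up x i i = lo :> nat.
Proof.
move=> /forallPn[k hk] /forallP hx; have := hx k; have := hx i; move: hk; rewrite !setcE eqxx.
case: eqP => [->|_]; last by move=> /negbTE ->.
rewrite val_succ_sat; case: ifP => _; move: (x i : nat) => u; lia.
Qed.

Lemma card_crossing m A : frozen m -> even_set A -> A \subset cutset m ->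
  (#|A :\: window_edges| <= 2 * d * #|[set x | rim x & pot x0 A x]|)%N.
Proof.
move=> fm eA sA; pose p := pot x0 A.
have cA : cutset p = A by apply: cut_pot.
have pw y : p y -> window y := pot_window fm eA sA.
pose F e : V * 'I_d * bool := (if p e.1 then e.1 else up e.1 e.2, e.2, p e.1).
have Fi : {in A :\: window_edges &, injective F}.
  move=> [x i] [y j]; rewrite !in_setD -cA => /andP[_ hx] /andP[_ hy] [h1 h2 h3].
  move: h1 hx hy; rewrite /= h3 h2; case: ifP => _ e hx hy; first by rewrite e.
  by rewrite (up_inj e (cut_nondeg hx) (cut_nondeg hy)).
rewrite -(card_in_imset Fi).
apply: leq_trans (_ : #|setX (setX [set x | rim x & p x] [set: 'I_d]) [set: bool]| <= _)%N; last first.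
  by rewrite !cardsX !cardsT card_ord card_bool -mulnA mulnC [(d * 2)%N]mulnC.
apply/subset_leq_card/subsetP => _ /imsetP[[x i] he ->]; rewrite !inE /= !andbT.
move: he; rewrite in_setD -{1}cA !inE /= => /andP[nw hc].
case: ifP hc nw => px; rewrite /= ?px.
  rewrite /rim (pw _ px) ?andbT /= => _ nw; apply/existsP; exists i.
  by rewrite (leave_window (pw _ px) nw) eqxx orbT.
rewrite eq_sym eqbF_neg negbK => pu; rewrite pu /rim (pw _ pu) !andbT /= => nw.
apply/existsP; exists i; by rewrite (enter_window nw (pw _ pu)) eqxx.
Qed.

Lemma rim_pot m A x : frozen m -> even_set A -> A \subset cutset m -> rim x -> pot x0 A x -> m x.
Proof.
move=> fm eA sA /andP[wx /existsP[k hk]] px.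
have pw y : ~~ window y -> pot x0 A y = false by apply: contraNF; apply: pot_window sA.
have key e : e \in cutset (pot x0 A) -> e \in cutset m by rewrite cut_pot //; apply: (subsetP sA).
have xN := ltn_ord (x k); have /andP[l1 l2] := forallP wx k.
case/orP: hk => /eqP hk.
  have kN : ((x k).-1 < N)%N by move: xN; move: (x k : nat) => u; lia.
  pose y := setc x k (Ordinal kN).
  have yx : up y k = x.
    rewrite /y up_setc; apply/ffunP => j; rewrite setcE; case: eqP => [->|//]; apply: val_inj.
    by rewrite /= val_succ_sat /= hk prednK // -hk xN.
  have nw : ~~ window y by apply/forallPn; exists k; rewrite setcE eqxx /= hk; lia.
  have := key (y, k); rewrite !inE /= yx px pw // => /(_ isT).
  by rewrite (frozen_out fm nw); case: (m x).
have nw : ~~ window (up x k).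
  apply/forallPn; exists k; rewrite setcE eqxx val_succ_sat hk hiN; lia.
have := key (x, k); rewrite !inE /= px pw // => /(_ isT).
by rewrite (frozen_out fm nw); case: (m x).
Qed.

Lemma frozen_weight_gt0 m : 0 < frozen_weight m.
Proof. by rewrite !exprn_gt0. Qed.

Lemma frozen0 : frozen [ffun => false].
Proof. by apply/frozenP => x; rewrite ffunE. Qed.

Lemma frozen_part_gt0 : 0 < \sum_(m | frozen m) frozen_weight m.
Proof.
rewrite (bigD1 _ frozen0) /= ltr_wpDr ?frozen_weight_gt0 //.
by apply: sumr_ge0 => m _; rewrite ltW ?frozen_weight_gt0.
Qed.

Lemma frozen_erase m A : frozen m -> even_set A -> A \subset cutset m ->
  frozen (addc m (pot x0 A)) /\
  frozen_weight m <= s ^+ #|A| * frozen_weight (addc m (pot x0 A)).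
Proof.
move=> fm eA sA; set m' := addc _ _.
have pw x : pot x0 A x -> window x := pot_window fm eA sA.
split.
  apply/frozenP => x; rewrite ffunE; case px: (pot x0 A x); first by move=> _; apply: pw.
  by rewrite addbF; apply: (frozenP _ fm).
have cE : cutset m' = cutset m :\: A.
  apply/setP => e; rewrite cut_addc cut_pot // in_setD.
  by case: (boolP (e \in A)) => [/(subsetP sA) ->|]; rewrite ?addbF.
have c1 : #|cutset m :&: window_edges| = (#|A :&: window_edges| + #|cutset m' :&: window_edges|)%N.
  rewrite -(cardsID A (cutset m :&: window_edges)) cE; congr (_ + _)%N; congr #|pred_of_set _|.
    by apply/setP => e; rewrite !in_setI; case: (boolP (e \in A)) => [/(subsetP sA) ->|]; rewrite ?andbF ?andbT.
  by apply/setP => e; rewrite !(in_setI, in_setD) andbA.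
have c2 : #|[set x | rim x & m x]| = (#|[set x | rim x & pot x0 A x]| + #|[set x | rim x & m' x]|)%N.
  rewrite -(cardsID [set x | pot x0 A x] [set x | rim x & m x]).
  congr (_ + _)%N; congr #|pred_of_set _|; apply/setP => x; rewrite !inE ?ffunE.
    case rx: (rim x) => //=; case px: (pot x0 A x); rewrite ?andbF // andbT.
    exact: rim_pot sA rx px.
  case rx: (rim x); rewrite ?andbF //=; case px: (pot x0 A x); last by rewrite addbF.
  by rewrite (rim_pot fm eA sA rx px).
have sn k n : 0 <= (s ^+ k) ^+ n by rewrite !exprn_ge0 // ltW.
rewrite /frozen_weight c1 c2 addnACA exprD ler_wpM2r //.
rewrite -exprM; apply: ler_wiXn2l => //; first exact: ltW.
have := card_crossing fm eA sA; have := cardsID window_edges A.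
move: #|A :&: _| #|A :\: _| #|[set x | _ & _]| #|A| => u v z y.
have dp : (1 <= 2 * d)%N by lia.
rewrite mulnDr => <- h; apply: leq_add h.
by rewrite -[X in (X <= _)%N]mul1n leq_mul2r dp orbT.
Qed.

Lemma frozen_peierls A :
  \sum_(m | frozen m && clos A (cutset m)) frozen_weight m <=
  s ^+ #|A| * \sum_(m | frozen m) frozen_weight m.
Proof.
pose phi := fun m : C => addc m (pot x0 A).
have phiK : involutive phi := addcK _.
have er m : frozen m && clos A (cutset m) -> frozen (phi m) /\ frozen_weight m <= s ^+ #|A| * frozen_weight (phi m).
  by move=> /andP[fm cA]; apply: frozen_erase fm (clos_even cA (cut_even m)) (clos_sub cA).
apply: le_trans (_ : \sum_(m | frozen m && clos A (cutset m)) s ^+ #|A| * frozen_weight (phi m) <= _).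
  by apply: ler_sum => m /er[].
have sn : 0 <= s ^+ #|A| by rewrite exprn_ge0 // ltW.
rewrite -mulr_sumr ler_wpM2l //.
rewrite (reindex_inj (inv_inj phiK)) /=.
under eq_bigr do rewrite phiK.
rewrite [X in X <= _]big_mkcond [X in _ <= X]big_mkcond /=; apply: ler_sum => m _.
case: ifP => [/er[]|_]; first by rewrite phiK => ->.
by case: ifP => // _; rewrite ltW ?frozen_weight_gt0.
Qed.

Section Inner.
Variables (a b : nat).
Hypotheses (loa : (lo < a)%N) (bhi : (b < hi)%N).

Lemma inner_window_edges : inner d N a b \subset window_edges.
Proof.
apply/subsetP => e; rewrite !inE => /forallP h.
apply/andP; split; apply/forallP => k; have /andP[h1 h2] := h k.
  by rewrite (leq_trans (ltnW loa) h1) (leq_trans (ltnW h2) (ltnW bhi)).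
have /andP[u1 u2] := up_bounds e.1 e.2 k.
by rewrite (leq_trans (ltnW loa) (leq_trans h1 u1)) (leq_trans u2 (leq_trans h2 (ltnW bhi))).
Qed.

Lemma frozen_exchange m B1 B2 : frozen m -> clos B1 (cutset m) -> B1 \subset inner d N a b ->
  even_set B2 -> B2 \subset inner d N a b -> clos B2 ((cutset m :\: B1) :|: B2) ->
  [disjoint cutset m :\: B1 & B2] ->
  let m' := addc m (fun x => pot x0 B1 x (+) pot x0 B2 x) in
  frozen m' /\ frozen_weight m' * (s ^+ (2 * d)) ^+ #|B1| = frozen_weight m * (s ^+ (2 * d)) ^+ #|B2|.
Proof.
move=> fm c1' i1 e2 i2 c2 dj m'; have e1 := clos_even c1' (cut_even m).
have a0 : (0 < a)%N by apply: leq_ltn_trans loa.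
have cE : cutset m' = cutset m :\: B1 :|: B2 by apply: cut_exchange; rewrite ?clos_sub.
have pi B x : even_set B -> B \subset inner d N a b -> pot x0 B x -> forall k, (a <= x k <= b)%N.
  by move=> eB sB; exact: (pot_inner x0E d2 a0 eB sB).
have pw B x : even_set B -> B \subset inner d N a b -> pot x0 B x -> window x.
  move=> eB sB px; apply/forallP => k; have /andP[h1 h2] := pi B x eB sB px k.
  by rewrite (leq_trans (ltnW loa) h1) (leq_trans h2 (ltnW bhi)).
have pr B x : even_set B -> B \subset inner d N a b -> rim x -> pot x0 B x = false.
  move=> eB sB /andP[_ /existsP[k hk]]; apply/negP => /(pi B x eB sB)/(_ k).
  by case/orP: hk => /eqP ->; rewrite ?[(a <= lo)%N]leqNgt ?loa // [(hi <= b)%N]leqNgt bhi andbF.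
split.
  apply/frozenP => x; rewrite ffunE; case p1: (pot x0 B1 x); first by move=> _; apply: pw p1.
  case p2: (pot x0 B2 x); first by move=> _; apply: pw p2.
  by rewrite !addbF; apply: (frozenP _ fm).
have rE : [set x | rim x & m' x] = [set x | rim x & m x].
  apply/setP => x; rewrite !inE ffunE; case rx: (rim x) => //=.
  by rewrite !pr // !addbF.
have wE : cutset m' :&: window_edges = (cutset m :&: window_edges) :\: B1 :|: B2.
  rewrite cE; apply/setP => e; rewrite !(in_setI, in_setU, in_setD).
  have := subsetP inner_window_edges e; have := subsetP i2 e.
  case: (e \in B2); last by rewrite !orbF andbA.
  by rewrite !orbT => /(_ isT) -> /(_ isT) ->.
have sB : B1 \subset cutset m :&: window_edges.
  by rewrite subsetI clos_sub // (subset_trans i1 inner_window_edges).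
have dB : [disjoint (cutset m :&: window_edges) :\: B1 & B2].
  rewrite -setI_eq0; apply/eqP/setP => e; rewrite !(in_setI, in_setD) in_set0.
  have := disjoint_nmem e dj; rewrite in_setD.
  by case: (e \in B1); case: (e \in cutset m); case: (e \in B2); case: (e \in window_edges).
rewrite /frozen_weight rE wE -!exprD; congr (_ ^+ _).
by rewrite addnAC [RHS]addnAC (card_exchange sB dB).
Qed.

End Inner.
End FrozenModel.

Section PhaseComparison.
Local Open Scope ring_scope.
Variables (d N : nat).
Local Notation V := {ffun 'I_d -> 'I_N}.
Local Notation E := (V * 'I_d)%type.
Local Notation C := {ffun V -> bool}.
Variables (R : realFieldType) (x0 : V) (s c q : R) (bf : C -> R).
Hypotheses (x0E : forall i, x0 i = 0%N :> nat) (d2 : (2 <= d)%N).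
Hypotheses (s0 : 0 < s) (s1 : s <= 1) (c1 : 1 <= c) (bf0 : forall m, 0 < bf m).
Hypothesis bf_le : forall m m' : C,
  bf m <= c ^+ #|[set x | on_face x & m x != m' x]| * bf m'.
Let t := s ^+ (2 * d).
Hypotheses (sq : s <= q) (tcq : t * c ^+ (4 * d) <= q) (q1 : q <= 1).
Let w := free_weight t bf.
Let Z := \sum_(m | plus_phase x0 m) w m.

Let t0 : 0 < t. Proof. exact: exprn_gt0. Qed.
Let q0 : 0 <= q. Proof. exact: le_trans (ltW s0) sq. Qed.
Let tc0 : 0 <= t * c ^+ (4 * d).
Proof. by rewrite mulr_ge0 ?ltW // exprn_gt0 // (lt_le_trans _ c1). Qed.
Let free_peierls_q A : \sum_(m | plus_phase x0 m && clos A (cutset m)) w m <= q ^+ #|A| * Z.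
Proof.
apply: le_trans (free_peierls x0 t0 c1 bf0 bf_le A) _.
by rewrite ler_pM2r ?(free_part_gt0 x0 t0 bf0) // lerXn2r // nnegrE.
Qed.

Lemma free_minus_prob x : (entropy d)%:R * q <= 2^-1 ->
  \sum_(m : C | plus_phase x0 m && m x) w m <= 2 * ((entropy d)%:R * q) * Z.
Proof.
move=> hq; have w0 m : 0 <= w m by rewrite ltW // free_weight_gt0.
apply: le_trans (_ : \sum_(W | reaches x W && (1 <= #|W|)%N) q ^+ #|W| * Z <= _); last first.
  rewrite -mulr_suml ler_pM2r ?(free_part_gt0 x0 t0 bf0) //.
  by apply: le_trans (sum_reaches x (ltn0Sn 0) q0 hq) _; rewrite expr1.
apply: le_trans (_ : \sum_(W : {set E} | reaches x W && (1 <= #|W|)%N)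
   \sum_(m | plus_phase x0 m && clos W (cutset m)) w m <= _); last first.
  by apply: ler_sum => W _; apply: free_peierls_q.
rewrite (exchange_big_dep (plus_phase x0)) /=; last by move=> W m _ /andP[].
rewrite big_mkcondr /=; apply: ler_sum => m pm.
have sg : 0 <= \sum_(W | [&& reaches x W, (1 <= #|W|)%N, plus_phase x0 m & clos W (cutset m)]) w m by apply: sumr_ge0.
case: ifP => [mx|_]; last by rewrite (eq_bigl _ _ (fun W => esym (andbA _ _ _))).
have [W /andP[hW iW]|nc] := pickP (fun W => (W \in comps (cutset m)) && inside x0 W x); last first.
  move: mx; rewrite (plus_phaseP _ _ pm) /chis big1 // => W hW.
  by have := nc W; rewrite hW.
have [e eW] := comps_neq0 hW.
rewrite (bigD1 W) /=; last first.
  rewrite pm comps_clos //= andbT; apply/andP; split; last by apply/card_gt0P; exists e.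
  rewrite /reaches (comps_conn hW); apply/exists_inP; exists e => //.
  exact: (interior_near d2 (clos_even (comps_clos hW) (cut_even m)) (comps_conn hW) iW eW).
by rewrite lerDl; apply: sumr_ge0.
Qed.

Variables (lo hi a b r : nat) (S : {set V}) (g : C -> R) (M : R).
Hypotheses (lo0 : (0 < lo)%N) (hiN : (hi.+1 < N)%N) (loa : (lo < a)%N) (ab : (a <= b)%N) (bhi : (b < hi)%N).
Hypothesis vol : (2 * (b - a).+1 ^ d <= N ^ d)%N.
Hypotheses (r0 : (0 < r)%N)
  (Sin : forall x k, x \in S -> (a + 5 * r <= x k)%N && (x k + 5 * r <= b)%N).
Hypotheses (gS : forall m m' : C, {in S, m =1 m'} -> g m = g m') (gM : forall m, `|g m| <= M).
Hypothesis ent : (entropy d)%:R * (4 * q) <= 2^-1.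

Let chi (f : bool) := if f then pot x0 else inside x0.
Let Om (f : bool) : pred C := if f then frozen lo hi else plus_phase x0.
Let wt2 (f : bool) := if f then frozen_weight s lo hi else w.

Lemma reaches_far x W : x \in S -> reaches x W -> ~~ (W \subset inner d N a b) -> (r <= #|W|)%N.
Proof.
move=> xS /andP[cW /exists_inP[e eW /forallP we]] /subsetPn[e' eW' /negP out].
rewrite leqNgt; apply/negP => lt; apply: out; rewrite inE; apply/forallP => k.
have := conn_diam k cW eW eW'; have := conn_diam k cW eW' eW; have := we k; have := Sin k xS.
move: lt; move: #|W| (e.1 k : nat) (e'.1 k : nat) (x k : nat) => n u v y.
clear; lia.
Qed.

Lemma free_frozen_close :
  `|(\sum_(m : C | plus_phase x0 m) g m * w m) / Z -
    (\sum_(m : C | frozen lo hi m) g m * frozen_weight s lo hi m) / \sum_(m : C | frozen lo hi m) frozen_weight s lo hi m|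
  <= 2 * M * (#|S|%:R * (2 * ((entropy d)%:R * (4 * q)) ^+ r)).
Proof.
have M0 : 0 <= M by apply: le_trans (normr_ge0 _) (gM [ffun=> false]).
have := @expect_close d N R x0 (inner d N a b) chi Om wt2 q t.
rewrite /expect /Zpart /= => H.
have a0 : (0 < a)%N := leq_ltn_trans (leq0n lo) loa.
have bN : (b.+1 < N)%N := leq_ltn_trans bhi (ltnW hiN).
have {}H := fun h1 h2 h3 h4 h5 h6 h7 => H h1 h2 h3 h4 h5 q0 q1 t0 h6 h7 S g M gS gM.
apply: le_trans (H _ _ _ _ _ _ _) _.
- by case=> m om; [exact: (frozen_chis x0E d2 lo0 om)|exact: (elimT (plus_phaseP _ _) om)].
- case=> m W x e om hW hx eW; first exact: (frozen_near x0E d2 lo0 om hW hx eW).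
  exact: (interior_near d2 (clos_even (comps_clos hW) (cut_even m)) (comps_conn hW) hx eW).
- by case=> A eA sA //; apply: (interior_inner x0E d2 a0 ab vol).
- by case=> m; rewrite ltW //; [apply: frozen_weight_gt0|apply: free_weight_gt0].
- by case; [apply: frozen_part_gt0|apply: free_part_gt0].
- case=> A; last exact: free_peierls_q.
  apply: le_trans (frozen_peierls x0E d2 s0 s1 lo0 hiN A) _.
  by rewrite ler_pM2r ?(frozen_part_gt0 d N) // lerXn2r // nnegrE ltW.
- case=> m B1 B2; first exact: (frozen_exchange s x0E d2 loa bhi).
  exact: (free_exchange t x0E d2 bf_le a0 ab bN vol).
rewrite ler_wpM2l ?mulr_ge0 //.
rewrite [X in _ <= X]mulr_natl -sumr_const; apply: ler_sum => x xS.
have q4 : 0 <= 4 * q by rewrite mulr_ge0.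
apply: le_trans (sum_reaches x r0 q4 ent).
rewrite [X in X <= _]big_mkcond [X in _ <= X]big_mkcond; apply: ler_sum => W _.
case: ifP => [/andP[rW iW]|_]; last by case: ifP; rewrite ?exprn_ge0.
by rewrite rW (reaches_far xS rW iW).
Qed.

End PhaseComparison.

(** * Antichains and the Littlewood-Offord bound *)

Section LittlewoodOfford.
Implicit Types (T : finType).

(* Lubell-Yamamoto-Meshalkin: if [G] itself is not in the antichain, write
   (g - a)! as the sum over x in G minus A of (g - a - 1)! and apply
   the induction hypothesis to each G minus x. *)
Lemma lym T (G : {set T}) (F : {set {set T}}) :
  (forall A, A \in F -> A \subset G) ->
  (forall A B, A \in F -> B \in F -> A \subset B -> A = B) ->
  \sum_(A in F) #|A|`! * (#|G| - #|A|)`! <= #|G|`!.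
Proof.
move: {2}#|G| (leqnn #|G|) => g; elim: g G F => [|g IH] G F eg sub anti.
  all: have [GF|GF] := boolP (G \in F).
  1,3: rewrite (bigD1 G) //= subnn muln1 big1 ?addn0 // => A /andP[AF AG];
    by rewrite (anti _ _ AF GF (sub _ AF)) eqxx in AG.
  rewrite big1 // => A AF; case/negP: GF; rewrite -(_ : A = G) //; apply/eqP.
  by rewrite eqEcard sub //=; apply: leq_trans eg (leq0n _).
have lt A : A \in F -> #|A| < #|G|.
  move=> AF; rewrite ltn_neqAle subset_leq_card ?sub // andbT.
  apply: contraNneq GF => eA; rewrite -(_ : A = G) //; apply/eqP.
  by rewrite eqEcard sub // eA /=.
have [G0|[x0 x0G]] := set_0Vmem G.
  by rewrite big1 // => A /lt; rewrite G0 cards0.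
have cG x : x \in G -> #|G :\ x| = #|G|.-1 by move=> xG; rewrite (cardsD1 x G) xG.
apply: leq_trans (_ : \sum_(x in G) \sum_(A in [set A in F | x \notin A]) #|A|`! * (#|G :\ x| - #|A|)`! <= _).
  rewrite (exchange_big_dep (mem F)) /=; last by move=> x A _; rewrite inE => /andP[].
  apply: leq_sum => A AF.
  rewrite (eq_bigl (mem (G :\: A))) => [|x]; last by rewrite !inE AF /= andbC.
  rewrite (eq_bigr (fun=> #|A|`! * (#|G|.-1 - #|A|)`!)) => [|x]; last by rewrite !inE => /andP[_ /cG ->].
  rewrite sum_nat_const cardsD (setIidPr (sub _ AF)) mulnCA leq_mul2l; apply/orP; right.
  have := lt _ AF; case: #|G| => // m; rewrite ltnS => le /=.
  by rewrite subSn // factS.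
apply: leq_trans (_ : \sum_(x in G) (#|G|.-1)`! <= _).
  apply: leq_sum => x xG; rewrite -(cG x xG); apply: IH.
  - by rewrite cG // -ltnS (leq_trans _ eg) // prednK // card_gt0; apply/set0Pn; exists x.
  - move=> A; rewrite inE => /andP[AF xA]; apply/subsetP => y yA.
    by rewrite !inE (subsetP (sub _ AF)) // andbT; apply: contraNneq xA => <-.
  - by move=> A B; rewrite !inE => /andP[AF _] /andP[BF _]; apply: anti.
rewrite sum_nat_const; have : 0 < #|G| by rewrite card_gt0; apply/set0Pn; exists x0.
by case: #|G| => // m _; rewrite factS.
Qed.

Lemma fact_central k l i : k <= l -> k`! * l`! <= (l + i)`! * (k - i)`!.
Proof.
move=> kl; elim: i => [|i IH]; first by rewrite addn0 subn0 mulnC.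
apply: leq_trans IH _; have [ki|ik] := leqP k i.
  have -> : k - i = 0 by lia.
  have -> : k - i.+1 = 0 by lia.
  by rewrite !muln1 addnS factS leq_pmull.
have -> : k - i = (k - i.+1).+1 by lia.
rewrite addnS !factS mulnCA -mulnA leq_mul2r; apply/orP; right; lia.
Qed.

Lemma central_bin k : 'C(k.*2, k) ^ 2 * (k.*2).+1 <= 4 ^ k.*2.
Proof.
elim: k => [//|k IH].
have e : 'C(k.+1.*2, k.+1) * k.+1 = 2 * (k.*2).+1 * 'C(k.*2, k).
  have h m : 'C(m.*2, m) * (m`! * m`!) = (m.*2)`!.
    by rewrite -[in RHS](bin_fact (_ : m <= m.*2)) -?addnn ?leq_addr // addnK.
  have := h k.+1; rewrite doubleS !factS -(h k).
  have k0 : 0 < k.+1 * (k`! * k`!) by rewrite !muln_gt0 !fact_gt0.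
  move=> E; apply/eqP; rewrite -(eqn_pmul2r k0); apply/eqP.
  move: E; move: 'C(_, _) 'C(_, _) (k`!) => a b f; nia.
have k0 : 0 < k.+1 ^ 2 by rewrite expn_gt0.
rewrite -(leq_pmul2r k0) mulnAC -expnMn e !expnMn.
have -> : 4 ^ k.+1.*2 = 16 * 4 ^ k.*2 by rewrite doubleS !expnS mulnA.
move: IH; move: ('C(_, _) ^ 2) (4 ^ k.*2) => a b; rewrite -addnn => h.
have h2 : (k + k).+1 * (k.+1 + k.+1).+1 <= 4 * k.+1 ^ 2 by rewrite expnS expn1; lia.
rewrite doubleS -addnn; nia.
Qed.

Lemma half_bin n : 'C(n, n./2) ^ 2 * n.+1 <= 4 ^ n.
Proof.
move: (n./2) (odd_double_half n) => k; case: (odd n) => <-; last by rewrite add0n central_bin.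
rewrite add1n.
have := central_bin k.+1; rewrite doubleS binS -[X in 'C(_, X)](_ : k.*2.+1 - k = k.+1); last first.
  by rewrite -addnn -addSn addnK.
rewrite bin_sub; last by rewrite -addnn -addSn leq_addl.
rewrite addnn -mul2n expnMn [4 ^ k.*2.+2]expnS => h.
rewrite -(leq_pmul2l (isT : 0 < 4)); apply: leq_trans h.
by rewrite mulnA leq_mul2l ltnS leqnSn orbT.
Qed.

Lemma sperner T (G : {set T}) (F : {set {set T}}) :
  (forall A, A \in F -> A \subset G) ->
  (forall A B, A \in F -> B \in F -> A \subset B -> A = B) ->
  #|F| ^ 2 * #|G|.+1 <= 4 ^ #|G|.
Proof.
move=> sub anti; set n := #|G|; pose k := n./2; pose l := n - k.
have kl : k <= l by rewrite /l /k; have := odd_double_half n; lia.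
have kn : k + l = n by rewrite /l /k; have := odd_double_half n; lia.
have lk : l <= k.+1 by rewrite /l /k; have := odd_double_half n; lia.
have le : #|F| * (k`! * l`!) <= n`!.
  apply: leq_trans (lym sub anti); rewrite -sum_nat_const; apply: leq_sum => A AF.
  have An : #|A| <= n by rewrite subset_leq_card // sub.
  have [lA|Al] := leqP l #|A|.
    have := fact_central (#|A| - l) kl; rewrite subnKC // (_ : k - (#|A| - l) = n - #|A|) //; lia.
  have := fact_central (n - #|A| - l) kl; rewrite subnKC; last by lia.
  by rewrite (_ : k - _ = #|A|) 1?[X in _ <= X]mulnC //; lia.
have F0 : 0 < k`! * l`! by rewrite muln_gt0 !fact_gt0.
have {}le : #|F| <= 'C(n, k).
  by rewrite -(leq_pmul2r F0) /l bin_fact // -kn leq_addr.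
apply: leq_trans (half_bin n); rewrite leq_mul2r; apply/orP; right.
by rewrite leq_exp2r.
Qed.

Lemma littlewood_offord T (B Q : {set T}) (I : pred {set T}) : B \subset Q ->
  (forall A A' : {set T}, A' \subset Q -> A \subset A' -> A' :\: A \subset B -> I A -> I A' -> A = A') ->
  #|[set A : {set T} | A \subset Q & I A]| ^ 2 * #|B|.+1 <= 4 ^ #|Q|.
Proof.
move=> BQ anti; pose N (D : {set T}) := #|[set A : {set T} | A \subset B & I (A :|: D)]|.
pose M := \max_(D in powerset (Q :\: B)) N D.
have hM : M ^ 2 * #|B|.+1 <= 4 ^ #|B|.
  rewrite /M; elim/big_ind: _ => [|x y hx hy|D].
  - by rewrite mul0n.
  - by rewrite /maxn; case: ifP.
  rewrite inE => DQ; apply: sperner => [A|A A']; first by rewrite inE => /andP[].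
  have dB : [disjoint B & D].
    by move: DQ; rewrite subsetD disjoint_sym => /andP[].
  rewrite !inE => /andP[AB IA] /andP[AB' IA'] AA'.
  have DQ' : D \subset Q by move: DQ; rewrite subsetD => /andP[].
  have := anti _ _ _ _ _ IA IA' => /(_ _ _ _)/setP e.
  have key (X : {set T}) : X \subset B -> (X :|: D) :&: B = X.
    by move=> XB; rewrite setIUl (setIidPl XB) [D :&: B]setIC (eqP (_ : B :&: D == set0)) ?setI_eq0 // setU0.
  rewrite -(key A AB) -(key A' AB'); congr (_ :&: _); apply/setP/e.
  - by rewrite subUset (subset_trans AB' BQ).
  - by rewrite setSU.
  - apply/subsetP => x; rewrite !inE negb_or => /andP[/andP[_ xD]]; rewrite (negbTE xD) orbF.
    exact: (subsetP AB').
have hT : #|[set A : {set T} | A \subset Q & I A]| <= 2 ^ (#|Q| - #|B|) * M.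
  rewrite -sum1_card (partition_big (fun A => A :\: B) (mem (powerset (Q :\: B)))) /=; last first.
    by move=> A; rewrite !inE => /andP[AQ _]; apply: setSD.
  apply: leq_trans (_ : \sum_(D in powerset (Q :\: B)) M <= _); last first.
    by rewrite sum_nat_const card_powerset cardsD (setIidPr BQ).
  apply: leq_sum => D hD; apply: leq_trans (_ : N D <= _); last exact: leq_bigmax_cond.
  rewrite sum1dep_card; set S := [set A | _].
  have Si : {in S &, injective (fun A => A :&: B)}.
    move=> A A'; rewrite !inE => /andP[_ /eqP e] /andP[_ /eqP e'] h.
    by rewrite -(setID A B) -(setID A' B) h e e'.
  rewrite -(card_in_imset Si); apply/subset_leq_card/subsetP => _ /imsetP[A + ->].
  by rewrite !inE => /andP[/andP[_ IA] /eqP <-]; rewrite subsetIr setID.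
have e : 4 ^ #|Q| = (2 ^ (#|Q| - #|B|)) ^ 2 * 4 ^ #|B|.
  by rewrite -[4]/(2 ^ 2) -!expnM mulnC -expnD [2 * #|B|]mulnC -mulnDl subnK ?subset_leq_card // mulnC.
rewrite e; apply: leq_trans (_ : (2 ^ (#|Q| - #|B|) * M) ^ 2 * #|B|.+1 <= _).
  by rewrite leq_mul2r leq_exp2r // hT orbT.
by rewrite expnMn -mulnA leq_mul2l hM orbT.
Qed.

Lemma binomial_inverse_moment (R : realFieldType) T (Q : {set T}) (p q : R) :
  (0 < p -> 0 <= q -> p + q = 1 ->
  \sum_(S in powerset Q) p ^+ #|S| * q ^+ (#|Q| - #|S|) / #|S|.+1%:R <= (p * #|Q|.+1%:R)^-1)%R.
Proof.
move=> p0 q0 pq; set n := #|Q|.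
have e : (\sum_(S in powerset Q) p ^+ #|S| * q ^+ (n - #|S|) / #|S|.+1%:R =
    \sum_(k < n.+1) 'C(n, k)%:R * (p ^+ k * q ^+ (n - k) / k.+1%:R))%R.
  rewrite (partition_big (fun S : {set T} => inord #|S| : 'I_n.+1) xpredT) //=.
  apply: eq_bigr => k _.
  rewrite (eq_bigr (fun=> p ^+ k * q ^+ (n - k) / k.+1%:R)%R); last first.
    by move=> S /andP[]; rewrite inE => SQ /eqP <-; rewrite inordK // ltnS subset_leq_card.
  rewrite sumr_const mulr_natl; congr (_ *+ _)%R.
  rewrite -(cards_draws Q k) -cardsE; congr #|pred_of_set _|; apply/setP => S; rewrite !inE unfold_in inE.
  case SQ: (S \subset Q) => //=; rewrite -(inj_eq val_inj) /= inordK // ltnS subset_leq_card //.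
rewrite e -[X in (_ <= X)%R]mul1r ler_pdivlMr ?mulr_gt0 ?ltr0n // mulr_suml.
have E : ((q + p) ^+ n.+1 = 1)%R by rewrite addrC pq expr1n.
rewrite -[X in (_ <= X)%R]E exprDn [X in (_ <= X)%R]big_ord_recl ler_wpDl //.
  by rewrite mulrn_wge0 // mulr_ge0 // exprn_ge0 // ltW.
rewrite le_eqVlt; apply/orP; left; apply/eqP; apply: eq_bigr => k _.
rewrite lift0 subSS -[RHS]mulr_natl exprS.
have := mul_bin_diag n.+1 k; rewrite /= => h.
have k0 : (k.+1%:R != 0 :> R)%R by rewrite pnatr_eq0.
have h' : (n.+1%:R * 'C(n, k)%:R = k.+1%:R * 'C(n.+1, k.+1)%:R :> R)%R by rewrite -!natrM h.
have -> : ('C(n.+1, k.+1)%:R = n.+1%:R * 'C(n, k)%:R / k.+1%:R :> R)%R by rewrite h' mulrAC divff // mul1r.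
move: (p ^+ k)%R (q ^+ (n - k))%R ('C(n, k)%:R)%R (k.+1%:R)%R (n.+1%:R)%R k0 => a b f g u g0.
by field.
Qed.

End LittlewoodOfford.

Section SignFlips.
Variables (T : finType).
Implicit Types (Q B pos A P : {set T}).

Definition symdiff A B : {set T} := (A :\: B) :|: (B :\: A).

Lemma in_symdiff A B x : (x \in symdiff A B) = (x \in A) (+) (x \in B).
Proof. by rewrite !inE; case: (x \in A); case: (x \in B). Qed.

Lemma symdiffK B : involutive (symdiff^~ B).
Proof. by move=> A; apply/setP => x; rewrite !in_symdiff -addbA addbb addbF. Qed.

Lemma card_flips Q B pos (I : pred {set T}) : B \subset Q -> pos \subset Q ->
  (forall P P', P' \subset Q -> P \subset P' -> P' :\: P \subset B ->
     I (symdiff P pos) -> I (symdiff P' pos) -> P = P') ->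
  #|[set A : {set T} | A \subset Q & I A]| ^ 2 * #|B|.+1 <= 4 ^ #|Q|.
Proof.
move=> BQ pQ anti; apply: leq_trans (littlewood_offord BQ anti).
rewrite leq_mul2r leq_exp2r // -(card_imset _ (inv_inj (symdiffK pos))) subset_leq_card ?orbT //.
apply/subsetP => _ /imsetP[A + ->]; rewrite !inE symdiffK => /andP[AQ ->]; rewrite andbT.
by apply/subsetP => x; rewrite in_symdiff; case: (boolP (x \in A)) => [/(subsetP AQ)|_ /(subsetP pQ)].
Qed.

(* [y <= (1 / al + al y ^ 2) / 2] by AM-GM, which turns the square root of the
   Littlewood-Offord bound into the inverse moment of [#|B|.+1]. *)
Lemma card_flips_real (R : realFieldType) Q B pos (I : pred {set T}) (al : R) : (0 < al)%R ->
  B \subset Q -> pos \subset Q ->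
  (forall P P', P' \subset Q -> P \subset P' -> P' :\: P \subset B ->
     I (symdiff P pos) -> I (symdiff P' pos) -> P = P') ->
  (#|[set A : {set T} | A \subset Q & I A]|%:R <=
   2 ^+ #|Q| * ((al^-1 + al / #|B|.+1%:R) / 2))%R.
Proof.
move=> al0 BQ pQ anti; have := card_flips BQ pQ anti; move: #|[set A | _]| #|B| #|Q| => c b q h.
have p0 : (0 < 2 ^+ q :> R)%R by rewrite exprn_gt0.
have b0 : (0 < b.+1%:R :> R)%R by rewrite ltr0n.
have {h} : (c%:R ^+ 2 * b.+1%:R <= (2 ^+ q) ^+ 2 :> R)%R.
  rewrite -exprM mulnC exprM -(natrX R 2) -[(2 ^ 2)%N]/4 -!natrX -natrM ler_nat.
  by rewrite expnE; apply: leq_trans h _.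
pose y : R := (c%:R / 2 ^+ q)%R.
have -> : (c%:R = 2 ^+ q * y :> R)%R by rewrite /y mulrC divfK // gt_eqF.
rewrite exprMn -mulrA -[X in (_ <= X)%R]mulr1 ler_pM2l ?exprn_gt0 // => h.
rewrite ler_pM2l //; move: (b.+1%:R : R)%R b0 h => g g0 h.
have y2 : (y ^+ 2 <= g^-1)%R by rewrite -[X in (_ <= X)%R]mul1r ler_pdivlMr.
have : (0 <= (1 - al * y) ^+ 2 / al)%R by rewrite divr_ge0 ?sqr_ge0 // ltW.
have -> : ((1 - al * y) ^+ 2 / al = al^-1 - 2 * y + al * y ^+ 2)%R.
  by field; rewrite gt_eqF.
have : (al * y ^+ 2 <= al * g^-1)%R by rewrite ler_pM2l.
move: (al * y ^+ 2)%R (al * g^-1)%R => u v; lra.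
Qed.

End SignFlips.

Section BottomFace.
Variables (d n : nat) (i : 'I_d).

Definition bottom_face : {set {ffun 'I_d -> 'I_n.+1}} := [set x : {ffun 'I_d -> 'I_n.+1} | x i == ord0].

Lemma card_bottom_face : #|bottom_face| * n.+1 = n.+1 ^ d.
Proof.
have := sum_face (d := d) (fun=> 1) i (ord0 : 'I_n.+1); rewrite /= [X in _ = X]sum1_card card_grid => <-.
rewrite -sum1dep_card big_distrl /=; apply: eq_bigr => x _.
by rewrite sum_nat_const card_ord mulnC.
Qed.

Lemma bottom_on_face x : x \in bottom_face -> on_face x.
Proof. by rewrite inE => /eqP xi; apply/existsP; exists i; rewrite xi. Qed.

End BottomFace.

From mathcomp Require Import boolp reals sequences exp.

(** * The Ising model in a box *)

Section GridSites.
Variables (d n : nat).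
Local Notation V := {ffun 'I_d -> 'I_n}.
Implicit Types (x y : V) (i j k : 'I_d).

Definition steps_to x y i : bool := (y == up x i) && (up x i != x).

Lemma steps_toP x y i :
  reflect (y i = (x i).+1 :> nat /\ forall j, j != i -> y j = x j) (steps_to x y i).
Proof.
apply: (iffP andP) => [[/eqP -> h]|[h1 h2]].
  split=> [|j ji]; first by rewrite up_val // eqxx add1n.
  by rewrite setcE (negbTE ji).
have -> : y = up x i.
  apply/ffunP => j; rewrite setcE; case: eqP => [->|/eqP ji]; last exact: h2.
  by apply: val_inj; rewrite /= val_succ_sat -h1 ltn_ord h1.
split=> //; apply/eqP => /ffunP/(_ i); rewrite setcE eqxx => /(congr1 val).
by rewrite /= val_succ_sat -h1 ltn_ord => e; move: h1; rewrite e; lia.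
Qed.

Lemma adj_sites x y : adj (site_of x) (site_of y) = (\sum_i ((x i - y i) + (y i - x i)) == 1)%N.
Proof.
rewrite /adj; congr (_ == _); apply: eq_bigr => i _; rewrite !ffunE.
move: (x i : nat) (y i : nat) => u v; lia.
Qed.

Lemma adj_steps x y :
  (adj (site_of x) (site_of y) : nat) = (\sum_i (steps_to x y i + steps_to y x i))%N.
Proof.
have [a|na] := boolP (adj _ _).
  move: a; rewrite adj_sites => /sum_nat_eq1[i [_ hi hj]].
  have oth j : j != i -> x j = y j.
    move=> ji; apply: val_inj => /=; have := hj j ji isT.
    by move: (x j : nat) (y j : nat) => u v; lia.
  rewrite (bigD1 i) //= big1 ?addn0 => [|j ji].
    have e1 : steps_to x y i = (y i == (x i).+1 :> nat).
      by apply/steps_toP/eqP => [[]//|h]; split=> // j /oth.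
    have e2 : steps_to y x i = (x i == (y i).+1 :> nat).
      by apply/steps_toP/eqP => [[]//|h]; split=> // j /oth.
    by rewrite e1 e2; move: hi; move: (x i : nat) (y i : nat) => u v; do 2 case: eqP => /=; lia.
  have ne : x i <> y i by move=> e; move: hi; rewrite e; lia.
  rewrite eq_sym in ji.
  case: steps_toP => [[_ /(_ i ji) e]|_]; first by case: ne.
  by case: steps_toP => [[_ /(_ i ji) e]|_] //; case: ne.
rewrite big1 // => i _.
have key u v : (u = x /\ v = y) \/ (u = y /\ v = x) -> steps_to u v i = false.
  move=> uv; apply/negP => /steps_toP[h1 h2]; case/negP: na; rewrite adj_sites.
  apply/sum_nat_eq1; exists i; split => // [|j ji _].
    by case: uv => -[<- <-]; rewrite h1; lia.
  by case: uv => -[<- <-]; rewrite h2 // subnn.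
by rewrite !key; auto.
Qed.

Lemma in_box_site x : in_box n (site_of x).
Proof.
apply/forallP => i; rewrite ffunE; have := ltn_ord (x i).
by move: (x i : nat) => u h; lia.
Qed.

Lemma on_boundaryE x : on_boundary x = on_face x.
Proof.
apply/asboolP/existsP => [[y [/sum_nat_eq1[i [_ hi hj]]]] /forallPn[j hj'] | [i hi]].
  have hx := forallP (in_box_site x).
  exists i; case: (eqVneq j i) => [e|ji]; last first.
    have := hx j; move: hj'; have := hj j ji isT.
    by rewrite !ffunE; move: (x j : nat) (y j) => u v; lia.
  rewrite e in hj'; move: hi hj' (hx i) (ltn_ord (x i)); rewrite !ffunE.
  by move: (x i : nat) (y i) => u v; lia.
pose y := [ffun j => if j == i then
  (if x i == 0 :> nat then site_of x i - 1 else site_of x i + 1)%R else site_of x j] : site d.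
exists y; split.
  apply/sum_nat_eq1; exists i; split => // [|j ji _]; rewrite /y !ffunE ?eqxx ?(negbTE ji).
    by case: ifP => _; lia.
  by rewrite subrr.
apply/forallPn; exists i; rewrite /y ffunE eqxx; move: hi; rewrite !ffunE.
by have := ltn_ord (x i); case: eqP; move: (x i : nat) => u; lia.
Qed.

Lemma site_of_inj : injective (@site_of d n).
Proof.
move=> x y /ffunP e; apply/ffunP => k; apply: val_inj => /=.
by have := e k; rewrite !ffunE; move: (x k : nat) (y k : nat) => u v; lia.
Qed.

Lemma extend_site (s : {ffun boxpt d n -> bool}) (x : boxpt d n) : extend s (site_of x) = s x.
Proof.
rewrite /extend; case: pickP => [x' /eqP/site_of_inj -> //|/(_ x)].
by rewrite eqxx.
Qed.

Lemma site_onto (z : site d) : (forall k, 2 * `|z k|%N < n) -> exists x : boxpt d n, site_of x = z.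
Proof.
move=> hz.
have h k : `|(z k + n%:Z - 1 - (n %/ 2)%:Z)%R|%N < n.
  by have := hz k; move: (z k) => u; lia.
exists [ffun k => Ordinal (h k)]; apply/ffunP => k; rewrite !ffunE /=.
by have := hz k; move: (z k) => u; lia.
Qed.

End GridSites.

Section Hamiltonian.
Local Open Scope ring_scope.
Variables (R : realType) (d n : nat) (beta : R) (h : boxpt d n -> R).
Local Notation V := (boxpt d n).
Local Notation C := {ffun V -> bool}.

Definition negc (m : C) : C := [ffun x => ~~ m x].

Lemma negcK : involutive negc.
Proof. by move=> m; apply/ffunP => x; rewrite !ffunE negbK. Qed.

Lemma pair_sum (F : V -> V -> R) : (forall x y, F x y = F y x) -> (forall x, F x x = 0) ->
  \sum_x \sum_(y | adj (site_of x) (site_of y)) F x y = 2 * \sum_x \sum_i F x (up x i).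
Proof.
move=> Fs F0.
have e x y : (if adj (site_of x) (site_of y) then F x y else 0) =
    \sum_i (steps_to x y i)%:R * F x y + \sum_i (steps_to y x i)%:R * F x y.
  rewrite -big_split /= (eq_bigr (fun i => (steps_to x y i + steps_to y x i)%:R * F x y)).
    by rewrite -mulr_suml -natr_sum -adj_steps; case: adj; rewrite ?mul1r ?mul0r.
  by move=> i _; rewrite natrD mulrDl.
have S : \sum_x \sum_y \sum_i (steps_to x y i)%:R * F x y = \sum_x \sum_i F x (up x i).
  apply: eq_bigr => x _; rewrite exchange_big; apply: eq_bigr => i _ /=.
  rewrite (bigD1 (up x i)) //= big1 ?addr0 => [|y /negbTE ne]; last by rewrite /steps_to ne mul0r.
  by rewrite /steps_to eqxx /=; case: eqVneq => [->|_]; rewrite ?F0 ?mul0r ?mul1r.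
have S' : \sum_x \sum_y \sum_i (steps_to y x i)%:R * F x y = \sum_x \sum_i F x (up x i).
  rewrite -S exchange_big; apply: eq_bigr => x _; apply: eq_bigr => y _.
  by apply: eq_bigr => i _; rewrite Fs.
rewrite (eq_bigr _ (fun x _ => big_mkcond _ _)) /=.
rewrite (eq_bigr _ (fun x _ => eq_bigr _ (fun y _ => e x y))).
by rewrite (eq_bigr _ (fun x _ => big_split _ _ _ _ _)) big_split /= S S' mulr2n mulrDl mul1r.
Qed.

Lemma hamiltonian_cut (m : C) :
  - hamiltonian beta h (negc m) =
  - (2 * beta * #|cutset m|%:R) + \sum_(x | on_face x) h x * spin R (~~ m x).
Proof.
rewrite /hamiltonian pair_sum; last 2 first.
- by move=> x y; rewrite mulrC.
- by move=> x; case: (negc m x); rewrite /spin; ring.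
have -> : \sum_(x : V) \sum_i (spin R (negc m x) * spin R (negc m (up x i)) - 1) = - 2 * #|cutset m|%:R.
  rewrite -sum1_card natr_sum mulr_sumr pair_big /= [RHS]big_mkcond; apply: eq_bigr => -[x i] _ /=.
  by rewrite inE !ffunE /=; case: (m x); case: (m _); rewrite /= /spin; ring.
rewrite opprB addrC; congr (_ + _); first by field.
by apply: eq_big => [x|x _]; rewrite ?on_boundaryE // ffunE.
Qed.

End Hamiltonian.

Section Embedding.
Variables (d n N : nat).
Hypotheses (n0 : 0 < n) (nN : n.+2 <= N).
Local Notation Vn := {ffun 'I_d -> 'I_n}.
Local Notation VN := {ffun 'I_d -> 'I_N}.
Local Notation Cn := {ffun Vn -> bool}.
Local Notation CN := {ffun VN -> bool}.
Implicit Types (x : Vn) (y : VN) (k : 'I_d).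

Definition shift : nat := (N - N %/ 2) - (n - n %/ 2).

Lemma shift_bounds : (0 < shift) && (shift + n < N).
Proof. rewrite /shift; lia. Qed.

Lemma embed_subproof (u : 'I_n) : u + shift < N.
Proof. have := ltn_ord u; have := shift_bounds; move: (u : nat) => v; lia. Qed.

Definition embed x : VN := [ffun k => Ordinal (embed_subproof (x k))].
Let lo := shift.
Let hi := (shift + n).-1.

Lemma embed_val x k : embed x k = x k + shift :> nat.
Proof. by rewrite ffunE. Qed.

Lemma embed_inj : injective embed.
Proof.
move=> x x' /ffunP e; apply/ffunP => k; apply: val_inj.
by have := congr1 val (e k); rewrite /= !embed_val => /addIn.
Qed.

Lemma site_of_embed x : site_of (embed x) = site_of x.
Proof.
apply/ffunP => k; rewrite !ffunE /=; have := ltn_ord (x k).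
by rewrite /shift; move: (x k : nat) => u; lia.
Qed.

Lemma window_embed x : window lo hi (embed x).
Proof.
apply/forallP => k; rewrite embed_val /lo /hi; have := ltn_ord (x k).
by move: (x k : nat) => u; lia.
Qed.

Lemma embed_onto y : window lo hi y -> exists x, embed x = y.
Proof.
move=> /forallP w.
have h k : y k - shift < n by have := w k; rewrite /lo /hi; move: (y k : nat) => u; lia.
exists [ffun k => Ordinal (h k)]; apply/ffunP => k; apply: val_inj.
rewrite /= embed_val ffunE /= subnK //.
by have := w k; rewrite /lo; case/andP.
Qed.

Definition lift_conf (m : Cn) : CN :=
  [ffun y => if [pick x | embed x == y] is Some x then m x else false].
Definition restr_conf (m : CN) : Cn := [ffun x => m (embed x)].

Lemma lift_embed m x : lift_conf m (embed x) = m x.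
Proof.
rewrite ffunE; case: pickP => [x' /eqP/embed_inj -> //|/(_ x)].
by rewrite eqxx.
Qed.

Lemma lift_out m y : ~~ window lo hi y -> lift_conf m y = false.
Proof.
move=> nw; rewrite ffunE; case: pickP => // x /eqP e.
by rewrite -e window_embed in nw.
Qed.

Lemma frozen_lift m : frozen lo hi (lift_conf m).
Proof. by apply/frozenP => y; apply: contraTT => nw; rewrite lift_out. Qed.

Lemma lift_confK : cancel lift_conf restr_conf.
Proof. by move=> m; apply/ffunP => x; rewrite ffunE lift_embed. Qed.

Lemma restr_confK m : frozen lo hi m -> lift_conf (restr_conf m) = m.
Proof.
move=> fm; apply/ffunP => y; have [w|nw] := boolP (window lo hi y).
  by have [x <-] := embed_onto w; rewrite lift_embed ffunE.
by rewrite lift_out // (frozen_out fm nw).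
Qed.

Lemma up_embed x k : (x k).+1 < n -> up (embed x) k = embed (up x k).
Proof.
move=> h; apply/ffunP => j; apply: val_inj; rewrite /= embed_val !setcE.
case: (eqVneq j k) => [_|_]; last by rewrite embed_val.
rewrite !val_succ_sat embed_val h addSn ifT //.
by have := shift_bounds; move: (x k : nat) h => u; lia.
Qed.

Lemma card_cut_lift m : #|cutset (lift_conf m) :&: window_edges d N lo hi| = #|cutset m|.
Proof.
pose F (e : Vn * 'I_d) := (embed e.1, e.2).
have Fi : injective F by move=> [x i] [x' i'] [/embed_inj -> ->].
rewrite -(card_imset _ Fi); congr #|pred_of_set _|; apply/setP => -[y i].
apply/idP/imsetP => [|[[x j] hx /= [-> e2]]]; last subst i.
  rewrite in_setI !inE /= => /and3P[hc /embed_onto[x ex] wu]; exists (x, i); last by rewrite /F ex.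
  have xn : (x i).+1 < n.
    have := forallP wu i; rewrite setcE eqxx val_succ_sat -ex embed_val.
    have := shift_bounds; have := ltn_ord (x i); rewrite /hi /lo.
    by move: (x i : nat) => u; case: ifP; lia.
  by rewrite inE /= -(lift_embed m x) -(lift_embed m (up x i)) -up_embed // ex.
have xn : (x j).+1 < n.
  by apply: up_neq; apply: cut_nondeg hx.
by move: hx; rewrite in_setI !inE /= up_embed // !lift_embed !window_embed /= andbT.
Qed.

Lemma rim_embed x : rim lo hi (embed x) = on_face x.
Proof.
rewrite /rim window_embed /=; apply: eq_existsb => k; rewrite embed_val /lo /hi.
by have := ltn_ord (x k); move: (x k : nat) => u h; apply/orP/orP => -[]; lia.
Qed.

Lemma card_rim_lift m :
  #|[set y | rim lo hi y & lift_conf m y]| = #|[set x | on_face x & m x]|.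
Proof.
rewrite -(card_imset _ embed_inj); congr #|pred_of_set _|; apply/setP => y.
apply/idP/imsetP => [|[x]]; last by rewrite !inE => /andP[fx mx] ->; rewrite rim_embed fx lift_embed.
rewrite inE => /andP[ry my]; have [x ex] : exists x, embed x = y.
  by apply: embed_onto; case/andP: ry.
by exists x; rewrite // inE -rim_embed -lift_embed ex ry.
Qed.

Lemma extend_lift (m : Cn) z : extend (negc (lift_conf m) : {ffun boxpt d N -> bool}) z =
  extend (negc m : {ffun boxpt d n -> bool}) z.
Proof.
rewrite [in RHS]/extend; case: pickP => [x /eqP <-|nx].
  by rewrite -site_of_embed extend_site !ffunE -[in RHS](lift_embed m) ffunE.
rewrite /extend; case: pickP => // y /eqP ey; rewrite ffunE lift_out //.
apply/negP => /embed_onto[x ex]; have := nx x.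
by rewrite -ey -ex site_of_embed eqxx.
Qed.

End Embedding.

Lemma window_arith (L r n N : nat) : 0 < r -> 4 * (L + 5 * r) + 8 <= n -> n < N ->
  let l := L + 5 * r in let o := (N.+1 - N.+1 %/ 2).-1 in
  let lo := shift n N.+1 in let hi := (shift n N.+1 + n).-1 in
  [/\ 0 < n, 4 * l + 2 <= N.+1, ((o + l) - (o - l)).+1 = 2 * l + 1, 0 < lo /\ hi.+1 < N.+1 &
   [/\ lo < o - l, o - l <= o + l, o + l < hi &
    forall u : nat, `|(u%:Z + (N.+1 %/ 2)%:Z + 1 - N.+1%:Z)%R|%N <= L ->
      (o - l + 5 * r <= u) && (u + 5 * r <= o + l)]].
Proof.
move=> r0 nl nN l o lo hi; rewrite /lo /hi /o /l /shift.
by do !split; try lia.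
Qed.

Lemma mixture_bound (R : realFieldType) (A A' z1 z2 M : R) : (0 < z1 -> 0 < z2 ->
  `|A| <= M * z1 -> `|A'| <= M * z2 ->
  `|(A + A') / (z1 + z2) - A / z1| <= 2 * M * (z2 / z1))%R.
Proof.
move=> z10 z20 b1 b2.
have M0 : (0 <= M)%R by rewrite -(pmulr_lge0 _ z10) (le_trans _ b1).
have -> : ((A + A') / (z1 + z2) - A / z1 = (A' * z1 - A * z2) / ((z1 + z2) * z1))%R.
  by field; rewrite !gt_eqF ?addr_gt0.
rewrite normrM normfV [(`|_ * z1|)%R]gtr0_norm ?mulr_gt0 ?addr_gt0 //.
rewrite ler_pdivrMr ?mulr_gt0 ?addr_gt0 //.
have -> : (2 * M * (z2 / z1) * ((z1 + z2) * z1) = 2 * M * z2 * z1 + 2 * M * z2 * z2)%R.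
  by field; rewrite gt_eqF.
apply: le_trans (ler_normB _ _) _; rewrite !normrM (gtr0_norm z10) (gtr0_norm z20).
apply: le_trans (_ : M * z2 * z1 + M * z1 * z2 <= _)%R.
  by apply: lerD; rewrite ler_pM2r.
have -> : (2 * M * z2 * z1 = M * z2 * z1 + M * z1 * z2)%R by ring.
by rewrite lerDl !mulr_ge0 // ltW.
Qed.

Section GibbsPhases.
Local Open Scope ring_scope.
Variables (R : realType) (d : nat) (beta lamstar : R).
Hypotheses (d2 : (2 <= d)%N) (lam0 : 0 < lamstar).
Hypotheses (beta1 : 8 * d%:R * lamstar <= beta) (beta2 : 8 * d%:R * (entropy d)%:R <= beta).
Local Notation box n := (boxpt d n.+1).
Local Notation conf n := {ffun boxpt d n.+1 -> bool}.

Definition corner n : box n := [ffun=> ord0].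
Definition fweight n (h : box n -> R) (m : conf n) : R := expR (- hamiltonian beta h (negc m)).
Definition Zplus n (h : box n -> R) : R := \sum_(m : conf n | plus_phase (corner n) m) fweight h m.
Definition Eplus n (h : box n -> R) (f : config d -> R) : R :=
  (\sum_(m : conf n | plus_phase (corner n) m) f (extend (negc m)) * fweight h m) / Zplus h.
Definition bounded_field n (h : box n -> R) : Prop := forall x, `|h x| <= lamstar.

Let d0 : (0 < d)%N := ltnW d2.
Let dR : 0 < d%:R :> R. Proof. by rewrite ltr0n. Qed.
Let s : R := expR (- (beta / d%:R)).
Let t : R := expR (- (2 * beta)).
Let c : R := expR (2 * lamstar).
Let face_weight n (h : box n -> R) (m : conf n) : R := expR (\sum_(x | on_face x) h x * spin R (~~ m x)).

Lemma corner0 n i : corner n i = 0%N :> nat.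
Proof. by rewrite ffunE. Qed.

Let beta0 : 0 < beta.
Proof. by apply: lt_le_trans beta1; rewrite !mulr_gt0. Qed.

Let s_gt0 : 0 < s. Proof. exact: expR_gt0. Qed.
Let s_le1 : s <= 1.
Proof. by rewrite -expR0 ler_expR oppr_le0 divr_ge0 // ltW. Qed.
Let c_ge1 : 1 <= c.
Proof. by rewrite -expR0 ler_expR mulr_ge0 // ltW. Qed.

Let tE : t = s ^+ (2 * d).
Proof. by rewrite -expRM_natl natrM; congr expR; field; rewrite gt_eqF. Qed.

Let tc_le : s ^+ (2 * d) * c ^+ (4 * d) <= s.
Proof.
rewrite -tE -expRM_natl -expRD ler_expR natrM.
have d1 : 1 <= d%:R :> R by rewrite ler1n.
have h : beta / d%:R <= beta by rewrite ler_pdivrMr // ler_peMr // ltW.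
have e : 4 * d%:R * (2 * lamstar) = 8 * d%:R * lamstar by ring.
rewrite e; move: (8 * d%:R * lamstar) (beta / d%:R) beta1 h => u v; lra.
Qed.

Let s_small : 8 * ((entropy d)%:R * s) <= 1.
Proof.
have e1 : 8 * (entropy d)%:R <= beta / d%:R by rewrite ler_pdivlMr // mulrAC.
have e2 : (8 * (entropy d)%:R) * s <= expR (beta / d%:R) * s.
  rewrite ler_pM2r //; apply: le_trans e1 _; apply: le_trans (expR_ge1Dx _).
  by rewrite lerDr.
by rewrite mulrA (le_trans e2) // -expRD addrN expR0.
Qed.

Lemma fweight_free n h m : fweight (n := n) h m = free_weight (s ^+ (2 * d)) (face_weight h) m.
Proof.
rewrite /fweight hamiltonian_cut expRD -tE /free_weight /t; congr (_ * _).
by rewrite -expRM_natl; congr expR; ring.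
Qed.

Lemma fweight_gt0 n (h : box n -> R) m : 0 < fweight h m.
Proof. exact: expR_gt0. Qed.

Lemma face_weight_le n (h : box n -> R) : bounded_field h -> forall m m' : conf n,
  face_weight h m <= c ^+ #|[set x | on_face x & m x != m' x]| * face_weight h m'.
Proof.
move=> hb m m'; rewrite /face_weight -expRM_natl -expRD ler_expR.
rewrite -lerBlDr -sumrB -sum1_card natr_sum mulr_suml.
rewrite [X in X <= _]big_mkcond [X in _ <= X]big_mkcond; apply: ler_sum => x _.
rewrite inE; case: (on_face x) => //=; have := hb x; rewrite ler_norml => /andP[h1 h2].
by case: (m x); case: (m' x); rewrite /spin /= ?subrr //; lra.
Qed.

Lemma Zplus_gt0 n (h : box n -> R) : 0 < Zplus h.
Proof.
rewrite /Zplus (eq_bigr _ (fun m _ => fweight_free h m)).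
by apply: free_part_gt0; [apply: exprn_gt0|move=> m; apply: expR_gt0].
Qed.

Lemma minus_prob n (h : box n -> R) x : bounded_field h ->
  \sum_(m : conf n | plus_phase (corner n) m && m x) fweight h m <= 4^-1 * Zplus h.
Proof.
move=> hb; rewrite /Zplus !(eq_bigr _ (fun m _ => fweight_free h m)).
have K0 : 0 <= (entropy d)%:R * s by rewrite mulr_ge0 // ltW.
have fw0 m : 0 < face_weight h m by apply: expR_gt0.
apply: le_trans (free_minus_prob (corner n) d2 s_gt0 c_ge1 fw0 (face_weight_le hb) (lexx s) tc_le _ _) _.
  by move: s_small; lra.
rewrite ler_wpM2r //; last by move: s_small; lra.
by apply: sumr_ge0 => m _; rewrite ltW // free_weight_gt0 // exprn_gt0.
Qed.

Lemma fweight_raise n (h h' : box n -> R) x u m : on_face x ->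
  h' x = h x + u -> (forall y, y != x -> h' y = h y) ->
  fweight h' m = fweight h m * expR (u * spin R (~~ m x)).
Proof.
move=> fx e1 e2; rewrite /fweight !hamiltonian_cut -expRD -addrA; congr (expR (_ + _)).
rewrite (bigD1 x) //= [in RHS](bigD1 x) //= e1 mulrDl addrAC; congr (_ + _ + _).
by apply: eq_bigr => y /andP[_ ne]; rewrite e2.
Qed.

Lemma Zplus_raise n (h h' : box n -> R) x u : bounded_field h -> on_face x -> 0 <= u ->
  h' x = h x + u -> (forall y, y != x -> h' y = h y) -> (1 + u / 2) * Zplus h <= Zplus h'.
Proof.
move=> hb fx u0 e1 e2; have mp := minus_prob x hb.
apply: le_trans (_ : \sum_(m : conf n | plus_phase (corner n) m)
    (fweight h m + u * fweight h m - 2 * u * (fweight h m * (m x)%:R)) <= _).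
  have e : \sum_(m : conf n | plus_phase (corner n) m) fweight h m * (m x)%:R =
      \sum_(m : conf n | plus_phase (corner n) m && m x) fweight h m.
    rewrite [RHS]big_mkcondr; apply: eq_bigr => m _; by case: (m x); rewrite ?mulr1 ?mulr0.
  rewrite !big_split /= sumrN -!mulr_sumr e -/(Zplus h).
  have : 2 * u * (\sum_(m : conf n | plus_phase (corner n) m && m x) fweight h m) <= 2 * u * (4^-1 * Zplus h).
    by rewrite ler_wpM2l // mulr_ge0.
  by move: (Zplus h) (\sum_(m | _) _) => Z S; lra.
apply: ler_sum => m _; rewrite (fweight_raise m fx e1 e2).
apply: le_trans (_ : fweight h m * (1 + u * spin R (~~ m x)) <= _).
  by rewrite /spin; case: (m x) => /=; rewrite le_eqVlt; apply/orP; left; apply/eqP; ring.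
by rewrite ler_pM2l ?fweight_gt0 // expR_ge1Dx.
Qed.

Definition flip_conf (z : config d) : config d := fun x => ~~ z x.

Lemma plus_exp_frozen n N (f : config d -> R) : (0 < n)%N -> (n.+2 <= N.+1)%N ->
  let lo := shift n N.+1 in let hi := (shift n N.+1 + n).-1 in
  plus_exp beta n f =
  (\sum_(m : conf N | frozen lo hi m) f (extend (negc m)) * frozen_weight s lo hi m) /
  \sum_(m : conf N | frozen lo hi m) frozen_weight s lo hi m.
Proof.
move=> n0 nN lo hi; rewrite /plus_exp /gibbs_exp.
pose K := expR (beta * #|[set x : boxpt d n | on_face x]|%:R).
have w (m : {ffun boxpt d n -> bool}) :
    expR (- hamiltonian beta (fun=> beta) (negc m)) = K * frozen_weight s lo hi (lift_conf n0 nN m).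
  rewrite hamiltonian_cut /frozen_weight card_cut_lift card_rim_lift -tE /K /t -expRM_natl -expRD.
  congr expR; rewrite -mulr_sumr natrD.
  have -> : \sum_(x : boxpt d n | on_face x) spin R (~~ m x) =
      #|[set x : boxpt d n | on_face x]|%:R - 2 * #|[set x : boxpt d n | on_face x & m x]|%:R.
    rewrite -!sum1_card !natr_sum mulr_sumr.
    rewrite [LHS]big_mkcond [X in _ = X - _]big_mkcond [X in _ = _ - X]big_mkcond -sumrB.
    by apply: eq_bigr => x _; rewrite !inE; case: (on_face x); case: (m x); rewrite /spin /=; ring.
  by ring.
have S (G : conf N -> R) : \sum_(m : conf N | frozen lo hi m) G m =
    \sum_(m : {ffun boxpt d n -> bool}) G (lift_conf n0 nN m).
  rewrite (reindex_onto (lift_conf n0 nN) (restr_conf n0 nN)) => [|m fm]; last exact: restr_confK.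
  by apply: eq_bigl => m; rewrite frozen_lift lift_confK eqxx.
rewrite !S [X in X / _ = _](reindex_inj (inv_inj (@negcK d n))) /=.
rewrite [X in _ / X = _](reindex_inj (inv_inj (@negcK d n))) /=.
have K0 : K != 0 by rewrite gt_eqF // expR_gt0.
rewrite (eq_bigr _ (fun m _ => w m)) -mulr_sumr.
rewrite (eq_bigr (fun m => K * (f (extend (negc (lift_conf n0 nN m))) * frozen_weight s lo hi (lift_conf n0 nN m)))).
  by rewrite -mulr_sumr invfM mulrACA divff // mul1r.
move=> m _; rewrite w mulrCA; congr (_ * (f _ * _)).
by apply: functional_extensionality_dep => z; rewrite extend_lift.
Qed.

Lemma local_bounded (f : config d -> R) : local_fun f -> exists M, forall z, `|f z| <= M.
Proof.
move=> [S hS].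
pose ext (u : {ffun seq_sub S -> bool}) : config d := fun x => if insub x is Some y then u y else true.
exists (\sum_(u : {ffun seq_sub S -> bool}) `|f (ext u)|) => z.
pose u := [ffun y : seq_sub S => z (val y)].
rewrite (hS z (ext u)); first by rewrite (bigD1 u) //= lerDl sumr_ge0.
by move=> x xS; rewrite /ext insubT ffunE.
Qed.

Lemma card_sites n (S : seq (site d)) : (#|[set x : boxpt d n | site_of x \in S]| <= size S)%N.
Proof.
rewrite cardE -(size_map (@site_of d n)); apply: uniq_leq_size.
  by rewrite map_inj_uniq ?enum_uniq //; apply: site_of_inj.
by move=> z /mapP[x]; rewrite mem_enum inE => xS ->.
Qed.

Lemma Eplus_close n N (h : box N -> R) (f : config d -> R) (S : seq (site d)) M L r :
  (forall z z', (forall x, x \in S -> z x = z' x) -> f z = f z') -> (forall z, `|f z| <= M) ->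
  (forall x k, x \in S -> (`|x k|%N <= L)%N) -> bounded_field h -> (0 < r)%N ->
  (4 * (L + 5 * r) + 8 <= n)%N -> (n < N)%N ->
  `|Eplus h f - plus_exp beta n f| <= 2 * M * ((size S)%:R * (2 * 2^-1 ^+ r)).
Proof.
move=> fS fM SL hb r0 nl nN.
have [n0 lN le [lo0 hiN] [loa ab bhi win]] := window_arith r0 nl nN.
set l := (L + 5 * r)%N in lN le loa ab bhi win *.
set o := (_.-1) in le loa ab bhi win *.
rewrite (plus_exp_frozen f n0 nN) /Eplus /Zplus.
rewrite !(eq_bigr _ (fun m _ => fweight_free h m)).
rewrite (eq_bigr (fun m => f (extend (negc m)) * free_weight (s ^+ (2 * d)) (face_weight h) m)); last first.
  by move=> m _; rewrite fweight_free.
have fw0 m : 0 < face_weight h m by apply: expR_gt0.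
have s8 : (entropy d)%:R * s <= 8^-1 by move: s_small; lra.
have hent : (entropy d)%:R * (4 * s) <= 2^-1 by move: s8; lra.
have M0 : 0 <= M by apply: le_trans (normr_ge0 _) (fM (fun=> true)).
pose SS := [set x : box N | site_of x \in S].
have vol : (2 * ((o + l) - (o - l)).+1 ^ d <= N.+1 ^ d)%N.
  apply: leq_trans (_ : ((4 * l + 2) ^ d <= _)%N); last by rewrite leq_exp2r.
  rewrite le; have -> : (4 * l + 2 = 2 * (2 * l + 1))%N by rewrite mulnDr mulnA.
  by rewrite expnMn leq_mul2r -[X in (X <= _)%N]expn1 leq_pexp2l ?orbT.
have := free_frozen_close (fun i => corner0 N i) d2 s_gt0 s_le1 c_ge1 fw0 (face_weight_le hb)
  (lexx s) tc_le s_le1 (lo := shift n N.+1) (hi := (shift n N.+1 + n).-1) (a := (o - l)%N) (b := (o + l)%N)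
  (r := r) (S := SS) (g := fun m => f (extend (negc m))) (M := M).
move=> H; apply: le_trans (H lo0 hiN loa ab bhi vol r0 _ _ _ hent) _ => {H}.
- by move=> x k; rewrite inE => xS; have := SL _ k xS; rewrite ffunE => /win.
- move=> m m' e; apply: fS => z zS; rewrite /extend.
  case: pickP => // x /eqP xz; rewrite !ffunE e //.
  by rewrite inE xz.
- by move=> m; apply: fM.
have e0 : 0 <= (entropy d)%:R * (4 * s) by rewrite !mulr_ge0 // ltW.
rewrite ler_wpM2l ?mulr_ge0 //; apply: ler_pM => //.
- by rewrite mulr_ge0 // exprn_ge0.
- by rewrite ler_nat card_sites.
- by rewrite ler_wpM2l // lerXn2r // nnegrE ?invr_ge0.
Qed.

Lemma cutset_negc n (m : conf n) : cutset (negc m) = cutset m.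
Proof. by rewrite -[RHS]cut_negb; apply: eq_cut => x; rewrite ffunE. Qed.

Lemma fweight_neg n (h : box n -> R) m : fweight h (negc m) = fweight (fun x => - h x) m.
Proof.
rewrite /fweight (hamiltonian_cut beta h (negc m)) (hamiltonian_cut beta (fun x => - h x) m).
rewrite cutset_negc; congr (expR (_ + _)).
by apply: eq_bigr => x _; rewrite !ffunE; case: (m x); rewrite /spin /=; ring.
Qed.

Lemma plus_phase_neg n (m : conf n) : plus_phase (corner n) (negc m) = ~~ plus_phase (corner n) m.
Proof.
have cE := cutset_negc m.
have cc : cutset (chis (inside (corner n)) (cutset m)) = cutset m.
  by apply: cut_chis (cut_even m) => A; apply: cut_interior.
case: (eqVneq (m (corner n)) (chis (inside (corner n)) (cutset m) (corner n))) => e.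
  have -> : plus_phase (corner n) m by apply/plus_phaseP; apply: cut_inj e; rewrite cc.
  apply/negP => /plus_phaseP/(_ (corner n)); rewrite cE -e ffunE.
  by case: (m _).
have -> : plus_phase (corner n) (negc m).
  apply/plus_phaseP; apply: (cut_inj (x0 := corner n)); rewrite cE ?cc //.
  by rewrite ffunE; move: e; case: (m _); case: (chis _ _ _).
by symmetry; apply/negP => /plus_phaseP/(_ (corner n)) /eqP; apply/negP.
Qed.

Lemma sum_phases n (h : box n -> R) (F : conf n -> R) :
  \sum_(s : conf n) F s * expR (- hamiltonian beta h s) =
  \sum_(m : conf n | plus_phase (corner n) m) F (negc m) * fweight h m +
  \sum_(m : conf n | plus_phase (corner n) m) F m * fweight (fun x => - h x) m.
Proof.
rewrite (reindex_inj (inv_inj (@negcK d n.+1))) /= (bigID (plus_phase (corner n))) /=; congr (_ + _).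
rewrite (reindex_inj (inv_inj (@negcK d n.+1))) /=.
apply: eq_big => m; first by rewrite plus_phase_neg negbK.
by move=> _; rewrite -fweight_neg /fweight !negcK.
Qed.

Lemma gibbs_near_plus n (h : box n -> R) (f : config d -> R) M : (forall z, `|f z| <= M) ->
  `|gibbs_exp beta h f - Eplus h f| <= 2 * M * (Zplus (fun x => - h x) / Zplus h).
Proof.
move=> fM; have Z1 := Zplus_gt0 h; have Z2 := Zplus_gt0 (fun x => - h x).
have M0 : 0 <= M by apply: le_trans (normr_ge0 _) (fM (fun=> true)).
rewrite /gibbs_exp (sum_phases h (fun s => f (extend s))).
have -> : \sum_(s : conf n) expR (- hamiltonian beta h s) = Zplus h + Zplus (fun x => - h x).
  under eq_bigr do rewrite -[expR _]mul1r.
  rewrite (sum_phases h (fun=> 1)).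
  by congr (_ + _); apply: eq_bigr => m _; rewrite mul1r.
have B (F : conf n -> R) (h' : box n -> R) : (forall m, `|F m| <= M) ->
   `|\sum_(m : conf n | plus_phase (corner n) m) F m * fweight h' m| <= M * Zplus h'.
  move=> FM; apply: le_trans (ler_norm_sum _ _ _) _; rewrite mulr_sumr; apply: ler_sum => m _.
  by rewrite normrM [X in _ * X <= _]gtr0_norm ?fweight_gt0 // ler_pM2r ?fweight_gt0.
have b1 := B (fun m => f (extend (negc m))) h (fun m => fM _).
have b2 := B (fun m => f (extend m)) (fun x => - h x) (fun m => fM _).
exact: mixture_bound Z1 Z2 b1 b2.
Qed.

Lemma gibbs_flip n (h : box n -> R) (f : config d -> R) (S : seq (site d)) :
  (forall z z', (forall x, x \in S -> z x = z' x) -> f z = f z') ->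
  (forall x k, x \in S -> (2 * `|x k| < n.+1)%N) ->
  gibbs_exp beta h (fun z => f (flip_conf z)) = gibbs_exp beta (fun x => - h x) f.
Proof.
move=> fS Sn; rewrite /gibbs_exp.
have e u : expR (- hamiltonian beta h (negc u)) = expR (- hamiltonian beta (fun x => - h x) u).
  by have := fweight_neg h (negc u); rewrite /fweight !negcK => <-.
rewrite [X in X / _](reindex_inj (inv_inj (@negcK d n.+1))) /=.
rewrite [X in _ / X](reindex_inj (inv_inj (@negcK d n.+1))) /=.
congr (_ / _); apply: eq_bigr => s' _; rewrite e //; congr (_ * _).
apply: fS => z zS; rewrite /flip_conf.
have [x <-] := site_onto (fun k => Sn z k zS).
by rewrite !extend_site ffunE negbK.
Qed.

End GibbsPhases.

From mathcomp Require Import all_classical all_reals all_analysis measurable_realfun.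
Import numFieldNormedType.Exports.
Local Open Scope classical_set_scope.
Local Open Scope ring_scope.

(** * Sign flips of a symmetric field *)

Section SignSymmetry.
Variables (R : realType) (d : nat).
Implicit Types (S : seq (site d)) (Phi : (site d -> R) -> Prop) (h : site d -> R).

Definition cylinder S Phi : Prop :=
  (forall h h', (forall z, z \in S -> h z = h' z) -> Phi h -> Phi h') /\
  (forall d0 (T : measurableType d0) (X : site d -> T -> R),
     (forall z, measurable_fun setT (X z)) -> measurable [set w | Phi (X^~ w)]).

Definition flip_signs (A : pred (site d)) h : site d -> R := fun z => if A z then - h z else h z.

Lemma cylinder_sub S S' Phi : {subset S <= S'} -> cylinder S Phi -> cylinder S' Phi.
Proof. by move=> SS' [c m]; split => // h h' e; apply: c => z /SS'; apply: e. Qed.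

Lemma cylinderI S Phi Psi : cylinder S Phi -> cylinder S Psi ->
  cylinder S (fun h => Phi h /\ Psi h).
Proof.
move=> [c m] [c' m']; split => [h h' e [a b]|d0 T X mX]; first by split; [apply: c a|apply: c' b].
exact: measurableI (m _ _ _ mX) (m' _ _ _ mX).
Qed.

Lemma cylinderN S Phi : cylinder S Phi -> cylinder S (fun h => ~ Phi h).
Proof.
move=> [c m]; split => [h h' e n p|d0 T X mX].
  by apply/n/(c h') => // z zS; rewrite e.
exact: measurableC (m _ _ _ mX).
Qed.

Lemma cylinder_flip S Phi A : cylinder S Phi -> cylinder S (fun h => Phi (flip_signs A h)).
Proof.
move=> [c m]; split => [h h' e|d0 T X mX].
  by apply: c => z zS; rewrite /flip_signs e.
apply: (m _ _ (fun z w => if A z then - X z w else X z w)) => z.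
by case: (A z) => //; apply: measurableT_comp.
Qed.

Section Law.
Context d0 (T : measurableType d0) (P : probability T R).

Lemma same_law_tuple k (X Y : T -> k.-tuple R) :
  measurable_fun setT X -> measurable_fun setT Y ->
  (forall B : 'I_k -> set R, (forall i, measurable (B i)) ->
     P [set w | forall i, B i (tnth (X w) i)] = P [set w | forall i, B i (tnth (Y w) i)]) ->
  forall D, measurable D -> P (X @^-1` D) = P (Y @^-1` D).
Proof.
move=> mX mY eB.
pose G : set (set (k.-tuple R)) := [set D | exists2 B : 'I_k -> set R,
   (forall i, measurable (B i)) & D = [set t | forall i, B i (tnth t i)]].
have rect (B : 'I_k -> set R) : (forall i, measurable (B i)) ->
    measurable [set t : k.-tuple R | forall i, B i (tnth t i)].
  move=> mB; rewrite (_ : [set t | _] = \bigcap_(i in [set: 'I_k]) (fun t => tnth t i) @^-1` B i).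
    apply: fin_bigcap_measurable => // i _.
    by rewrite -[X in measurable X]setTI; apply: measurable_tnth.
  by apply/seteqP; split => t h i; [move=> _|]; apply: h.
have GT : G setT.
  by exists (fun=> setT) => [i|]; [exact: measurableT|apply/seteqP; split].
have mG : measurable = <<s G >>.
  apply/seteqP; split.
    apply: smallest_sub; first exact: smallest_sigma_algebra.
    elim/big_ind: _ => [//|A B hA hB|i _]; first by rewrite subUset.
    move=> _ [B mB <-]; apply: sub_sigma_algebra.
    exists (fun j => if j == i then B else setT) => [j|]; first by case: ifP.
    rewrite setTI; apply/seteqP; split => t /= h; last by have := h i; rewrite eqxx.
    by move=> j; case: eqP => [->|].
  apply: smallest_sub; first exact: sigma_algebra_measurable.
  by move=> _ [B mB ->]; apply: rect.
pose mXf : {mfun T >-> k.-tuple R} := HB.pack X (isMeasurableFun.Build _ _ _ _ X mX).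
pose mYf : {mfun T >-> k.-tuple R} := HB.pack Y (isMeasurableFun.Build _ _ _ _ Y mY).
move=> D mD.
apply: (measure_unique G (fun=> setT) mG _ _ _ (pushforward P mXf) (pushforward P mYf)) => //.
- move=> _ _ [B mB ->] [B' mB' ->]; exists (fun i => B i `&` B' i) => [i|]; first exact: measurableI.
  by apply/seteqP; split => t /= => [[a b] i|h]; [split|split=> i; case: (h i)].
- by rewrite bigcup_const //; exists 0%N.
- by move=> _ [B mB ->]; apply: eB.
- by move=> _; rewrite /= /pushforward preimage_setT probability_setT ltry.
Qed.

Variable lam : site d -> {RV P >-> R}.
Hypothesis iid : iid_field lam.
Hypothesis sym : forall B : set R, measurable B ->
  P (lam (origin d) @^-1` B) = P ((fun w => - lam (origin d) w) @^-1` B).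

Lemma site_symmetric x (B : set R) : measurable B ->
  P ((fun w => - lam x w) @^-1` B) = P (lam x @^-1` B).
Proof.
move=> mB; have mN : measurable (-%R @^-1` B : set R).
  by rewrite -[X in measurable X]setTI; apply: oppr_measurable.
have e y : P ((fun w => - lam y w) @^-1` B) = P (lam y @^-1` (-%R @^-1` B)) by [].
by rewrite e (iid.1 x _ mN) -e -sym // -(iid.1 x).
Qed.

Lemma flip_invariance S Phi (A : pred (site d)) : cylinder S Phi ->
  P [set w | Phi (lam^~ w)] = P [set w | Phi (flip_signs A (lam^~ w))].
Proof.
move=> cyl; have us := undup_uniq S; pose s := undup S.
have {}cyl : cylinder s Phi by apply: cylinder_sub cyl => z; rewrite mem_undup.
have [c m] := cyl.
pose X (b : bool) (w : T) : (size s).-tuple R :=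
  map_tuple (fun z => if b then flip_signs A (lam^~ w) z else lam z w) (in_tuple s).
have mX b : measurable_fun setT (X b).
  apply/measurable_fun_tnthP => i.
  rewrite (_ : _ \o _ = fun w => if b then flip_signs A (lam^~ w) (tnth (in_tuple s) i)
      else lam (tnth (in_tuple s) i) w); last first.
    by apply/funext => w /=; rewrite tnth_map.
  rewrite /flip_signs; case: b; last exact: measurable_funPT.
  by case: (A _); [apply: measurableT_comp => //|]; exact: measurable_funPT.
pose hh (t : (size s).-tuple R) : site d -> R := fun z => nth 0 t (index z s).
have hX b w : Phi (hh (X b w)) <-> Phi (if b then flip_signs A (lam^~ w) else lam^~ w).
  have e z : z \in s -> hh (X b w) z = (if b then flip_signs A (lam^~ w) else lam^~ w) z.
    move=> zs; rewrite /hh /X /= (nth_map (origin d)) ?index_mem // nth_index //.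
    by case: b.
  by split; apply: c => z zs; rewrite e.
have mD : measurable [set t : (size s).-tuple R | Phi (hh t)].
  apply: m => z; rewrite /hh.
  have [zs|zs] := boolP (z \in s).
    have lt : (index z s < size s)%N by rewrite index_mem.
    rewrite (_ : (fun t => _) = fun t : (size s).-tuple R => tnth t (Ordinal lt)).
      exact: measurable_tnth.
    by apply/funext => t; rewrite (tnth_nth 0).
  rewrite (_ : (fun t => _) = cst 0); first exact: measurable_cst.
  by apply/funext => t; rewrite nth_default // size_tuple memNindex.
have := @same_law_tuple _ _ _ (mX false) (mX true) _ _ mD.
have pre b : X b @^-1` [set t | Phi (hh t)] = [set w | Phi (if b then flip_signs A (lam^~ w) else lam^~ w)].
  by apply/seteqP; split => w /hX.
rewrite !pre; apply => B mB.
pose B' (z : site d) : set R := if insub (index z s) is Some i then B i else setT.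
have mB' z : measurable (B' z) by rewrite /B'; case: insub => //; exact: measurableT.
have B'E i : B' (tnth (in_tuple s) i) = B i.
  by rewrite /B' (tnth_nth (origin d)) /= index_uniq // (valK i).
have one (b : bool) (C : site d -> set R) : (forall z w, z \in s ->
      C z (lam z w) <-> B' z (if b then flip_signs A (lam^~ w) z else lam z w)) ->
   [set w | forall i, B i (tnth (X b w) i)] = \bigcap_(z in [set` s]) (lam z @^-1` C z).
  move=> hC; apply/seteqP; split => w /= h.
    move=> z /= zs; apply/hC => //; have lt : (index z s < size s)%N by rewrite index_mem.
    have := h (Ordinal lt); rewrite tnth_map -B'E (tnth_nth (origin d)) /= nth_index //.
  move=> i; rewrite tnth_map -B'E; apply/hC; first exact: mem_tnth.
  exact/h/mem_tnth.
rewrite (one false B') // (one true (fun z => if A z then -%R @^-1` B' z else B' z)); last first.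
  by move=> z w _; rewrite /flip_signs; case: (A z).
rewrite !iid.2 //; last first.
  by move=> z; case: (A z) => //; rewrite -[X in measurable X]setTI; apply: oppr_measurable.
apply: eq_bigr => z _; case: (A z) => //.
exact: esym (site_symmetric z (mB' z)).
Qed.

End Law.
End SignSymmetry.

Lemma quotient_step (R : realFieldType) (u p m p' m' : R) :
  0 <= u -> 0 < p -> 0 < m -> 0 < m' -> (1 + u / 2) * p <= p' -> (1 + u / 2) * m' <= m ->
  (1 + u) * (p / m) <= p' / m'.
Proof.
move=> u0 p0 m0 m'0 h1 h2; rewrite ler_pdivlMr // mulrA mulrAC ler_pdivrMr //.
have uu : 1 + u <= (1 + u / 2) * (1 + u / 2) by nra.
have e : (1 + u / 2) * p * ((1 + u / 2) * m') = (1 + u / 2) * (1 + u / 2) * (p * m') by ring.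
apply: le_trans (_ : (1 + u / 2) * p * ((1 + u / 2) * m') <= _).
  by rewrite e -[X in X <= _]mulrA ler_pM2r // mulr_gt0.
by apply: ler_pM => //; rewrite mulr_ge0 ?addr_ge0 ?divr_ge0 // ltW.
Qed.

Section BoundaryRatio.
Variables (R : realType) (d : nat) (beta lamstar : R).
Hypotheses (d2 : (2 <= d)%N) (lam0 : 0 < lamstar).
Hypotheses (beta1 : 8 * d%:R * lamstar <= beta) (beta2 : 8 * d%:R * (entropy d)%:R <= beta).
Implicit Types (h : site d -> R) (n : nat).
Local Notation box n := (boxpt d n.+1).

Definition clip (v : R) : R := if `|v| <= lamstar then v else 0.
Definition box_field n h : box n -> R := fun x => clip (h (site_of x)).
Definition opp_field n (f : box n -> R) : box n -> R := fun x => - f x.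
Definition phase_ratio n h : R :=
  Zplus beta (@box_field n h) / Zplus beta (opp_field (@box_field n h)).

Lemma clipN v : clip (- v) = - clip v.
Proof. by rewrite /clip normrN; case: ifP => _; rewrite ?oppr0. Qed.

Lemma clip_bound v : `|clip v| <= lamstar.
Proof. by rewrite /clip; case: ifP => // _; rewrite normr0 ltW. Qed.

Lemma clip_id v : `|v| <= lamstar -> clip v = v.
Proof. by rewrite /clip => ->. Qed.

Lemma measurable_clip : measurable_fun setT clip.
Proof. by apply: measurable_fun_ifT => //; apply: measurable_fun_ler. Qed.

Lemma box_field_bounded n h : bounded_field lamstar (@box_field n h).
Proof. by move=> x; apply: clip_bound. Qed.

Lemma opp_field_bounded n (f : box n -> R) : bounded_field lamstar f -> bounded_field lamstar (opp_field f).
Proof. by move=> fb x; rewrite /opp_field normrN. Qed.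

Lemma Zp0 n (f : box n -> R) : 0 < Zplus beta f.
Proof. exact: Zplus_gt0. Qed.

Lemma ratio_gt0 n h : 0 < phase_ratio n h.
Proof. by rewrite divr_gt0 ?Zp0. Qed.

Lemma eq_Zplus n (f g : box n -> R) : (forall x, on_face x -> f x = g x) ->
  Zplus beta f = Zplus beta g.
Proof.
move=> e; apply: eq_bigr => m _; rewrite /fweight !hamiltonian_cut; congr (expR (_ + _)).
by apply: eq_bigr => x fx; rewrite e.
Qed.

Definition face_sites n : seq (site d) := [seq site_of x | x <- enum [pred x : box n | on_face x]].

Lemma mem_face_sites n (x : box n) : (site_of x \in face_sites n) = on_face x.
Proof. by rewrite mem_map ?mem_enum //; apply: site_of_inj. Qed.

Lemma eq_ratio n h h' : (forall z, z \in face_sites n -> h z = h' z) -> phase_ratio n h = phase_ratio n h'.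
Proof.
move=> e; have e' (x : box n) : on_face x -> box_field h x = box_field h' x.
  by rewrite -mem_face_sites /box_field => /e ->.
by congr (_ / _); apply: eq_Zplus => x fx; rewrite /opp_field e'.
Qed.

Lemma ratio_flip n h (A : pred (site d)) : (forall z, z \in face_sites n -> A z) ->
  phase_ratio n (flip_signs A h) = (phase_ratio n h)^-1.
Proof.
move=> e; rewrite /phase_ratio invf_div; have e' (x : box n) : on_face x ->
    box_field (flip_signs A h) x = - box_field h x.
  by rewrite -mem_face_sites /box_field /flip_signs => /e ->; rewrite clipN.
by congr (_ / _); apply: eq_Zplus => x fx; rewrite /opp_field e' // opprK.
Qed.

Lemma ratio_raise n h h' (x : box n) (u : R) : on_face x -> 0 <= u ->
  clip (h' (site_of x)) = clip (h (site_of x)) + u ->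
  (forall z, z != site_of x -> h' z = h z) -> (1 + u) * phase_ratio n h <= phase_ratio n h'.
Proof.
move=> fx u0 e1 e2.
have ne (y : box n) : y != x -> box_field h' y = box_field h y.
  move=> yx; rewrite /box_field e2 //; apply: contra yx => /eqP e; apply/eqP; exact: site_of_inj e.
have r1 : (1 + u / 2) * Zplus beta (@box_field n h) <= Zplus beta (@box_field n h').
  exact: (Zplus_raise d2 lam0 beta1 beta2 (@box_field_bounded n h) fx u0 e1 ne).
have r2 : (1 + u / 2) * Zplus beta (opp_field (@box_field n h')) <= Zplus beta (opp_field (@box_field n h)).
  apply: (Zplus_raise d2 lam0 beta1 beta2 (opp_field_bounded (@box_field_bounded n h')) fx u0).
    by rewrite /opp_field /box_field e1; ring.
  by move=> y yx; rewrite /opp_field (ne y yx).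
exact: quotient_step u0 (Zp0 _) (Zp0 _) (Zp0 _) r1 r2.
Qed.

Definition ratio_lt n (a : R) h : bool := phase_ratio n h < a.

Lemma ratio_cylinder n (a : R) : cylinder (face_sites n) (fun h => ratio_lt n a h).
Proof.
split=> [h h' e|d0 T X mX]; first by rewrite /ratio_lt (eq_ratio e).
have mclip := measurable_clip.
have mf (x : box n) : measurable_fun setT (fun w => box_field (X^~ w) x).
  by apply: (measurableT_comp mclip).
have mZ (f : T -> box n -> R) : (forall x, measurable_fun setT (fun w => f w x)) ->
    measurable_fun setT (fun w => Zplus beta (f w)).
  move=> mf'; rewrite /Zplus; under eq_fun do rewrite -big_filter.
  apply: measurable_sum => m.
  rewrite /fweight; apply: (measurableT_comp (@measurable_expR R)).
  under eq_fun do rewrite hamiltonian_cut.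
  apply: measurable_funD => //; under eq_fun do rewrite -big_filter.
  apply: measurable_sum => x.
  by apply: measurable_funM.
rewrite (_ : [set w | _] = [set w | Zplus beta (@box_field n (X^~ w)) < a * Zplus beta (opp_field (@box_field n (X^~ w)))]); last first.
  by apply/seteqP; split => w /=; rewrite /ratio_lt /phase_ratio ltr_pdivrMr ?Zp0.
rewrite -[X in measurable X]setTI.
have /(_ measurableT [set true]) : measurable_fun setT
   (fun w => Zplus beta (@box_field n (X^~ w)) < a * Zplus beta (opp_field (@box_field n (X^~ w)))).
  apply: measurable_fun_ltr; first exact: mZ.
  apply: measurable_funM => //; apply: mZ => x.
  by apply: measurableT_comp.
by apply.
Qed.

End BoundaryRatio.

Section FiniteFamilies.
Context d0 (T : measurableType d0) (R : realType) (P : probability T R).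

Definition Pr (A : set T) : R := fine (P A).

Lemma PrE A : measurable A -> P A = (Pr A)%:E.
Proof. by move=> mA; rewrite /Pr fineK // fin_num_measure. Qed.

Lemma Pr_ge0 A : 0 <= Pr A.
Proof. by rewrite /Pr fine_ge0. Qed.

Lemma PrT : Pr setT = 1.
Proof. by rewrite /Pr probability_setT. Qed.

Lemma Pr_sub A B : measurable A -> measurable B -> A `<=` B -> Pr A <= Pr B.
Proof. by move=> mA mB AB; rewrite -lee_fin -!PrE // le_measure ?inE. Qed.

Lemma sum_Pr_le (I J : finType) (pI : pred I) (pJ : pred J) (E : I -> set T) (F : J -> set T) (c : J -> R) :
  (forall i, measurable (E i)) -> (forall j, measurable (F j)) -> (forall j, pJ j -> 0 <= c j) ->
  (forall w, \sum_(i | pI i) \1_(E i) w <= \sum_(j | pJ j) c j * \1_(F j) w) ->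
  \sum_(i | pI i) Pr (E i) <= \sum_(j | pJ j) c j * Pr (F j).
Proof.
move=> mE mF c0 le.
have m1 (A : set T) : measurable A -> measurable_fun setT (fun w => (\1_A w : R)%:E).
  by move=> mA; apply/measurable_EFinP; apply: measurable_indic.
have n0 (A : set T) w : (0 <= (\1_A w : R)%:E)%E by rewrite lee_fin.
have e1 : (\sum_(i | pI i) Pr (E i))%:E = (\int[P]_w (\sum_(i | pI i) \1_(E i) w)%:E)%E.
  under eq_integral do rewrite -sumEFin -big_filter.
  rewrite (ge0_integral_sum _ measurableT (fun i => m1 _ (mE i)) (fun i w _ => n0 _ w)).
  rewrite big_filter -sumEFin; apply: eq_bigr => i _.
  by rewrite integral_indic // setIT; apply: esym; apply: PrE.
have e2 : (\sum_(j | pJ j) c j * Pr (F j))%:E = (\int[P]_w (\sum_(j | pJ j) c j * \1_(F j) w)%:E)%E.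
  under eq_integral do rewrite -sumEFin.
  rewrite -sumEFin.
  pose c' j := if pJ j then c j else 0.
  have c'0 j : 0 <= c' j by rewrite /c'; case: ifP => // /c0.
  have n1 j w : (0 <= (c' j)%:E * (\1_(F j) w : R)%:E)%E by rewrite mule_ge0 // lee_fin.
  rewrite (eq_bigr (fun j => (c' j * Pr (F j))%:E)); last by move=> j h; rewrite /c' h.
  under eq_integral.
    move=> w _; rewrite (eq_bigr (fun j => (c' j)%:E * (\1_(F j) w)%:E)%E); last first.
      by move=> j h; rewrite /c' h EFinM.
    rewrite -big_filter; over.
  rewrite (ge0_integral_sum _ measurableT (fun j => measurable_funeM (c' j)%:E (m1 _ (mF j))) (fun j w _ => n1 j w)).
  rewrite big_filter; apply: eq_bigr => j _.
  rewrite (ge0_integralZl_EFin _ measurableT (fun w _ => n0 (F j) w) (m1 _ (mF j)) (c'0 j)).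
  by rewrite integral_indic // setIT EFinM; congr (_ * _)%E; apply: esym; apply: PrE.
have p1 w : (0 <= (\sum_(i | pI i) \1_(E i) w : R)%:E)%E by rewrite lee_fin sumr_ge0.
have p2 w : (0 <= (\sum_(j | pJ j) c j * \1_(F j) w : R)%:E)%E.
  by rewrite lee_fin sumr_ge0 // => j h; rewrite mulr_ge0 ?c0.
have q1 : measurable_fun setT (fun w => (\sum_(i | pI i) \1_(E i) w : R)%:E).
  apply/measurable_EFinP; under eq_fun do rewrite -big_filter.
  by apply: measurable_sum => i; apply: measurable_indic.
have q2 : measurable_fun setT (fun w => (\sum_(j | pJ j) c j * \1_(F j) w : R)%:E).
  apply/measurable_EFinP; under eq_fun do rewrite -big_filter.
  by apply: measurable_sum => j; apply: measurable_funM => //; apply: measurable_indic.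
by rewrite -lee_fin e1 e2; apply: ge0_le_integral => // w _; rewrite lee_fin.
Qed.

End FiniteFamilies.

(** * Anti-concentration of the ratio of the two phases *)

Section AntiConcentration.
Variables (R : realType) (d : nat) (beta lamstar : R).
Hypotheses (d2 : (2 <= d)%N) (lam0 : 0 < lamstar).
Hypotheses (beta1 : 8 * d%:R * lamstar <= beta) (beta2 : 8 * d%:R * (entropy d)%:R <= beta).
Variables (n : nat) (i0 : 'I_d).
Implicit Types (h : site d -> R) (A S P : {set boxpt d n.+1}).
Local Notation Q := (bottom_face n i0).
Local Notation clip := (clip lamstar).
Local Notation phase_ratio := (phase_ratio beta lamstar n).

Definition sites_of A : pred (site d) := fun z => z \in [seq site_of x | x <- enum A].

Lemma mem_sites_of A x : sites_of A (site_of x) = (x \in A).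
Proof. by rewrite /sites_of mem_map ?mem_enum //; apply: site_of_inj. Qed.

Definition nonneg_sites h : {set boxpt d n.+1} :=
  [set x : boxpt d n.+1 | (x \in Q) && (0 <= clip (h (site_of x)))]%SET.
Definition large_sites (de : R) h : {set boxpt d n.+1} :=
  [set x : boxpt d n.+1 | (x \in Q) && (de <= `|clip (h (site_of x))|)]%SET.

(* The field obtained from [h] by prescribing the set [P] of sites of the
   bottom face where it is nonnegative. *)
Definition resign h P := flip_signs (sites_of (symdiff P (nonneg_sites h))) h.

Lemma clip_resign h P x : x \in Q ->
  clip (resign h P (site_of x)) = if x \in P then `|clip (h (site_of x))| else - `|clip (h (site_of x))|.
Proof.
move=> xQ; rewrite /resign /flip_signs mem_sites_of in_symdiff inE xQ /=.
have [v0|v0] := lerP 0 (clip (h (site_of x))); case: (x \in P); rewrite ?clipN //=.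
- by rewrite ger0_norm.
- by rewrite ger0_norm.
- by rewrite ltr0_norm.
- by rewrite ltr0_norm // opprK.
Qed.

Lemma ratio_pos h : 0 < phase_ratio h.
Proof. exact: ratio_gt0. Qed.

Lemma ratio_resign1 h P x : x \in Q -> x \notin P ->
  (1 + 2 * `|clip (h (site_of x))|) * phase_ratio (resign h P) <= phase_ratio (resign h (x |: P)%SET).
Proof.
move=> xQ xP; apply: (ratio_raise d2 lam0 beta1 beta2 (x := x)).
- exact: bottom_on_face xQ.
- by rewrite mulr_ge0.
- by rewrite !clip_resign // (negPf xP) !inE eqxx /=; ring.
- move=> z zx; rewrite /resign /flip_signs; congr (if _ then _ else _).
  have [/mapP[y _ zE]|no] := boolP (z \in [seq site_of y | y <- enum (boxpt d n.+1)]).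
    have yx : y != x by apply: contra zx => /eqP <-; rewrite zE.
    by rewrite zE !mem_sites_of !in_symdiff !inE (negPf yx).
  have out A : sites_of A z = false.
    apply/negP => /mapP[y _ zE]; case/negP: no; apply/mapP; exists y => //.
    by rewrite mem_enum.
  by rewrite !out.
Qed.

Lemma ratio_resign_mono h P P' : P' \subset Q -> P \subset P' ->
  phase_ratio (resign h P) <= phase_ratio (resign h P').
Proof.
move=> P'Q; have [k] := ubnP #|P' :\: P|%SET; elim: k P => // k IH P.
rewrite ltnS => hk PP'; have [e|[x]] := set_0Vmem (P' :\: P)%SET.
  suff -> : P = P' by [].
  by apply/eqP; rewrite finset.eqEsubset PP' -finset.setD_eq0 e eqxx.
rewrite inE => /andP[xP xP'].
have step : phase_ratio (resign h P) <= phase_ratio (resign h (x |: P)%SET).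
  apply: le_trans (ratio_resign1 h (fintype.subsetP P'Q _ xP') xP).
  by rewrite ler_peMl ?(ltW (ratio_pos _)) // lerDl mulr_ge0.
apply: le_trans step (IH _ _ _).
  apply: leq_trans hk; apply: proper_card; apply/fintype.properP; split.
    by apply/fintype.subsetP => y; rewrite !inE negb_or => /andP[/andP[_ ->] ->].
  by exists x; rewrite !inE ?eqxx ?xP.
by rewrite finset.subUset finset.sub1set xP'.
Qed.

Definition in_window (a b : R) h : bool := (a <= phase_ratio h) && (phase_ratio h < b).

Lemma count_window h (a de al : R) : 0 < a -> 0 < de -> 0 < al ->
  #|[set A : {set boxpt d n.+1} | (A \subset Q) && in_window a (a * (1 + 2 * de)) (flip_signs (sites_of A) h)]%SET|%:R
   <= 2 ^+ #|Q| * ((al^-1 + al / #|large_sites de h|.+1%:R) / 2).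
Proof.
move=> a0 de0 al0; apply: (card_flips_real (pos := nonneg_sites h)) => //.
- by apply/fintype.subsetP => x; rewrite inE => /andP[].
- by apply/fintype.subsetP => x; rewrite inE => /andP[].
move=> P P' P'Q PP' sub; rewrite -!/(resign _ _) => /andP[w1 _] /andP[_ w2].
have [e|[x xD]] := set_0Vmem (P' :\: P)%SET.
  by apply/eqP; rewrite finset.eqEsubset PP' -finset.setD_eq0 e eqxx.
have := fintype.subsetP sub x xD; rewrite inE => /andP[xQ dv].
move: xD; rewrite inE => /andP[xP xP'].
have sP : (x |: P)%SET \subset P' by rewrite finset.subUset finset.sub1set xP'.
have := le_trans (ratio_resign1 h xQ xP) (ratio_resign_mono h P'Q sP).
move=> /le_lt_trans /(_ w2); rewrite ltNge => /negP nle; exfalso; apply: nle.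
have u0 : 0 <= 1 + 2 * de by rewrite addr_ge0 // mulr_ge0 // ltW.
rewrite mulrC; apply: (ler_pM u0 (ltW a0)) => //.
by rewrite lerD2l ler_pM2l.
Qed.

End AntiConcentration.

Section Concentration.
Variables (R : realType) (d : nat) (beta lamstar : R).
Hypotheses (d2 : (2 <= d)%N) (lam0 : 0 < lamstar).
Hypotheses (beta1 : 8 * d%:R * lamstar <= beta) (beta2 : 8 * d%:R * (entropy d)%:R <= beta).
Context d0 (T : measurableType d0) (P : probability T R).
Variable lam : site d -> {RV P >-> R}.
Hypothesis iid : iid_field lam.
Hypothesis sym : forall B : set R, measurable B ->
  P (lam (origin d) @^-1` B) = P ((fun w => - lam (origin d) w) @^-1` B).
Implicit Types n : nat.
Local Notation clip := (clip lamstar).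
Local Notation in_window := (in_window beta lamstar).

Lemma window_cylinder n (a b : R) : cylinder (face_sites d n) (fun h => in_window n a b h).
Proof.
have := cylinderI (cylinderN (ratio_cylinder beta lamstar d2 n a)) (ratio_cylinder beta lamstar d2 n b).
congr (cylinder _ _); apply/funext => h; apply/propext; rewrite /in_window /ratio_lt leNgt.
by split=> [[/negP -> ->]|/andP[/negP ? ?]].
Qed.

Variable de : R.
Let D : set R := [set v | de <= `|clip v|].
Let p := Pr P (lam (origin d) @^-1` D).

Let mD : measurable D.
Proof.
rewrite -[X in measurable X]setTI.
have /(_ measurableT [set true]) : measurable_fun setT (fun v : R => de <= `|clip v|).
  apply: measurable_fun_ler => //; apply: measurableT_comp => //; exact: measurable_clip.
by apply.
Qed.

Let mlam x (B : set R) : measurable B -> measurable (lam x @^-1` B).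
Proof. by move=> mB; rewrite -[X in measurable X]setTI; apply: measurable_funPT. Qed.

Let event n (i0 : 'I_d) (S : {set boxpt d n.+1}) : set T := [set w | large_sites lamstar n i0 de (lam^~ w) = S].

Let eventE n (i0 : 'I_d) (S : {set boxpt d n.+1}) : S \subset bottom_face n i0 ->
  event i0 S = \bigcap_(z in [set` [seq site_of x | x <- enum (bottom_face n i0)]])
    lam z @^-1` (if sites_of S z then D else ~` D).
Proof.
move=> SQ; apply/seteqP; split => w.
  move=> wS z /mapP[x]; rewrite mem_enum => xQ ->; rewrite mem_sites_of -wS inE xQ /= /D /=.
  by case: ifP => // /negbT/negP.
move=> h; apply/setP => x; rewrite inE; have [xQ|xQ] /= := boolP (x \in bottom_face n i0).
  have := h (site_of x); rewrite /= mem_sites_of map_f ?mem_enum // => /(_ isT).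
  by case: (x \in S) => // /negP/negPf.
by apply/esym/negbTE; apply: contra xQ => /(fintype.subsetP SQ).
Qed.

Let mevent n (i0 : 'I_d) (S : {set boxpt d n.+1}) : S \subset bottom_face n i0 -> measurable (event i0 S).
Proof.
move=> SQ; rewrite eventE //; apply: fin_bigcap_measurable => // z _; apply: mlam.
by case: ifP => _ //; apply: measurableC.
Qed.

Let Pr_event n (i0 : 'I_d) (S : {set boxpt d n.+1}) : S \subset bottom_face n i0 ->
  Pr P (event i0 S) = p ^+ #|S| * (1 - p) ^+ (#|bottom_face n i0| - #|S|).
Proof.
move=> SQ.
have mc z : measurable (if sites_of S z then D else ~` D) by case: ifP => _ //; apply: measurableC.
have us : uniq [seq site_of x | x <- enum (bottom_face n i0)].
  by rewrite map_inj_uniq ?enum_uniq //; apply: site_of_inj.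
have pc z : P (lam z @^-1` (if sites_of S z then D else ~` D)) = (if sites_of S z then p else 1 - p)%:E.
  rewrite iid.1 //; case: ifP => _; first by rewrite (PrE P (mlam _ mD)).
  by rewrite preimage_setC (probability_setC _ (mlam _ mD)) (PrE P (mlam _ mD)).
rewrite eventE // /Pr iid.2 // big_map (eq_bigr _ (fun x _ => pc (site_of x))) prodEFin /=.
rewrite big_enum /= (bigID (mem S)) /=; congr (_ * _).
  rewrite (eq_bigl (mem S)); last first.
    by move=> x; rewrite andb_idl // => /(fintype.subsetP SQ).
  by rewrite (eq_bigr (fun=> p)) ?prodr_const // => x xS; rewrite mem_sites_of ifT.
rewrite (eq_bigr (fun=> 1 - p)); last by move=> x /andP[_ xS]; rewrite mem_sites_of ifF //; apply: negbTE.
rewrite (eq_bigl (mem (bottom_face n i0 :\: S)%SET)); last first.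
  by move=> x; rewrite -[RHS]/(x \in (_ :\: S)%SET) finset.in_setD andbC.
by rewrite prodr_const cardsD (finset.setIidPr SQ).
Qed.

Lemma anti_concentration n (i0 : 'I_d) (a : R) : 0 < a -> 0 < de -> 0 < p ->
  Pr P [set w | in_window n a (a * (1 + 2 * de)) (lam^~ w)] <=
  (1 + p^-1) / 2 / Num.sqrt #|bottom_face n i0|.+1%:R.
Proof.
move=> a0 de0 p0; set Q := bottom_face n i0; set b := a * _.
pose al : R := Num.sqrt #|Q|.+1%:R.
have al0 : 0 < al by rewrite sqrtr_gt0 ltr0n.
pose c (S : {set boxpt d n.+1}) : R := 2 ^+ #|Q| * ((al^-1 + al / #|S|.+1%:R) / 2).
pose E (A : {set boxpt d n.+1}) : set T := [set w | in_window n a b (flip_signs (sites_of A) (lam^~ w))].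
have mE A : measurable (E A).
  apply: (cylinder_flip (sites_of A) (window_cylinder n a b)).2 => z; exact: measurable_funPT.
have PE A : Pr P (E A) = Pr P [set w | in_window n a b (lam^~ w)].
  by rewrite /Pr -(flip_invariance iid sym _ (window_cylinder n a b)).
pose F (S : {set boxpt d n.+1}) : set T := if S \subset Q then event i0 S else set0.
have mF S : measurable (F S) by rewrite /F; case: ifP => // SQ; apply: mevent.
have p1 : p <= 1.
  by rewrite -(PrT P); apply: Pr_sub => //; apply: mlam.
have large w : large_sites lamstar n i0 de (lam^~ w) \subset Q.
  by apply/fintype.subsetP => x; rewrite inE => /andP[].
have ind (g : {set boxpt d n.+1} -> R) w :
    \sum_(S in powerset Q) g S * \1_(F S) w = g (large_sites lamstar n i0 de (lam^~ w)).
  rewrite (bigD1 (large_sites lamstar n i0 de (lam^~ w))) ?powersetE ?large //=.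
  rewrite big1 ?addr0 => [|S /andP[]].
    by rewrite indicE /F large mem_set ?mulr1.
  rewrite powersetE => SQ ne; rewrite indicE /F SQ memNset ?mulr0 // => e.
  by rewrite -e eqxx in ne.
have le1 : \sum_(A in powerset Q) Pr P (E A) <= \sum_(S in powerset Q) c S * Pr P (F S).
  apply: sum_Pr_le => // [S _|w].
    rewrite mulr_ge0 ?exprn_ge0 // divr_ge0 // addr_ge0 ?invr_ge0 ?(ltW al0) //.
    by rewrite divr_ge0 // ltW.
  rewrite ind; apply: le_trans (count_window d2 lam0 beta1 beta2 n i0 (lam^~ w) a0 de0 al0).
  rewrite -sum1_card natr_sum big_mkcond [X in _ <= X]big_mkcond /=; apply: ler_sum => A _.
  rewrite powersetE inE indicE; case: (A \subset Q) => //=.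
  rewrite /E /b; case: ifP => wn; first by rewrite mem_set.
  by rewrite memNset // => /=; rewrite wn.
have le2 : \sum_(S in powerset Q) Pr P (F S) <= 1.
  have := @sum_Pr_le _ _ _ P _ unit (mem (powerset Q)) predT F (fun=> setT) (fun=> 1) mF
    (fun=> measurableT) (fun _ _ => ler01).
  rewrite !big_const card_unit /= PrT mulr1 addr0; apply => w.
  rewrite big_const card_unit /= indicT mulr1 addr0.
  rewrite -[X in _ <= X](ind (fun=> 1) w); apply: ler_sum => S _; by rewrite mul1r.
have le3 : \sum_(S in powerset Q) Pr P (F S) / #|S|.+1%:R <= (p * #|Q|.+1%:R)^-1.
  have q0 : 0 <= 1 - p by rewrite subr_ge0.
  have pq : p + (1 - p) = 1 by rewrite addrC subrK.
  rewrite (eq_bigr (fun S : {set boxpt d n.+1} => p ^+ #|S| * (1 - p) ^+ (#|Q| - #|S|) / #|S|.+1%:R)).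
    exact: binomial_inverse_moment.
  by move=> S; rewrite powersetE => SQ; rewrite /F SQ Pr_event.
have q2 : 0 < 2 ^+ #|Q| :> R by rewrite exprn_gt0.
have : 2 ^+ #|Q| * Pr P [set w | in_window n a b (lam^~ w)] <=
       2 ^+ #|Q| * ((al^-1 * 1 + al * (p * #|Q|.+1%:R)^-1) / 2).
  have -> : 2 ^+ #|Q| * Pr P [set w | in_window n a b (lam^~ w)] = \sum_(A in powerset Q) Pr P (E A).
    rewrite (eq_bigr _ (fun A _ => PE A)) sumr_const card_powerset -[X in _ = X]mulr_natl natrX.
    by [].
  apply: (le_trans le1).
  have -> : \sum_(S in powerset Q) c S * Pr P (F S) =
      2 ^+ #|Q| * ((al^-1 * \sum_(S in powerset Q) Pr P (F S) +
        al * \sum_(S in powerset Q) Pr P (F S) / #|S|.+1%:R) / 2).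
    rewrite !mulr_sumr -big_split /= mulr_suml mulr_sumr; apply: eq_bigr => S _; rewrite /c.
    have rg (t i x u f v : R) : t * ((i + x * u) * v) * f = t * ((i * f + x * (f * u)) * v) by ring.
    exact: rg.
  rewrite ler_pM2l // ler_pM2r // ?invr_gt0 //; apply: lerD.
    by rewrite ler_pM2l // invr_gt0.
  by rewrite ler_pM2l.
rewrite ler_pM2l // => /le_trans; apply; rewrite le_eqVlt; apply/orP; left; apply/eqP.
have als : #|Q|.+1%:R = al ^+ 2 by rewrite /al sqr_sqrtr.
have fd (x y : R) : 0 < x -> 0 < y -> (x^-1 * 1 + x * (y * x ^+ 2)^-1) / 2 = (1 + y^-1) / 2 / x.
  by move=> x0 y0; field; rewrite !gt_eqF.
by rewrite -/al als fd.
Qed.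

End Concentration.

(** * Almost sure behaviour of the ratio *)

Lemma powR_difference (R : realType) (eta : R) (k : nat) : 0 < eta ->
  eta * k.+2%:R `^ (- (1 + eta)) <= k.+1%:R `^ (- eta) - k.+2%:R `^ (- eta).
Proof.
move=> e0; have p (j : nat) : (0 : R) < j.+1%:R by rewrite ltr0n.
pose a : R := ln k.+1%:R; pose b : R := ln k.+2%:R.
have pE (j : nat) (x : R) : j.+1%:R `^ x = expR (x * ln j.+1%:R) by rewrite /powR gt_eqF.
have inv : k.+2%:R^-1 = expR (- b) by rewrite expRN lnK // posrE.
have ab : k.+2%:R^-1 <= b - a.
  have -> : b - a = - ln (1 + - k.+2%:R^-1).
    have -> : 1 + - k.+2%:R^-1 = k.+1%:R / k.+2%:R :> R.
      by rewrite -{1}(divff (lt0r_neq0 (p k.+1))) -mulN1r -mulrDl -[k.+2%:R]natr1 addrK.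
    by rewrite ln_div ?posrE // opprB.
  rewrite lerNr; apply: le_ln1Dx; rewrite ltrN2 invf_lt1 //.
  by rewrite ltr1n.
have -> : eta * k.+2%:R `^ (- (1 + eta)) = eta * k.+2%:R^-1 * expR (- eta * b).
  by rewrite pE inv -/b mulNr mulrDl mul1r opprD expRD mulrA mulNr.
have -> : k.+1%:R `^ (- eta) = expR (- eta * b) * expR (eta * (b - a)).
  by rewrite pE -expRD -/a; congr expR; ring.
rewrite pE -/b -[X in _ - X]mulr1 -mulrBr mulrC ler_pM2l ?expR_gt0 //.
rewrite lerBrDl; apply: le_trans (expR_ge1Dx _); rewrite lerD2l.
by rewrite ler_pM2l.
Qed.

Lemma powR_partial_sum (R : realType) (eta : R) (n : nat) : 0 < eta ->
  \sum_(k < n) k.+1%:R `^ (- (1 + eta)) <= 1 + eta^-1.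
Proof.
move=> e0; apply: (@le_trans _ _ (\sum_(k < n.+1) k.+1%:R `^ (- (1 + eta)))).
  by rewrite [X in _ <= X]big_ord_recr /= lerDl powR_ge0.
apply: (@le_trans _ _ (1 + eta^-1 * (1 - n.+1%:R `^ (- eta)))); last first.
  by rewrite lerD2l ler_piMr ?invr_ge0 ?(ltW e0) // gerBl powR_ge0.
elim: n => [|n IH]; first by rewrite big_ord_recr big_ord0 /= add0r !powR1 subrr mulr0 addr0.
rewrite big_ord_recr /=.
have step : n.+2%:R `^ (- (1 + eta)) <= eta^-1 * (n.+1%:R `^ (- eta) - n.+2%:R `^ (- eta)).
  by rewrite mulrC ler_pdivlMr // mulrC; apply: powR_difference.
by apply: le_trans (lerD IH step) _; rewrite -addrA -mulrDr addrA addrNK.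
Qed.

Lemma bernoulli_exp (R : realDomainType) (u : R) (k : nat) : 0 <= u -> 1 + k%:R * u <= (1 + u) ^+ k.
Proof.
move=> u0; elim: k => [|k IH]; first by rewrite mul0r addr0.
have k0 : 0 <= k%:R :> R by [].
rewrite exprS -natr1; apply: le_trans (ler_wpM2l _ IH); last by rewrite addr_ge0.
by move: (k%:R : R) k0 => v v0; nra.
Qed.

Section Borel.
Context d0 (T : measurableType d0) (R : realType) (P : probability T R).

Lemma PrU A B : measurable A -> measurable B -> Pr P (A `|` B) <= Pr P A + Pr P B.
Proof.
move=> mA mB; rewrite -lee_fin EFinD -!PrE //; first exact: measureU2.
exact: measurableU.
Qed.

Lemma borel_cantelli (A : nat -> set T) (C eta : R) : (forall k, measurable (A k)) -> 0 < eta -> 0 <= C ->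
  (forall k, Pr P (A k) <= C * k.+1%:R `^ (- (1 + eta))) ->
  {ae P, forall w, exists K, forall k, (K <= k)%N -> ~ A k w}.
Proof.
move=> mA e0 C0 le; exists (lim_sup_set A); split.
- by apply: bigcap_measurable => // n _; apply: bigcup_measurable.
- apply: lim_sup_set_cvg0 => //.
  apply: (@le_lt_trans _ _ (C * (1 + eta^-1))%:E); last exact: ltry.
  apply: lime_le; first by apply: is_cvg_nneseries.
  apply: nearW => n; rewrite (eq_bigr (fun k => (Pr P (A k))%:E)); last by move=> k _; apply: PrE.
  rewrite sumEFin lee_fin; apply: le_trans (ler_wpM2l C0 (powR_partial_sum n e0)).
  by rewrite big_mkord mulr_sumr; apply: ler_sum.
move=> w nK n _; apply: contrapT => no; apply: nK; exists n => k nk Ak; apply: no.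
by exists k.
Qed.

End Borel.

Lemma variance_charges (R : realType) d0 (T : measurableType d0) (P : probability T R)
    (X : {RV P >-> R}) (lamstar : R) :
  ('E_P[X] = 0)%E -> (0 < 'V_P[X])%E -> P [set w | lamstar < `|X w|] = 0%E ->
  exists2 de : R, 0 < de & 0 < Pr P (X @^-1` [set v | de <= `|clip lamstar v|]).
Proof.
move=> EX VX bd; apply: contrapT => no.
have mX : measurable_fun setT X by exact: measurable_funPT.
have mD de : measurable (X @^-1` [set v | de <= `|clip lamstar v|]).
  rewrite -[X in measurable X]setTI.
  have /(_ measurableT [set true]) : measurable_fun setT (fun w => de <= `|clip lamstar (X w)|).
    apply: measurable_fun_ler => //; apply: measurableT_comp => //.
    by apply: measurableT_comp => //; exact: measurable_clip.
  by apply.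
have ae1 : {ae P, forall w, forall k : nat, ~ k.+1%:R^-1 <= `|clip lamstar (X w)|}.
  apply: ae_foralln => k; exists (X @^-1` [set v | k.+1%:R^-1 <= `|clip lamstar v|]); split => //.
    apply: (etrans (PrE P (mD _))); congr (_%:E); apply/eqP; rewrite eq_le Pr_ge0 andbT leNgt.
    by apply/negP => p0; apply: no; exists k.+1%:R^-1.
  by move=> w /= /contrapT.
have ae2 : {ae P, forall w, ~ lamstar < `|X w|}.
  exists [set w | lamstar < `|X w|]; split => //.
    rewrite -[X in measurable X]setTI.
    have /(_ measurableT [set true]) : measurable_fun setT (fun w => lamstar < `|X w|).
      by apply: measurable_fun_ltr => //; apply: measurableT_comp.
    by apply.
  by move=> w /= /contrapT.
have ae0 : {ae P, forall w, X w = 0}.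
  apply: filterS2 ae1 ae2 => w small /negP; rewrite -leNgt => xl.
  apply/eqP; apply: contrapT => /negP; rewrite -normr_gt0 => x0.
  apply: (small (Num.truncn `|X w|^-1)); rewrite clip_id // -[X in _ <= X]invrK lef_pV2 ?posrE ?invr_gt0 //.
  by rewrite ltW // real_truncnS_gt // num_real.
move: VX; suff -> : ('V_P[X] = 0)%E by rewrite ltxx.
rewrite /variance unlock EX /= unlock -[RHS](integral0_eq P (D := setT) (f := fun=> 0%E)) //.
apply: ae_eq_integral => //.
  apply/measurable_EFinP; apply: measurable_funM; apply: measurable_funB => //.
apply: filterS ae0 => w xw _ /=; rewrite -/(X w) fctE /= xw.
by rewrite subrr mulr0.
Qed.

Section Escape.
Variables (R : realType) (d : nat) (beta lamstar : R).
Hypotheses (d2 : (2 <= d)%N) (lam0 : 0 < lamstar).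
Hypotheses (beta1 : 8 * d%:R * lamstar <= beta) (beta2 : 8 * d%:R * (entropy d)%:R <= beta).
Context d0 (T : measurableType d0) (P : probability T R).
Variable lam : site d -> {RV P >-> R}.
Hypothesis iid : iid_field lam.
Hypothesis sym : forall B : set R, measurable B ->
  P (lam (origin d) @^-1` B) = P ((fun w => - lam (origin d) w) @^-1` B).
Variable de : R.
Hypothesis de0 : 0 < de.
Let p := Pr P (lam (origin d) @^-1` [set v | de <= `|clip lamstar v|]).
Hypothesis p0 : 0 < p.

Definition window_event n (a b : R) : set T := [set w | in_window beta lamstar n a b (lam^~ w)].

Lemma measurable_window n (a b : R) : measurable (window_event n a b).
Proof. by apply: (window_cylinder beta lamstar d2 n a b).2 => z; exact: measurable_funPT. Qed.

Lemma window_small n (a : R) k : 0 < a ->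
  Pr P (window_event n a (a * (1 + 2 * de) ^+ k)) <=
  k%:R * ((1 + p^-1) / 2 / Num.sqrt (n.+1 ^ d.-1)%:R).
Proof.
move=> a0; set q := 1 + 2 * de; have q0 : 0 < q by rewrite addr_gt0 // mulr_gt0.
elim: k => [|k IH].
  rewrite mul0r expr0 mulr1 (_ : window_event n a a = set0) ?/Pr ?measure0 //.
  by apply/seteqP; split => // w; rewrite /window_event /in_window /= => /andP[/le_lt_trans h /h]; rewrite ltxx.
have aq : 0 < a * q ^+ k by rewrite mulr_gt0 // exprn_gt0.
have sub : window_event n a (a * q ^+ k.+1) `<=`
    window_event n a (a * q ^+ k) `|` window_event n (a * q ^+ k) (a * q ^+ k * q).
  move=> w; rewrite /window_event /in_window /= exprSr mulrA => /andP[-> ->]; rewrite andbT /=.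
  by case: ltP; [left|right].
have mw := measurable_window.
have l1 := Pr_sub P (mw _ _ _) (measurableU _ _ (mw _ _ _) (mw _ _ _)) sub.
apply: (le_trans l1).
apply: le_trans (PrU _ (mw _ _ _) (mw _ _ _)) _.
rewrite -natr1 mulrDl mul1r; apply: lerD IH _.
pose i0 : 'I_d := Ordinal (ltnW d2).
apply: le_trans (anti_concentration d2 lam0 beta1 beta2 iid sym n i0 aq de0 p0) _.
have c0 : 0 < (1 + p^-1) / 2 by rewrite divr_gt0 // addr_gt0 ?invr_gt0.
rewrite ler_pM2l // lef_pV2 ?posrE ?sqrtr_gt0 ?ltr0n ?expn_gt0 // ler_sqrt // ler_nat.
apply: leqW; have := card_bottom_face n i0; rewrite -[in X in _ = X](prednK (ltnW d2)) expnSr.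
by move/eqP; rewrite eqn_pmul2r // => /eqP ->.
Qed.

Lemma ratio_escapes (M : nat -> nat) (c eta : R) : 0 < c -> 0 < eta ->
  (forall k, c * k.+1%:R `^ (1 + eta) <= Num.sqrt (M k.+1 ^ d.-1)%:R) ->
  {ae P, forall w, forall kappa : nat, exists K, forall k, (K <= k)%N ->
    ~~ in_window beta lamstar (M k).-1 kappa.+1%:R^-1 kappa.+1%:R (lam^~ w)}.
Proof.
move=> c0 e0 growth; apply: ae_foralln => kappa.
pose a : R := kappa.+1%:R^-1; have a0 : 0 < a by rewrite invr_gt0.
pose J := (Num.truncn (kappa.+1%:R ^+ 2 / (2 * de))).+1.
have cover : kappa.+1%:R <= a * (1 + 2 * de) ^+ J.
  rewrite mulrC ler_pdivlMr // -expr2.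
  have := @bernoulli_exp R (2 * de) J (ltW (mulr_gt0 (ltr0n _ 2) de0)).
  apply: le_trans; apply: le_trans (_ : J%:R * (2 * de) <= _); last by rewrite lerDr.
  by rewrite -ler_pdivrMr ?mulr_gt0 // ltW // real_truncnS_gt // num_real.
pose B k := window_event (M k.+1).-1 a kappa.+1%:R.
have mB k : measurable (B k) by exact: measurable_window.
pose C := J%:R * ((1 + p^-1) / 2) / c.
have C0 : 0 <= C.
  by rewrite divr_ge0 ?(ltW c0) // mulr_ge0 // divr_ge0 // addr_ge0 // invr_ge0 ltW.
have leB k : Pr P (B k) <= C * k.+1%:R `^ (- (1 + eta)).
  have Mk : (0 < M k.+1)%N.
    rewrite lt0n; apply/eqP => M0; have := growth k.
    rewrite M0 exp0n ?sqrtr0; last by case: (d) d2 => [|[]].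
    by rewrite leNgt mulr_gt0 // powR_gt0.
  have sub : B k `<=` window_event (M k.+1).-1 a (a * (1 + 2 * de) ^+ J).
    by move=> w; rewrite /B /window_event /in_window /= => /andP[-> /lt_le_trans ->].
  apply: (le_trans (Pr_sub P (mB k) (measurable_window _ _ _) sub)).
  apply: le_trans (window_small _ _ a0) _; rewrite prednK // /C -!mulrA ler_wpM2l //.
  rewrite ler_wpM2l ?addr_ge0 ?invr_ge0 ?(ltW p0) // ler_pM2l ?invr_gt0 //.
  have x0 : 0 < k.+1%:R `^ (1 + eta) :> R by rewrite powR_gt0.
  rewrite powRN -invfM lef_pV2 ?posrE ?mulr_gt0 //; last first.
    by apply: lt_le_trans (growth k); rewrite mulr_gt0.
apply: filterS (borel_cantelli mB e0 C0 leB) => w [K nB]; exists K.+1 => -[//|k] Kk.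
by apply/negP; apply: nB.
Qed.

End Escape.

Lemma shift_face (n m u v : nat) : (n.+2 <= m)%N -> (u <= n)%N ->
  (u%:Z + (n.+1 %/ 2)%:Z + 1 - n.+1%:Z = v%:Z + (m.+1 %/ 2)%:Z + 1 - m.+1%:Z)%R ->
  (0 < v < m)%N.
Proof. lia. Qed.

Lemma face_sites_disjoint d n m (z : site d) : (n.+2 <= m)%N ->
  z \in face_sites d n -> z \notin face_sites d m.
Proof.
move=> nm /mapP[x _ ->]; apply/negP => /mapP[y]; rewrite mem_enum => /existsP[i fi] e.
have ei := congr1 (fun f : site d => f i) e; rewrite !ffunE in ei.
have := shift_face nm (ltn_ord (x i)) ei.
by case/orP: fi => /eqP => [->|[->]]; rewrite ?ltnn ?andbF.
Qed.

Section SignChanges.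
Variables (R : realType) (d : nat) (beta lamstar : R).
Hypotheses (d2 : (2 <= d)%N) (lam0 : 0 < lamstar).
Hypotheses (beta1 : 8 * d%:R * lamstar <= beta) (beta2 : 8 * d%:R * (entropy d)%:R <= beta).
Context d0 (T : measurableType d0) (P : probability T R).
Variable lam : site d -> {RV P >-> R}.
Hypothesis iid : iid_field lam.
Hypothesis sym : forall B : set R, measurable B ->
  P (lam (origin d) @^-1` B) = P ((fun w => - lam (origin d) w) @^-1` B).
Implicit Types (h : site d -> R).

Definition below (s : bool) n h : bool :=
  ratio_lt beta lamstar n 1 (if s then h else flip_signs predT h).

Lemma below_cylinder s n : cylinder (face_sites d n) (fun h => below s n h).
Proof.
rewrite /below; case: s; first exact: ratio_cylinder.
exact: (cylinder_flip predT (ratio_cylinder beta lamstar d2 n 1)).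
Qed.

Lemma belowE s n h : below s n h =
  if s then phase_ratio beta lamstar n h < 1 else 1 < phase_ratio beta lamstar n h.
Proof.
rewrite /below; case: s => //; rewrite /ratio_lt ratio_flip // invf_lt1 //.
exact: ratio_gt0.
Qed.

Lemma below_flip s n h : below s n (flip_signs [in face_sites d n] h) = below (~~ s) n h.
Proof.
have p := ratio_gt0 beta lamstar d2 n h.
by rewrite !belowE ratio_flip //; case: s; rewrite /= ?invf_lt1 ?invf_gt1.
Qed.

Variables (s : bool) (sz : nat -> nat).
Hypothesis gap : forall j, (sz j + 2 <= sz j.+1)%N.

Fixpoint run m h : Prop := if m is m'.+1 then run m' h /\ below s (sz m') h else True.
Fixpoint run_sites m : seq (site d) :=
  if m is m'.+1 then run_sites m' ++ face_sites d (sz m') else [::].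

Lemma run_cylinder m : cylinder (run_sites m) (run m).
Proof.
elim: m => [|m IH] /=.
  by split => // d1 T1 X _; rewrite (_ : [set _ | _] = setT) //; apply/seteqP; split.
apply: cylinderI; [apply: cylinder_sub IH|apply: cylinder_sub (below_cylinder s (sz m))] => z zS;
  by rewrite mem_cat zS ?orbT.
Qed.

Lemma run_sites_fresh m z : z \in run_sites m -> z \notin face_sites d (sz m).
Proof.
have inc j k : (sz j + 2 <= sz (j + k.+1))%N.
  elim: k => [|k IH]; first by rewrite addn1.
  by rewrite [(j + _)%N]addnS; apply: leq_trans IH _; apply: leq_trans (gap _); rewrite leq_addr.
have far j : (j < m)%N -> ((sz j).+2 <= sz m)%N.
  by move=> jm; rewrite -(subnKC jm) addSnnS -addn2.
have : forall j, (j <= m)%N -> z \in run_sites j -> z \notin face_sites d (sz m); last exact.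
elim=> [//|j IH] jm /=; rewrite mem_cat => /orP[]; first exact: IH (ltnW jm).
exact: face_sites_disjoint (far _ jm).
Qed.

Let ev m : set T := [set w | run m (lam^~ w)].

Let mev m : measurable (ev m).
Proof. by apply: (run_cylinder m).2 => z; exact: measurable_funPT. Qed.

Lemma run_small m : Pr P (ev m) <= (2 ^+ m)^-1.
Proof.
elim: m => [|m IH].
  rewrite (_ : ev 0 = setT) ?PrT ?expr0 ?invr1 //; exact/seteqP.
pose Phi h := run m h /\ below s (sz m) h; pose Psi h := run m h /\ below (~~ s) (sz m) h.
have cP : cylinder (run_sites m.+1) Phi by exact: (run_cylinder m.+1).
pose A := [set w | Psi (lam^~ w)].
have eA : [set w | Phi (flip_signs [in face_sites d (sz m)] (lam^~ w))] = A.
  apply/seteqP; split => w; rewrite /A /Phi /Psi /= below_flip => -[r b]; split => //;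
    apply: (run_cylinder m).1 r => z /run_sites_fresh /negPf zf; by rewrite /flip_signs ifF.
have mA : measurable A.
  by rewrite -eA; apply: (cylinder_flip _ cP).2 => z; exact: measurable_funPT.
have PA : Pr P A = Pr P (ev m.+1).
  by rewrite /Pr -eA -(flip_invariance iid sym _ cP).
have dis : Pr P (ev m.+1 `|` A) = Pr P (ev m.+1) + Pr P A.
  apply: EFin_inj; rewrite EFinD -!PrE //; last exact: measurableU.
  apply: measureU => //; apply/seteqP; split => // w [[_ b] [_]].
  move: b; rewrite !belowE; case: (s) => /= /lt_trans h /h; by rewrite ltxx.
have : Pr P (ev m.+1 `|` A) <= Pr P (ev m).
  by apply: Pr_sub => //; [exact: measurableU|move=> w [] []].
rewrite dis PA => h; have {}h := le_trans h IH.
rewrite exprS invfM ler_pdivlMl //; apply: le_trans h.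
by rewrite mulrDl mul1r.
Qed.

Lemma run_negligible : P.-negligible [set w | forall j, below s (sz j) (lam^~ w)].
Proof.
have mB : measurable (\bigcap_m ev m) by exact: bigcap_measurable.
apply: (@negligibleS _ _ _ P (\bigcap_m ev m)).
  move=> w b m _; rewrite /ev /=; elim: m => //= m IH; split => //; exact: b.
apply/negligibleP => //; apply: (etrans (PrE P mB)); congr (_%:E); apply/eqP; rewrite eq_le Pr_ge0 andbT.
apply/ler_addgt0Pr => e e0; rewrite add0r.
pose m := (Num.truncn e^-1).+1.
apply: le_trans (Pr_sub P mB (mev m) _) _; first exact: bigcap_inf.
apply: le_trans (run_small m) _; rewrite -[X in _ <= X]invrK lef_pV2 ?posrE ?invr_gt0 ?exprn_gt0 //.
apply: le_trans (ltW (real_truncnS_gt (num_real _))) _.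
by rewrite -natrX ler_nat ltnW // ltn_expl.
Qed.

End SignChanges.

Section Recurrence.
Variables (R : realType) (d : nat) (beta lamstar : R).
Hypothesis d2 : (2 <= d)%N.
Context d0 (T : measurableType d0) (P : probability T R).
Variable lam : site d -> {RV P >-> R}.

Lemma signs_recur s (M : nat -> nat) : iid_field lam ->
  (forall B : set R, measurable B ->
    P (lam (origin d) @^-1` B) = P ((fun w => - lam (origin d) w) @^-1` B)) ->
  (forall N, exists K, forall k, (K <= k)%N -> (N <= M k)%N) ->
  {ae P, forall w, forall K, exists2 k, (K <= k)%N & ~~ below beta lamstar s (M k).-1 (lam^~ w)}.
Proof.
move=> iid sym Minf; apply: ae_foralln => K.
have /choice[g gP] : forall N, exists k, (K <= k)%N /\ (N <= M k)%N.
  move=> N; have [K' K'P] := Minf N; exists (maxn K K').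
  by rewrite leq_maxl; split => //; apply: K'P; rewrite leq_maxr.
pose idx := fix idx j := if j is j'.+1 then g (M (idx j')).+3 else g 0.
have gap j : ((M (idx j)).-1 + 2 <= (M (idx j.+1)).-1)%N.
  have [_ /=] := gP (M (idx j)).+3; rewrite -/idx.
  case: (M (g _)) => // v; rewrite /= ltnS => h; apply: leq_trans h.
  by rewrite addn2; case: (M _).
have := run_negligible beta lamstar d2 iid sym s gap.
apply: negligibleS => w /= none j; apply: contrapT => nb; apply: none.
exists (idx j); last exact/negP.
by case: j nb => [|j] _; exact: (gP _).1.
Qed.

End Recurrence.

(** * Limit points *)

Section WeakLimits.
Variables (R : realType) (d : nat) (beta lamstar : R).
Hypotheses (d2 : (2 <= d)%N) (lam0 : 0 < lamstar).
Hypotheses (beta1 : 8 * d%:R * lamstar <= beta) (beta2 : 8 * d%:R * (entropy d)%:R <= beta).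

Lemma near_plus (f : config d -> R) (e : R) : local_fun f -> 0 < e ->
  exists kappa N0 : nat, forall n m (g : boxpt d n.+1 -> R), (N0 <= m)%N -> (m < n)%N ->
    (forall x, `|g x| <= lamstar) -> Zplus beta (fun x => - g x) / Zplus beta g <= kappa.+1%:R^-1 ->
    `|gibbs_exp beta g f - plus_exp beta m f| <= e.
Proof.
move=> lf e0; have [M fM] := local_bounded lf; have [S fS] := lf.
have M0 : 0 <= M by apply: le_trans (normr_ge0 _) (fM (fun=> true)).
pose L := \max_(x <- S) \max_(k < d) `|x k|%N.
have SL x k : x \in S -> (`|x k|%N <= L)%N.
  by move=> xS; rewrite /L; apply: (bigmaxn_sup_seq _ xS) => //; exact: leq_bigmax.
pose c : R := 4 * M * (size S)%:R; have c0 : 0 <= c by rewrite !mulr_ge0.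
pose r := (Num.truncn (2 * c / e)).+1.
have small (a : R) (j : nat) : 0 <= a -> (Num.truncn (2 * a / e) < j)%N -> a / j%:R <= e / 2.
  move=> a0 jt; have j0 : 0 < j%:R :> R by rewrite ltr0n; case: j jt.
  rewrite ler_pdivrMr // mulrAC ler_pdivlMr // mulrC [e * _]mulrC -ler_pdivrMr //.
  by apply: le_trans (ltW (real_truncnS_gt (num_real _))) _; rewrite ler_nat.
exists (Num.truncn (2 * (2 * M) / e)), (4 * (L + 5 * r) + 8)%N => n m g Nm mn gb weight.
have := Eplus_close d2 lam0 beta1 beta2 fS fM SL gb (ltn0Sn _ : (0 < r)%N) Nm mn.
have -> : 2 * M * ((size S)%:R * (2 * 2^-1 ^+ r)) = c / 2 ^+ r.
  by rewrite exprVn /c; ring.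
have le1 : c / 2 ^+ r <= e / 2.
  have sm : c / r%:R <= e / 2 by exact: small c0 (ltnSn _).
  apply: (le_trans _ sm); apply: ler_wpM2l => //.
  by rewrite lef_pV2 ?posrE ?exprn_gt0 ?ltr0n // -natrX ler_nat ltnW // ltn_expl.
move=> /le_trans /(_ le1) near1.
have near2 : `|gibbs_exp beta g f - Eplus beta g f| <= e / 2.
  apply: le_trans (gibbs_near_plus beta d2 g fM) _.
  apply: le_trans (_ : 2 * M / (Num.truncn (2 * (2 * M) / e)).+1%:R <= _); last first.
    exact: (small _ _ (mulr_ge0 _ M0) (ltnSn _)).
  by rewrite ler_wpM2l // mulr_ge0.
rewrite [e]splitr -(subrKA (Eplus beta g f)).
exact: le_trans (ler_normD _ _) (lerD near2 near1).
Qed.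

Lemma local_flip (f : config d -> R) : local_fun f -> local_fun (fun z => f (flip_conf z)).
Proof.
by move=> [S fS]; exists S => s t e; apply: fS => z zS; rewrite /flip_conf e.
Qed.

Lemma flip_large (f : config d -> R) : local_fun f -> exists N0 : nat, forall n (g : boxpt d n.+1 -> R),
  (N0 <= n)%N -> gibbs_exp beta g (fun z => f (flip_conf z)) = gibbs_exp beta (fun x => - g x) f.
Proof.
move=> [S fS]; exists (\max_(x <- S) \max_(k < d) (2 * `|x k|)%N) => n g Nn.
apply: (gibbs_flip beta g fS) => x k xS; rewrite ltnS; apply: leq_trans Nn.
by apply: (bigmaxn_sup_seq _ xS) => //; exact: (leq_bigmax (F := fun k => (2 * `|x k|)%N)).
Qed.

Variable h : site d -> R.
Hypothesis hb : forall x, `|h x| <= lamstar.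

Definition phase_exp (b : bool) m (f : config d -> R) : R :=
  if b then plus_exp beta m f else minus_exp beta m f.

Definition dominated (b : bool) (c : R) n : bool :=
  if b then c <= phase_ratio beta lamstar n h else phase_ratio beta lamstar n h <= c^-1.

Let ratioE n : phase_ratio beta lamstar n h =
  Zplus beta (fun x : boxpt d n.+1 => h (site_of x)) / Zplus beta (fun x : boxpt d n.+1 => - h (site_of x)).
Proof.
have e : @box_field R d lamstar n h = fun x => h (site_of x) by apply/funext => x; exact: clip_id.
by rewrite /phase_ratio e.
Qed.

Lemma near_phase (b : bool) (f : config d -> R) (e : R) : local_fun f -> 0 < e ->
  exists kappa N0 : nat, forall n m, (N0 <= m)%N -> (m < n)%N -> dominated b kappa.+1%:R n ->
    `|rf_exp beta h n.+1 f - phase_exp b m f| <= e.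
Proof.
move=> lf e0; case: b.
  have [kappa [N0 near]] := near_plus lf e0; exists kappa, N0 => n m Nm mn; rewrite /dominated ratioE => dom.
  apply: near => //.
  by rewrite -invf_div lef_pV2 ?posrE ?divr_gt0 ?Zplus_gt0.
have [kappa [N0 near]] := near_plus (local_flip lf) e0; have [N1 flip] := flip_large lf.
exists kappa, (maxn N0 N1.+1) => n m; rewrite geq_max => /andP[Nm Nm1] mn; rewrite /dominated ratioE => dom.
case: m Nm Nm1 mn => // m Nm Nm1 mn.
have -> : phase_exp false m.+1 f = plus_exp beta m.+1 (fun z => f (flip_conf z)).
  by rewrite /plus_exp flip.
have -> : rf_exp beta h n.+1 f = gibbs_exp beta (fun x : boxpt d n.+1 => - h (site_of x)) (fun z => f (flip_conf z)).
  rewrite flip; last exact: (@leq_trans m _ _ Nm1 (ltnW (ltnW mn))).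
  by rewrite /rf_exp; congr (gibbs_exp _ _ _); apply/funext => x; rewrite opprK.
apply: near => // [x|]; first by rewrite normrN hb.
by rewrite (_ : (fun x => - - _) = fun x => h (site_of x)) //; apply/funext => x; rewrite opprK.
Qed.

Variable M : nat -> nat.
Hypothesis Minf : forall N, exists K, forall k, (K <= k)%N -> (N <= M k)%N.
Hypothesis escape : forall kappa : nat, exists K, forall k, (K <= k)%N ->
  ~~ in_window beta lamstar (M k).-1 kappa.+1%:R^-1 kappa.+1%:R h.

Lemma dominated_late (b : bool) (kappa N : nat) : exists K, forall k, (K <= k)%N ->
  dominated b 1 (M k).-1 -> dominated b kappa.+1%:R (M k).-1 /\ (N < M k)%N.
Proof.
have [K1 h1] := Minf N.+1; have [K2 h2] := escape kappa.
exists (maxn K1 K2) => k; rewrite geq_max => /andP[/h1 Nk /h2 esc] dom; split => //.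
have k1 : 1 <= kappa.+1%:R :> R by rewrite ler1n.
have k2 : kappa.+1%:R^-1 <= 1 :> R by rewrite invf_le1 // ltr0n.
move: esc dom; rewrite /in_window negb_and -ltNge -leNgt /dominated; case: b; rewrite ?invr1.
  by case/orP => // /lt_le_trans /(_ k2) lt1 /(lt_le_trans lt1); rewrite ltxx.
case/orP => [/ltW //|ge /[dup] le1 /(le_trans ge) k3].
by apply: le_trans le1 _; rewrite invf_ge1 // ltr0n.
Qed.

Lemma dominated_mono b (k1 k2 n : nat) : (k1 <= k2)%N -> dominated b k2.+1%:R n -> dominated b k1.+1%:R n.
Proof.
move=> k12; have le : k1.+1%:R <= k2.+1%:R :> R by rewrite ler_nat.
rewrite /dominated; case: b => h2; first exact: le_trans le h2.
by apply: le_trans h2 _; rewrite lef_pV2 ?posrE ?ltr0n.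
Qed.

Lemma limit_along (b : bool) (phi : nat -> nat) nu : (forall k, (phi k < phi k.+1)%N) ->
  weak_limit (fun k => rf_exp beta h (M (phi k))) nu ->
  (forall K, exists2 k, (K <= k)%N & dominated b 1 (M (phi k)).-1) ->
  weak_limit (phase_exp b) nu.
Proof.
move=> mono lim io f lf; apply/cvgrPdist_le => e e0; have e2 : 0 < e / 2 by rewrite divr_gt0.
have [kappa [N0 near]] := near_phase b lf e2.
have phi_ge k : (k <= phi k)%N by elim: k => // k IH; exact: leq_ltn_trans IH (mono k).
have /cvgrPdist_le /(_ _ e2) [K1 _ K1P] := lim f lf.
near=> m; have Nm : (N0 <= m)%N by near: m; exists N0.
have [K2 K2P] := dominated_late b kappa m.+1.
have [k + dom] := io (maxn K1 K2); rewrite geq_max => /andP[Kk1 Kk2].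
have [dom' Mk] := K2P _ (leq_trans Kk2 (phi_ge k)) dom.
have mM : (m < (M (phi k)).-1)%N by case: (M _) Mk.
have := near _ m Nm mM dom'; rewrite prednK; last by apply: leq_trans Mk.
move=> d1; have d3 := K1P k Kk1.
rewrite [e]splitr -(subrKA (rf_exp beta h (M (phi k)) f)).
exact: le_trans (ler_normD _ _) (lerD d3 d1).
Unshelve. all: by end_near.
Qed.

Lemma phase_is_limit_point (b : bool) nu :
  (forall K, exists2 k, (K <= k)%N & dominated b 1 (M k).-1) ->
  weak_limit (phase_exp b) nu -> weak_limit_point (fun k => rf_exp beta h (M k)) nu.
Proof.
move=> io lim.
have /choice[g gP] : forall K, exists k, [/\ (K <= k)%N, dominated b K.+1%:R (M k).-1 & (K.+1 < M k)%N].
  move=> K; have [K1 K1P] := dominated_late b K K.+1.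
  have [k + dom] := io (maxn K K1); rewrite geq_max => /andP[Kk /K1P /(_ dom) [d1 d3]].
  by exists k.
pose phi := fix phi j := if j is j'.+1 then g (phi j').+1 else g 0.
have phi_ge j : exists2 K, (j <= K)%N & phi j = g K.
  elim: j => [|j [K jK e]]; first by exists 0%N.
  exists (phi j).+1 => //; rewrite ltnS e; apply: leq_trans jK _; by have [] := gP K.
exists phi; split => [k|f lf]; first by have [] := gP (phi k).+1.
apply/cvgrPdist_le => e e0; have e2 : 0 < e / 2 by rewrite divr_gt0.
have [kappa [N0 near]] := near_phase b lf e2.
have /cvgrPdist_le /(_ _ e2) [K1 _ K1P] := lim f lf.
pose m := maxn N0 K1; have d1 := K1P m (leq_maxr _ _).
exists (maxn kappa m) => // j /=; rewrite geq_max => /andP[kj mj].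
have [K jK ->] := phi_ge j; have [_ dom Mk] := gP K.
have mM : (m < (M (g K)).-1)%N.
  by apply: leq_ltn_trans (leq_trans mj jK) _; case: (M _) Mk.
have := near _ m (leq_maxl _ _) mM (dominated_mono (leq_trans kj jK) dom).
rewrite prednK; last by apply: leq_trans Mk.
rewrite distrC => d3; rewrite [e]splitr -(subrKA (phase_exp b m f)).
exact: le_trans (ler_normD _ _) (lerD d1 d3).
Qed.

Lemma limit_points (rec : forall b K, exists2 k, (K <= k)%N & dominated b 1 (M k).-1) :
  limit_points_are_pm beta (fun k => rf_exp beta h (M k)).
Proof.
move=> nu; split => [[phi [mono lim]]|[lim|lim]]; last 2 first.
- exact: (phase_is_limit_point (rec true) lim).
- exact: (phase_is_limit_point (rec false) lim).
have [io|no] := pselect (forall K, exists2 k, (K <= k)%N & dominated true 1 (M (phi k)).-1).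
  by left; apply: (limit_along mono lim io).
right; apply: (limit_along (b := false) mono lim) => K; apply: contrapT => no'.
apply: no => K'; exists (maxn K K'); first exact: leq_maxr.
have [//|] := boolP (dominated true 1 _); rewrite /dominated -ltNge => /ltW lt.
by case: no'; exists (maxn K K'); rewrite ?leq_maxl // /dominated invr1.
Qed.

End WeakLimits.

Section AlmostSure.
Variables (R : realType) (d : nat) (beta lamstar : R).
Hypotheses (d2 : (2 <= d)%N) (lam0 : 0 < lamstar).
Hypotheses (beta1 : 8 * d%:R * lamstar <= beta) (beta2 : 8 * d%:R * (entropy d)%:R <= beta).
Context d0 (T : measurableType d0) (P : probability T R).
Variable lam : site d -> {RV P >-> R}.
Hypothesis iid : iid_field lam.
Hypothesis sym : forall B : set R, measurable B ->
  P (lam (origin d) @^-1` B) = P ((fun w => - lam (origin d) w) @^-1` B).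
Hypothesis bounded : P [set w | lamstar < `|lam (origin d) w|] = 0%E.

Lemma fields_bounded : {ae P, forall w, forall x, `|lam x w| <= lamstar}.
Proof.
have mD : measurable [set v : R | lamstar < `|v|].
  rewrite -[X in measurable X]setTI.
  have /(_ measurableT [set true]) : measurable_fun setT (fun v : R => lamstar < `|v|).
    by apply: measurable_fun_ltr.
  by apply.
have one x : {ae P, forall w, `|lam x w| <= lamstar}.
  exists (lam x @^-1` [set v | lamstar < `|v|]); split.
  - by rewrite -[X in measurable X]setTI; apply: measurable_funPT.
  - by rewrite iid.1.
  - by move=> w /= /negP; rewrite -ltNge.
have enum (n : nat) : {ae P, forall w, if @unpickle (site d) n is Some x then `|lam x w| <= lamstar else true}.
  by case: unpickle => [x|]; [exact: one|exact: aeW].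
by apply: filterS (ae_foralln enum) => w h x; have := h (pickle x); rewrite pickleK.
Qed.

Lemma limit_points_ae (M : nat -> nat) (c eta : R) :
  ('E_P[lam (origin d)] = 0)%E -> (0 < 'V_P[lam (origin d)])%E -> 0 < c -> 0 < eta ->
  (forall k, c * k.+1%:R `^ (1 + eta) <= Num.sqrt (M k.+1 ^ d.-1)%:R) ->
  (forall N, exists K, forall k, (K <= k)%N -> (N <= M k)%N) ->
  {ae P, forall w, limit_points_are_pm beta (fun k => rf_exp beta (fun x => lam x w) (M k))}.
Proof.
move=> EX VX c0 e0 growth Minf.
have [de de0 p0] := variance_charges EX VX bounded.
have esc := ratio_escapes d2 lam0 beta1 beta2 iid sym de0 p0 c0 e0 growth.
have rec b := signs_recur beta lamstar d2 b iid sym Minf.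
apply: filterS2 (filterI fields_bounded esc) (filterI (rec true) (rec false)) => w [hb he] [r1 r2].
apply: (limit_points d2 lam0 beta1 beta2 hb Minf he) => b K.
case: b; [have [k Kk nb] := r1 K|have [k Kk nb] := r2 K]; exists k => //; move: nb;
  by rewrite belowE // /dominated -leNgt ?invr1.
Qed.

End AlmostSure.

Lemma sqrt_exp_powR (R : realType) (m e : nat) : Num.sqrt (m ^ e)%:R = m%:R `^ (e%:R / 2) :> R.
Proof.
by rewrite natrX -powR12_sqrt ?exprn_ge0 // -powR_mulrn // -powRrM.
Qed.

Lemma volume_growth (R : realType) (d k : nat) : (3 < d)%N ->
  1 * k.+1%:R `^ (1 + 2^-1) <= Num.sqrt (k.+1 ^ d.-1)%:R :> R.
Proof.
move=> d3; rewrite mul1r sqrt_exp_powR ler_powR ?ler1n //.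
have -> : 1 + 2^-1 = 3%:R / 2 :> R by lra.
by rewrite ler_pM2r ?invr_gt0 // ler_nat -ltnS prednK // (leq_trans _ d3).
Qed.

(* [(4 - d) (d - 1) = 2] for [d = 2, 3], which is where the subsequence comes from. *)
Lemma critical_exponent (R : realFieldType) (d : nat) (om : R) : (2 <= d)%N -> (d <= 3)%N ->
  1 + om * d.-1%:R / 2 = (4 - d%:R + om) * (d.-1%:R / 2).
Proof. by case: d => [|[|[|[|d]]]] //= _ _; lra. Qed.

Lemma subsequence_growth (R : realType) (d k : nat) (om : R) : (2 <= d)%N -> (d <= 3)%N -> 0 < om ->
  2^-1 `^ (d.-1%:R / 2) * k.+1%:R `^ (1 + om * d.-1%:R / 2) <=
  Num.sqrt (Num.truncn (k.+1%:R `^ (4 - d%:R + om) : R) ^ d.-1)%:R :> R.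
Proof.
move=> d2 d3 om0; rewrite sqrt_exp_powR; set y := k.+1%:R `^ (4 - _ + _).
have s0 : 0 <= 4 - d%:R + om :> R.
  by rewrite addr_ge0 ?(ltW om0) // subr_ge0 ler_nat (leq_trans d3).
have y1 : 1 <= y by rewrite -(powRr0 (k.+1%:R : R)) ler_powR // ler1n.
have -> : k.+1%:R `^ (1 + om * d.-1%:R / 2) = y `^ (d.-1%:R / 2).
  rewrite /y -powRrM; congr (_ `^ _).
  exact: critical_exponent.
rewrite -powRM ?invr_ge0 ?(le_trans ler01 y1) //.
apply: ge0_ler_powR => //; rewrite ?nnegrE ?divr_ge0 ?mulr_ge0 ?invr_ge0 ?(le_trans ler01 y1) //.
have := real_truncnS_gt (num_real y).
have : (1 : R) <= (Num.truncn y)%:R by rewrite ler1n truncn_gt_nat.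
by rewrite -natr1; lra.
Qed.

Lemma subsequence_infinite (R : realType) (d : nat) (om : R) : (d <= 3)%N -> 0 < om ->
  forall N, exists K, forall k, (K <= k)%N -> (N <= Num.truncn (k%:R `^ (4 - d%:R + om) : R))%N.
Proof.
move=> d3 om0 N; exists N.+1 => -[//|k] Nk.
have s1 : 1 <= 4 - d%:R + om :> R.
  have : d%:R <= 3 :> R by rewrite ler_nat.
  lra.
rewrite truncn_ge_nat ?powR_ge0 //; apply: (@le_trans _ _ (k.+1%:R `^ 1)).
  by rewrite powRr1 // ler_nat ltnW.
by rewrite ler_powR // ler1n.
Qed.
Theorem theorem2p1 (R : realType) (d : nat) (lamstar : R) :
  (2 <= d)%N -> 0 < lamstar ->
  exists beta0 : R, forall beta : R, 0 < beta -> beta0 <= beta ->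
  forall (d0 : measure_display) (T : measurableType d0) (P : probability T R)
         (lam : site d -> {RV P >-> R}),
    iid_field lam ->
    (* symmetric distribution *)
    (forall B : set R, measurable B ->
       P (lam (origin d) @^-1` B) = P ((fun w => - lam (origin d) w) @^-1` B)) ->
    (* zero mean, strictly positive variance *)
    ('E_P[lam (origin d)] = 0)%E ->
    (0 < 'V_P[lam (origin d)])%E ->
    (* P(|lam_0| > lamstar) = 0 *)
    P [set w | lamstar < `|lam (origin d) w|] = 0%E ->
    ((3 < d)%N ->
       {ae P, forall w, limit_points_are_pm beta (rf_exp beta (fun x => lam x w))}) /\
    (forall om : R, 0 < om -> (d <= 3)%N ->
       {ae P, forall w, limit_points_are_pm beta
          (fun n => rf_exp beta (fun x => lam x w)
                      (Num.truncn ((n%:R : R) `^ (4 - d%:R + om))))}).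
Proof.
move=> d2 lam0; exists (8 * d%:R * lamstar + 8 * d%:R * (entropy d)%:R) => beta _ betal.
have t0 : 0 <= 8 * d%:R * lamstar by rewrite !mulr_ge0 // ltW.
have t1 : 0 <= 8 * d%:R * (entropy d)%:R :> R by rewrite !mulr_ge0.
have beta1 : 8 * d%:R * lamstar <= beta by apply: le_trans betal; rewrite lerDl.
have beta2 : 8 * d%:R * (entropy d)%:R <= beta by apply: le_trans betal; rewrite lerDr.
move=> d0 T P lam iid sym EX VX bounded; split=> [d3|om om0 d3].
  apply: (limit_points_ae d2 lam0 beta1 beta2 iid sym bounded (M := id) EX VX ltr01 (eta := 2^-1)).
  - by rewrite invr_gt0.
  - by move=> k; apply: volume_growth.
  - by move=> N; exists N.
have e0 : 0 < om * d.-1%:R / 2 by rewrite divr_gt0 // mulr_gt0 // ltr0n -ltnS prednK // ltnW.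
have c0 : 0 < 2^-1 `^ (d.-1%:R / 2) :> R by rewrite powR_gt0 // invr_gt0.
apply: (limit_points_ae d2 lam0 beta1 beta2 iid sym bounded
  (M := fun n => Num.truncn (n%:R `^ (4 - d%:R + om) : R)) EX VX c0 e0).
  by move=> k; apply: subsequence_growth.
exact: subsequence_infinite.
Qed.
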